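(* The stress-energy-momentum tensor $\mathfrak{T}$ of a relativistic electromagnetic fluid has the following three equivalent formulations. (i) For a Lagrangian density $\ell(A,{\rm d}A,w,\varrho,\varsigma,\mathsf{g})$, $$\mathfrak{T}=\Big(\ell-\varrho\frac{\partial\ell}{\partial\varrho}-\varsigma\frac{\partial\ell}{\partial\varsigma}\Big)\delta+w\otimes\frac{\partial\ell}{\partial w}-\frac{\partial\ell}{\partial A}\otimes A-\frac{\partial\ell}{\partial F}\stackrel{\rm tr}{\otimes}F.$$ (ii) If $\ell(A,{\rm d}A,w,\varrho,\varsigma,\mathsf{g})=-\epsilon(\rho,s,E,B,\mathsf{g})\mu(\mathsf{g})-q\rho\,A\cdot u\,\mu(\mathsf{g})$, then $$\mathfrak{T}=\Big[\Big(\epsilon-\frac{\partial\epsilon}{\partial E}\cdot E\Big)\frac1{c^2}u\otimes u^\flat+\frac1c\big(u\otimes S_\epsilon+S_\epsilon^\sharp\otimes u^\flat\big)+\frac{\partial\epsilon}{\partial E}\otimes E-B^\sharp\stackrel{\rm tr}{\otimes}\Big(\frac{\partial\epsilon}{\partial B}\Big)^\flat+\Big(\frac{\partial\epsilon}{\partial\rho}\rho+\frac{\partial\epsilon}{\partial s}s+\frac{\partial\epsilon}{\partial B}:B-\epsilon\Big)\mathsf{P}\Big]\mu(\mathsf{g}),$$ with $S_\epsilon$ the Poynting one-form $S_\epsilon=(-1)^n\frac1c\,\mathbf{i}_{E^\sharp}\mathbf{i}_u\star\big(\frac{\partial\epsilon}{\partial B}\big)^\flat$. (iii) If $\ell(A,{\rm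 d}A,w,\varrho,\varsigma,\mathsf{g})=-\mathfrak{e}(\rho,s,u,F,\mathsf{g})\mu(\mathsf{g})-q\rho\,A\cdot u\,\mu(\mathsf{g})$, then $$\mathfrak{T}=\Big[\Big(\mathfrak{e}-\frac{\partial\mathfrak{e}}{\partial u}\cdot u\Big)\frac1{c^2}u\otimes u^\flat-u\otimes\frac{\partial\mathfrak{e}}{\partial u}+\frac{\partial\mathfrak{e}}{\partial F}\stackrel{\rm tr}{\otimes}F+\Big(\rho\frac{\partial\mathfrak{e}}{\partial\rho}+s\frac{\partial\mathfrak{e}}{\partial s}-\mathfrak{e}\Big)\mathsf{P}\Big]\mu(\mathsf{g}).$$
   Context: $(\mathcal{M},\mathsf{g})$ is an oriented $(n+1)$-dimensional Lorentzian manifold (signature $(-,+,\dots,+)$), $\mu(\mathsf{g})$ its volume form, $\star$ the Hodge star with $(\star\omega)_{\beta\dots}=\frac1{k!}\omega^{\alpha_1\dots\alpha_k}\mu(\mathsf{g})_{\alpha_1\dots\alpha_k\beta\dots}$, $c>0$ the speed of light, $q$ a constant. $w$ is a timelike vector field, $\varrho,\varsigma$ are $(n+1)$-forms (generalized velocity, mass and entropy densities, obtained by push-forward under the world-tube of $\partial_\lambda$ and fixed reference volume forms), $A$ a one-form, $F={\rm d}A$. Proper quantities: $u=cw/\sqrt{-\mathsf{g}(w,w)}$, $\rho=\frac{\sqrt{-\mathsf{g}(w,w)}\,\varrho}{c\,\mu(\mathsf{g})}$, $s=\frac{\sqrt{-\mathsf{g}(w,w)}\,\varsigma}{c\,\mu(\mathsf{g})}$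 (so $\rho\,A\cdot u\,\mu(\mathsf{g})=\varrho\,A\cdot w$); $E=-\frac1c\mathbf{i}_uF\in\Omega^1$, $B=-\frac1c\mathbf{i}_u(\star F)\in\Omega^{n-2}$; equivalently $F=\frac1cu^\flat\wedge E-\frac1c\star(u^\flat\wedge B)$. $\mathsf{P}=\delta+\frac1{c^2}u\otimes u^\flat$, $\delta$ the Kronecker delta. The stress-energy-momentum tensor $\mathfrak{T}$ is the $(1,1)$-tensor density whose divergence gives the fluid equations derived from Hamilton's principle, namely expression (i), which is obtained from the critical conditions of $\delta\int_{\Phi(\mathcal{D})}\ell=0$ for variations $\delta A=-\pounds_\zeta A+\alpha$, $\delta w=-\pounds_\zeta w$, $\delta\varrho=-\pounds_\zeta\varrho$, $\delta\varsigma=-\pounds_\zeta\varsigma$ ($\zeta$ and $\alpha$ an arbitrary vector field and one-form vanishing at the initial and final slices of the world-tube, domain varied along $\zeta$). Standing assumption: $\ell$ is the density of a spacetime covariant theory; in particular $\epsilon$ is covariant, $\epsilon(\rho\circ\psi,s\circ\psi,\psi^*E,\psi^*B,\psi^*\mathsf{g})=\epsilon(\rho,s,E,B,\mathsf{g})\circ\psi$ for all $\psi\in\operatorname{Diff}(\mathcal{M})$, and likewise for $\mathfrak{e}$. The function $\mathfrak{e}(\rho,s,u,F,\mathsf{g})$ is the same energy density $\epsilon$ expressed through $u,F$ instead of $E,B$. Notation. $\partial\ell/\partial\varrho$, $\partial\ell/\partial\varsigma$ are functions; $\partial\ell/\partial w$, $\partial\ell/\partial A$, $\partial\ell/\partial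 F$ dual tensor densities, with $\delta\ell=\frac12\frac{\partial\ell}{\partial F_{\mu\nu}}\delta F_{\mu\nu}$ and similarly $\delta\mathfrak{e}=\frac12\frac{\partial\mathfrak{e}}{\partial F_{\mu\nu}}\delta F_{\mu\nu}$; $\partial\epsilon/\partial B$ is the $(n-2)$-vector field with $\delta\epsilon=\frac{\partial\epsilon}{\partial B}:\delta B$, where $:$ is $\frac1{(n-2)!}$ times full contraction. For a $k$-vector $\pi$ and $k$-form $\omega$, $(\pi\stackrel{\rm tr}{\otimes}\omega)^\mu_\nu=\frac1{(k-1)!}\pi^{\mu\alpha_2\dots\alpha_k}\omega_{\nu\alpha_2\dots\alpha_k}$ (zero if $k=0$); in particular $(\frac{\partial\ell}{\partial F}\stackrel{\rm tr}{\otimes}F)^\mu_\nu=\frac{\partial\ell}{\partial F_{\mu\gamma}}F_{\nu\gamma}$. For tensor products, the first factor carries the upper index $\mu$, the second the lower index $\nu$.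
   Formalization: Covariance of ε is required for diffeomorphisms between open subsets, orientation-reversing ones included, not only for Diff(M): if M has no orientation-reversing diffeomorphism (n=4), ε containing ⋆(E∧B∧B) is covariant but violates (ii). *)

(* Defs.v *)
From HB Require Import structures.
From mathcomp Require Import all_boot all_order all_algebra all_fingroup.
From mathcomp Require Import all_classical all_reals all_analysis.

Set Implicit Arguments.
Unset Strict Implicit.
Unset Printing Implicit Defensive.

Import Order.TTheory GRing.Theory Num.Theory numFieldNormedType.Exports.

Local Open Scope classical_set_scope.
Local Open Scope ring_scope.

(** * C^k and C^infinity germs *)

Fixpoint C_at (R : realType) (V W : normedModType R) (k : nat) (f : V -> W)
    (x : V) : Prop :=
  match k with
  | 0 => {for x, continuous f}
  | k'.+1 => (\forall y \near x, differentiable f y) /\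
             forall v : V, C_at k' ('D_v f) x
  end.

Definition smooth_at (R : realType) (V W : normedModType R) (f : V -> W)
    (x : V) : Prop := forall k, C_at k f x.

(** * Oriented manifolds *)

(** Each point [p] carries a chart [mchart p], with domain [mdom p] and inverse
    [mchartV p], defined around it; these charts form an oriented atlas.  The
    tangent space at [p] is identified with R^N through [mchart p], so that a
    tensor at [p] is an array of components relative to [mchart p], and a tensor
    field is a function on [M].  Jacobian matrices are those of the library:
    ['J f x i j] is the i-th partial derivative of the j-th component of f. *)
Record oriented_manifold (R : realType) (N : nat) := OrientedManifold {
  mcarrier :> topologicalType;
  mhausdorff : hausdorff_space mcarrier;
  mcountable : @second_countable mcarrier;
  mdom : mcarrier -> set mcarrier;
  mchart : mcarrier -> mcarrier -> 'rV[R]_N;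
  mchartV : mcarrier -> 'rV[R]_N -> mcarrier;
  mdom_open : forall p, open (mdom p);
  mdom_self : forall p, mdom p p;
  mim_open : forall p, open (mchart p @` mdom p);
  mchartK : forall p m, mdom p m -> mchartV p (mchart p m) = m;
  mchart_cts : forall p m, mdom p m -> {for m, continuous (mchart p)};
  mchartV_cts : forall p m, mdom p m -> {for mchart p m, continuous (mchartV p)};
  mtrans_smooth : forall p p' m, mdom p m -> mdom p' m ->
    smooth_at (mchart p' \o mchartV p) (mchart p m);
  mtrans_pos : forall p p' m, mdom p m -> mdom p' m ->
    0 < \det ('J (mchart p' \o mchartV p) (mchart p m)) }.

(** * Tensor algebra on R^(n+1) *)

(** Rank k arrays: components of k-forms, k-vectors and their densities. *)
Notation tensor R n k := 'rV[R]_#|{: k.-tuple 'I_n.+1}|.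

Section Algebra.
Variables (R : realType) (n : nat).
Implicit Types (G g : 'M[R]_n.+1) (i j : 'I_n.+1).

Definition coef k (t : tensor R n k) (I : k.-tuple 'I_n.+1) : R :=
  t ord0 (enum_rank I).

Definition mktensor k (f : k.-tuple 'I_n.+1 -> R) : tensor R n k :=
  \row_a f (enum_val a).

Definition coef1 (t : tensor R n 1) i : R := coef t [tuple i].
Definition coef2 (t : tensor R n 2) i j : R := coef t [tuple i; j].
Definition mktensor1 (f : 'I_n.+1 -> R) : tensor R n 1 :=
  mktensor (fun I => f (tnth I ord0)).
Definition mktensor2 (f : 'I_n.+1 -> 'I_n.+1 -> R) : tensor R n 2 :=
  mktensor (fun I => f (tnth I ord0) (tnth I ord_max)).

Definition alternating k (t : tensor R n k) : Prop :=
  forall (s : 'S_k) (I : k.-tuple 'I_n.+1),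
    coef t [tuple tnth I (s a) | a < k] = (-1) ^+ s * coef t I.

(** [G] applied to every index; it lowers (resp. raises) all indices when [G] is
    the metric (resp. its inverse), and is the pull-back of k-forms when [G] is
    a Jacobian matrix. *)
Definition act k G (t : tensor R n k) : tensor R n k :=
  mktensor (fun I =>
    \sum_(J : k.-tuple 'I_n.+1) (\prod_(a < k) G (tnth I a) (tnth J a)) * coef t J).

Definition flat k g (t : tensor R n k) := act g t.
Definition sharp k g (t : tensor R n k) := act (invmx g) t.

(** (1/k!) times full contraction; the duality pairing when k = 1. *)
Definition contr k (p t : tensor R n k) : R :=
  (k`!%:R)^-1 * \sum_(I : k.-tuple 'I_n.+1) coef p I * coef t I.

Definition iprod k (X : tensor R n 1) (t : tensor R n k.+1) : tensor R n k :=
  mktensor (fun J => \sum_i coef1 X i * coef t [tuple of i :: J]).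

(** Row: upper index, given by the first factor; column: lower index. *)
Definition trtens k : tensor R n k -> tensor R n k -> 'M[R]_n.+1 :=
  match k with
  | 0 => fun _ _ => 0
  | k'.+1 => fun p t => \matrix_(i, j) ((k'`!%:R)^-1 *
      \sum_(J : k'.-tuple 'I_n.+1)
        coef p [tuple of i :: J] * coef t [tuple of j :: J])
  end.

(** Lorentzian signature (-,+,...,+). *)
Definition lorentzian g : Prop :=
  g^T = g /\ exists2 P, P \in unitmx &
    P *m g *m P^T = diag_mx (\row_i (if i == ord0 then -1 else 1)).

Definition sqnorm g (v : tensor R n 1) : R := contr v (flat g v).

Definition levi_civita (I : seq 'I_n.+1) : R :=
  if size I == n.+1 then \det (\matrix_(a, b) (nth ord0 I a == b)%:R) else 0.

(** An (n+1)-form (r dx^0 /\ ... /\ dx^n) is encoded by its component r. *)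
Definition vol g : R := Num.sqrt (- \det g).

(** Hodge star of a k-form, as an l-form; meant for k + l = n + 1. *)
Definition hodge k l g (t : tensor R n k) : tensor R n l :=
  mktensor (fun J => (k`!%:R)^-1 *
    \sum_(I : k.-tuple 'I_n.+1) coef (sharp g t) I * (vol g * levi_civita (I ++ J))).

(** dx^{i_1} /\ ... /\ dx^{i_k} *)
Definition wedge_basis k (I : k.-tuple 'I_n.+1) : tensor R n k :=
  mktensor (fun J => \det (\matrix_(a < k, b < k) (tnth I a == tnth J b)%:R)).

(** The alternating tensor df/dt with (delta f = contr (pderiv f t) (delta t))
    for all alternating variations (delta t). *)
Definition pderiv k (f : tensor R n k -> R) (t : tensor R n k) : tensor R n k :=
  mktensor (fun I => 'D_(wedge_basis I) f t).

(** * Pull-backs by a map with Jacobian matrix [G] *)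

Definition pull_form k G (t : tensor R n k) := act G t.
Definition pull_vec G (v : tensor R n 1) := act (invmx G)^T v.
Definition pull_top G (r : R) := \det G * r.
Definition pull_metric G (g : 'M[R]_n.+1) := G *m g *m G^T.
(** k-vector densities and (1,1)-tensor densities *)
Definition pull_mvdens k G (t : tensor R n k) := \det G *: act (invmx G)^T t.
Definition pull_dens11 G (T : 'M[R]_n.+1) :=
  \det G *: ((invmx G)^T *m T *m G^T).

End Algebra.

(** * Calculus on a manifold *)

Section Calculus.
Variables (R : realType) (n : nat) (M : oriented_manifold R n.+1).
Implicit Types (p : M) (i j k : 'I_n.+1).

(** Components in the chart [mchart p] of the tensor field [s], at the point of
    coordinates x. *)
Definition in_chart (X : Type) (pull : 'M[R]_n.+1 -> X -> X) (s : M -> X) p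
    (x : 'rV[R]_n.+1) : X :=
  pull ('J (mchart (mchartV p x) \o mchartV p) x) (s (mchartV p x)).

Definition smooth_field_at (X : normedModType R)
    (pull : 'M[R]_n.+1 -> X -> X) (s : M -> X) p : Prop :=
  smooth_at (in_chart pull s p) (mchart p p).

(** Partial derivative at p, with respect to the i-th coordinate of [mchart p]. *)
Definition pd i (f : 'rV[R]_n.+1 -> R) p : R := 'D_(delta_mx ord0 i) f (mchart p p).

Definition loc1 (pull : 'M[R]_n.+1 -> tensor R n 1 -> tensor R n 1)
    (s : M -> tensor R n 1) p i x : R := coef1 (in_chart pull s p x) i.

Definition ext_d (A : M -> tensor R n 1) : M -> tensor R n 2 := fun p =>
  mktensor2 (fun i j => pd i (loc1 (@pull_form R n 1) A p j) p
                        - pd j (loc1 (@pull_form R n 1) A p i) p).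

Definition lie_form (Z A : M -> tensor R n 1) : M -> tensor R n 1 := fun p =>
  mktensor1 (fun i => \sum_k
    (coef1 (Z p) k * pd k (loc1 (@pull_form R n 1) A p i) p
     + coef1 (A p) k * pd i (loc1 (@pull_vec R n) Z p k) p)).

Definition lie_vec (Z w : M -> tensor R n 1) : M -> tensor R n 1 := fun p =>
  mktensor1 (fun i => \sum_k
    (coef1 (Z p) k * pd k (loc1 (@pull_vec R n) w p i) p
     - coef1 (w p) k * pd k (loc1 (@pull_vec R n) Z p i) p)).

Definition lie_top (Z : M -> tensor R n 1) (r : M -> R) : M -> R := fun p =>
  \sum_k (coef1 (Z p) k * pd k (in_chart (@pull_top R n) r p) p
          + r p * pd k (loc1 (@pull_vec R n) Z p k) p).

(** Divergence of a vector density *)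
Definition div_vdens (J : M -> tensor R n 1) p : R :=
  \sum_k pd k (loc1 (@pull_mvdens R n 1) J p k) p.

(** Divergence (d_m b^{mi}) of a bivector density *)
Definition div_bivdens (b : M -> tensor R n 2) : M -> tensor R n 1 := fun p =>
  mktensor1 (fun i => \sum_k
    pd k (fun x => coef2 (in_chart (@pull_mvdens R n 2) b p x) k i) p).

(** Levi-Civita connection: [christoffel g p k i j] is Gamma^k_{ij}. *)
Definition christoffel (g : M -> 'M[R]_n.+1) p k i j : R :=
  let dg a b d := pd a (fun x => in_chart (@pull_metric R n) g p x b d) p in
  2^-1 * \sum_d invmx (g p) k d * (dg i d j + dg j d i - dg d i j).

(** Covariant divergence of a (1,1)-tensor density *)
Definition div_dens11 (g T : M -> 'M[R]_n.+1) : M -> tensor R n 1 := fun p =>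
  mktensor1 (fun j =>
    \sum_i pd i (fun x => in_chart (@pull_dens11 R n) T p x i j) p
    - \sum_i \sum_k christoffel g p k i j * T p i k).

(** Jacobian matrix at p of a map of M to itself, in the charts at p and at its
    image. *)
Definition tmap (f : M -> M) p : 'M[R]_n.+1 :=
  'J (mchart (f p) \o f \o mchartV p) (mchart p p).

Definition smooth_map_on (U : set M) (f : M -> M) : Prop :=
  forall p, U p -> {for p, continuous f} /\
    smooth_at (mchart (f p) \o f \o mchartV p) (mchart p p).

(** Covariance below is required for diffeomorphisms between open subsets of M,
    which include the global ones; some manifolds have no orientation reversing
    global diffeomorphism. *)
Definition local_diffeo (U : set M) (f : M -> M) : Prop :=
  [/\ open U, open (f @` U), smooth_map_on U f &
      exists2 h, (forall p, U p -> h (f p) = p) & smooth_map_on (f @` U) h].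

End Calculus.

(** * Relativistic electromagnetic fluids *)

(** Arguments (A, F, w, r, s, g), (rho, s, E, B, g) and (rho, s, u, F, g), where
    in the first one r and s are the components of the generalized mass and
    entropy densities, which are (n+1)-forms. *)
Notation lagr_arg R n :=
  (tensor R n%N 1 * tensor R n%N 2 * tensor R n%N 1 * R * R * 'M[R]_n.+1)%type.
Notation eps_arg R n :=
  (R * R * tensor R n%N 1 * tensor R n%N (n - 2) * 'M[R]_n.+1)%type.
Notation en_arg R n :=
  (R * R * tensor R n%N 1 * tensor R n%N 2 * 'M[R]_n.+1)%type.

Section Proper.
Variables (R : realType) (n : nat) (c : R).
Implicit Types (g : 'M[R]_n.+1) (w : tensor R n 1) (F : tensor R n 2).

Definition timelike g w : Prop := sqnorm g w < 0.

Definition proper_velocity g w := (c / Num.sqrt (- sqnorm g w)) *: w.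

(** proper density associated with the generalized density r *)
Definition proper_density g w (r : R) : R :=
  Num.sqrt (- sqnorm g w) * r / (c * vol g).

Definition electric (u : tensor R n 1) F : tensor R n 1 := - c^-1 *: iprod u F.

Definition magnetic g (u : tensor R n 1) F : tensor R n (n - 2) :=
  - c^-1 *: iprod u (hodge (n - 2).+1 g F).

Definition uu g (u : tensor R n 1) : 'M[R]_n.+1 := trtens u (flat g u).

Definition proj_orth g (u : tensor R n 1) : 'M[R]_n.+1 := 1%:M + c ^- 2 *: uu g u.

End Proper.

Section Fluid.
Variables (R : realType) (n : nat) (M : oriented_manifold R n.+1).
Variables (c q : R).

(** A Lagrangian density, or an energy density, is a function of the values of
    the fields at each point.  It is total on arrays of components; only its
    values at alternating F and B, Lorentzian g and timelike w, u are meaningful,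
    and these are the only ones constrained by covariance. *)
Definition lagrangian := M -> lagr_arg R n -> R.
Definition eps_density := M -> eps_arg R n -> R.
Definition en_density := M -> en_arg R n -> R.

(** psi^*(l(A, ...)) = l(psi^* A, ...) for orientation preserving psi *)
Definition covariant_lagrangian (l : lagrangian) : Prop :=
  forall U f, local_diffeo U f -> forall p, U p ->
  let G := tmap f p in 0 < \det G ->
  forall A F w r s g, alternating F -> lorentzian g -> timelike g w ->
  l p (pull_form G A, pull_form G F, pull_vec G w, pull_top G r, pull_top G s,
       pull_metric G g)
  = pull_top G (l (f p) (A, F, w, r, s, g)).

Definition covariant_eps (eps : eps_density) : Prop :=
  forall U f, local_diffeo U f -> forall p, U p ->
  let G := tmap f p in
  forall rho s E B g, alternating B -> lorentzian g ->
  eps p (rho, s, pull_form G E, pull_form G B, pull_metric G g)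
  = eps (f p) (rho, s, E, B, g).

Definition covariant_en (e : en_density) : Prop :=
  forall U f, local_diffeo U f -> forall p, U p ->
  let G := tmap f p in 0 < \det G ->
  forall rho s u F g, alternating F -> lorentzian g -> timelike g u ->
  e p (rho, s, pull_vec G u, pull_form G F, pull_metric G g)
  = e (f p) (rho, s, u, F, g).

Record fluid_fields := FluidFields {
  fg : M -> 'M[R]_n.+1;
  fA : M -> tensor R n 1;
  fw : M -> tensor R n 1;
  fr : M -> R;
  fs : M -> R }.

Definition fF (X : fluid_fields) : M -> tensor R n 2 := ext_d (fA X).
Definition fu (X : fluid_fields) p := proper_velocity c (fg X p) (fw X p).
Definition frho (X : fluid_fields) p := proper_density c (fg X p) (fw X p) (fr X p).
Definition fsig (X : fluid_fields) p := proper_density c (fg X p) (fw X p) (fs X p).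
Definition fE (X : fluid_fields) p := electric c (fu X p) (fF X p).
Definition fB (X : fluid_fields) p := magnetic c (fg X p) (fu X p) (fF X p).

Definition lagr_state (X : fluid_fields) p : lagr_arg R n :=
  (fA X p, fF X p, fw X p, fr X p, fs X p, fg X p).
Definition eps_state (X : fluid_fields) p : eps_arg R n :=
  (frho X p, fsig X p, fE X p, fB X p, fg X p).
Definition en_state (X : fluid_fields) p : en_arg R n :=
  (frho X p, fsig X p, fu X p, fF X p, fg X p).

Record regular_fields (X : fluid_fields) : Prop := RegularFields {
  reg_lorentz : forall p, lorentzian (fg X p);
  reg_timelike : forall p, timelike (fg X p) (fw X p);
  reg_g : forall p, smooth_field_at (@pull_metric R n) (fg X) p;
  reg_A : forall p, smooth_field_at (@pull_form R n 1) (fA X) p;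
  reg_w : forall p, smooth_field_at (@pull_vec R n) (fw X) p;
  reg_r : forall p, smooth_field_at (@pull_top R n : _ -> R -> R) (fr X) p;
  reg_s : forall p, smooth_field_at (@pull_top R n : _ -> R -> R) (fs X) p }.

(** ** Hamilton's principle *)

Section Variation.
Variables (l : lagrangian) (X : fluid_fields).

Definition dl_dA p : tensor R n 1 :=
  pderiv (fun A => l p (A, fF X p, fw X p, fr X p, fs X p, fg X p)) (fA X p).
Definition dl_dF p : tensor R n 2 :=
  pderiv (fun F => l p (fA X p, F, fw X p, fr X p, fs X p, fg X p)) (fF X p).
Definition dl_dw p : tensor R n 1 :=
  pderiv (fun w => l p (fA X p, fF X p, w, fr X p, fs X p, fg X p)) (fw X p).
Definition dl_dr p : R :=
  derive1 (fun r : R => l p (fA X p, fF X p, fw X p, r, fs X p, fg X p)) (fr X p).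
Definition dl_ds p : R :=
  derive1 (fun s : R => l p (fA X p, fF X p, fw X p, fr X p, s, fg X p)) (fs X p).

(** The integrand (delta l + Lie_Z l) of the first variation of the action
    int_{Phi(D)} l, the domain being varied along Z, for
    delta A = - Lie_Z A + a, delta w = - Lie_Z w, delta r = - Lie_Z r,
    delta s = - Lie_Z s (r, s: generalized mass and entropy densities), and the
    metric being fixed. *)
Definition first_variation (Z a : M -> tensor R n 1) p : R :=
  let dA := fun m => a m - lie_form Z (fA X) m in
  'D_((dA p, ext_d dA p, - lie_vec Z (fw X) p, - lie_top Z (fr X) p,
       - lie_top Z (fs X) p, 0) : lagr_arg R n) (l p) (lagr_state X p)
  + lie_top Z (fun m => l m (lagr_state X m)) p.

(** Euler-Lagrange expression of A: dl/dA^i - d_m (dl/dF^{mi}) *)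
Definition maxwell p : tensor R n 1 := dl_dA p - div_bivdens dl_dF p.

(** T^i_k Z^k + dl/dF^{ik} a_k *)
Definition boundary_flux (T : M -> 'M[R]_n.+1) (Z a : M -> tensor R n 1)
    : M -> tensor R n 1 := fun p =>
  mktensor1 (fun i => \sum_k
    (T p i k * coef1 (Z p) k + coef2 (dl_dF p) i k * coef1 (a p) k)).

(** T is the (1,1)-tensor density whose divergence gives the fluid equations:
    the first variation is
      int_{Phi(D)} (- div T . Z + maxwell . a) + int_{Phi(D)} div (flux),
    so that the critical conditions are (div T = 0) and (maxwell = 0), together
    with boundary conditions on the flux.  The identity of the integrands is
    required for all germs Z, a of smooth fields at every point. *)
Definition stress_energy_momentum (T : M -> 'M[R]_n.+1) : Prop :=
  forall p, differentiable (in_chart (@pull_dens11 R n) T p) (mchart p p) /\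
  forall Z a, smooth_field_at (@pull_vec R n) Z p ->
    smooth_field_at (@pull_form R n 1) a p ->
    first_variation Z a p
    = - contr (Z p) (div_dens11 (fg X) T p) + contr (maxwell p) (a p)
      + div_vdens (boundary_flux T Z a) p.

Definition tensor_lagrangian p : 'M[R]_n.+1 :=
  (l p (lagr_state X p) - fr X p * dl_dr p - fs X p * dl_ds p) *: 1%:M
  + trtens (fw X p) (dl_dw p) - trtens (dl_dA p) (fA X p)
  - trtens (dl_dF p) (fF X p).

End Variation.

(** ** The Lagrangian densities given by an energy density *)

Definition lagrangian_of_eps (l : lagrangian) (eps : eps_density) : Prop :=
  forall p A F w r s g, alternating F -> lorentzian g -> timelike g w ->
  let u := proper_velocity c g w in
  let rho := proper_density c g w r in
  let sig := proper_density c g w s in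
  l p (A, F, w, r, s, g)
  = - eps p (rho, sig, electric c u F, magnetic c g u F, g) * vol g
    - q * rho * contr u A * vol g.

Definition lagrangian_of_en (l : lagrangian) (e : en_density) : Prop :=
  forall p A F w r s g, alternating F -> lorentzian g -> timelike g w ->
  let u := proper_velocity c g w in
  let rho := proper_density c g w r in
  let sig := proper_density c g w s in
  l p (A, F, w, r, s, g)
  = - e p (rho, sig, u, F, g) * vol g - q * rho * contr u A * vol g.

Definition tensor_eps (eps : eps_density) (X : fluid_fields) p : 'M[R]_n.+1 :=
  let: (rho, s, E, B, g) := eps_state X p in
  let u := fu X p in
  let e := eps p (rho, s, E, B, g) in
  let e_rho := derive1 (fun r : R => eps p (r, s, E, B, g)) rho in
  let e_s := derive1 (fun r : R => eps p (rho, r, E, B, g)) s in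
  let e_E := pderiv (fun E' => eps p (rho, s, E', B, g)) E in
  let e_B := pderiv (fun B' => eps p (rho, s, E, B', g)) B in
  let S : tensor R n 1 := ((-1) ^+ n * c^-1) *:
    iprod (sharp g E) (iprod u (hodge 3 g (flat g e_B))) in
  vol g *:
    ((e - contr e_E E) *: (c ^- 2 *: uu g u)
     + c^-1 *: (trtens u S + trtens (sharp g S) (flat g u))
     + trtens e_E E - trtens (sharp g B) (flat g e_B)
     + (e_rho * rho + e_s * s + contr e_B B - e) *: proj_orth c g u).

Definition tensor_en (e : en_density) (X : fluid_fields) p : 'M[R]_n.+1 :=
  let: (rho, s, u, F, g) := en_state X p in
  let e0 := e p (rho, s, u, F, g) in
  let e_rho := derive1 (fun r : R => e p (r, s, u, F, g)) rho in
  let e_s := derive1 (fun r : R => e p (rho, r, u, F, g)) s in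
  let e_u := pderiv (fun u' => e p (rho, s, u', F, g)) u in
  let e_F := pderiv (fun F' => e p (rho, s, u, F', g)) F in
  vol g *:
    ((e0 - contr e_u u) *: (c ^- 2 *: uu g u)
     - trtens u e_u + trtens e_F F
     + (rho * e_rho + s * e_s - e0) *: proj_orth c g u).

End Fluid.

(* Main.v *)
(** (i) In the chart at p a covariant Lagrangian does not depend on the point, and
    its covariance under the linear group can be differentiated at the identity.
    Applied to the matrix Gamma^k_{ij} Z^j, whose action on g is the derivative of g
    along Z (metric compatibility), this removes dl/dg, and the first variation
    becomes dl/dA . a + dl/dF : da + T0^i_k nabla_i Z^k, with T0 the expression (i).
    For an arbitrary tensor density T the right-hand side of the variational
    identity is the same expression with T in place of T0.  Taking Z linear in the
    chart and zero at p then gives T = T0.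

    (iii) follows from (i) by the chain rule at a point.  (ii) is (iii) for
    e(u, F) = eps(E, B): covariance under the reflection along u makes d eps/dB
    tangential, and the Poynting terms come from the vanishing of every
    antisymmetrization over n+2 indices. *)

Require Import Defs.
From HB Require Import structures.
From mathcomp Require Import all_boot all_order all_algebra all_fingroup.
From mathcomp Require Import all_classical all_reals all_analysis.
From mathcomp Require Import ring lra.
(* [coef1] is shadowed by a lemma on polynomials. *)
Require Import Defs.

Set Implicit Arguments.
Unset Strict Implicit.
Unset Printing Implicit Defensive.

Import Order.TTheory GRing.Theory Num.Theory numFieldNormedType.Exports.

Local Open Scope classical_set_scope.
Local Open Scope ring_scope.

(** * Germs of differentiable maps *)

Section Calculus1.
Context {R : realType}.
Implicit Types V W U : normedModType R.

(** A field stores, at each point, components in the chart of that point, so nothing can be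
    differentiated directly: every field is first written in one fixed chart, and [d], the Lie
    derivative, the derivatives of the Lagrangian and expression (i) must each be shown to commute
    with transition maps. Covariance is known only at alternating [F], Lorentzian [g] and timelike
    [w]. Derivatives of covariance are therefore taken along curves that stay among such states:
    alternating directions for forms, small parameters for [w], pull-backs for [g]. The magnetic
    form [B] is always annihilated by [u], but the derivative of [eps] in [B] probes all alternating
    directions, and away from tangential [B] only covariance controls [eps]. The reflection along
    [u] fixes [E], [B] and [g] and changes the sign of every form divisible by the covector of [u],
    which makes the derivative vanish on those forms. It reverses the orientation, and covariance of
    [eps] includes such maps. Tangency in turn makes the Hodge star of the derivative divisible by
    that covector, which is how the Poynting one-form comes to contain all of the mixed terms. *)

Lemma near_eq_differentiable V W (f g : V -> W) x :
  (\near x, f x = g x) -> differentiable f x -> differentiable g x.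
Proof.
move=> fg df; have [dc /eqaddoP dE] := (diff_locallyP x f).1 df.
have gE : g \o shift x = cst (g x) + 'd f x +o_ 0 id.
  have fg0 : \forall h \near (0 : V), f (h + x) = g (h + x).
    by move: fg; rewrite (near_shift 0 x) subr0.
  apply/eqaddoP => e e0; move: fg0 (dE e e0); apply: filterS2.
  by move=> h /= E; rewrite ![(_ - _) h]/(_ - _) /= -E -(nbhs_singleton fg).
have dgE := diff_unique dc gE.
by apply/diff_locallyP; rewrite dgE.
Qed.

Lemma differentiable_mx V m n (f : V -> 'M[R]_(m, n)) x :
  (forall i j, differentiable (fun y => f y i j) x) -> differentiable f x.
Proof.
move=> df.
have -> : f = \sum_i \sum_j (fun y => f y i j *: delta_mx i j).
  apply/funext => y; rewrite fct_sumE [LHS]matrix_sum_delta.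
  by apply: eq_bigr => i _; rewrite fct_sumE.
apply: differentiable_sum => i; apply: differentiable_sum => j.
exact: differentiableZl.
Qed.

Lemma differentiable_entry V m n (f : V -> 'M[R]_(m, n)) x i j :
  differentiable f x -> differentiable (fun y => f y i j) x.
Proof.
move=> df; apply: (@differentiable_comp _ _ _ _ f (fun N => N i j)) => //.
exact: differentiable_coord.
Qed.

Lemma derive_entry V m n (f : V -> 'M[R]_(m, n)) x v i j :
  differentiable f x -> 'D_v (fun y => f y i j) x = 'D_v f x i j.
Proof. by move=> /diff_derivable df; rewrite derive_mx// mxE. Qed.

Lemma is_derive_line V (f : V -> R) a v (t : R) :
  derivable f (a + t *: v) v ->
  is_derive t (1 : R) (fun s => f (a + s *: v)) ('D_v f (a + t *: v)).
Proof.
have E : (fun h : R => h^-1 *: (f (a + (h *: 1 + t) *: v) - f (a + t *: v)))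
  = (fun h : R => h^-1 *: (f (h *: v + (a + t *: v)) - f (a + t *: v))).
  by apply/funext => h; rewrite scalerDl [h *: 1]mulr1 addrCA.
by move=> df; split; rewrite /derivable /derive /= E.
Qed.

(** The mean value theorem for [t |-> f (x + h w + t v) - f (x + t v)] on [[0, h]] leaves a
    difference of two values of ['D_v f], and each is expanded to first order at [x]. Only
    differentiability of ['D_v f] at the single point [x] enters; the two remainders give the two
    parts of the bound. *)
Lemma second_difference V (f : V -> R) x v w :
  (\near x, differentiable f x) -> differentiable ('D_v f) x ->
  forall e : R, 0 < e -> \forall h \near 0^'+,
    `|f (x + h *: w + h *: v) - f (x + h *: v) - (f (x + h *: w) - f x)
      - h * h * 'd ('D_v f) x w| <= e * (h * (`|w| + `|v| + `|v|)) * h.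
Proof.
move=> df dDf e e0.
have [_ /eqaddoP /(_ e e0)] := (diff_locallyP x ('D_v f)).1 dDf.
move=> /nbhs_ballP[d1 d10 Hd1].
move: df; rewrite (near_shift 0 x) subr0 => /nbhs_ballP[d2 d20 Hd2].
set c := `|w| + `|v|.
have c0 : 0 <= c by rewrite addr_ge0.
have cv : `|v| <= c by rewrite lerDr.
have cw : `|w| <= c by rewrite lerDl.
near=> h.
have h0 : 0 < h by [].
have hc1 : h * (c + 1) < d1.
  rewrite -ltr_pdivlMr ?ltr_wpDl//; near: h; apply: nbhs_right_lt.
  by rewrite divr_gt0 ?ltr_wpDl.
have hc2 : h * (c + 1) < d2.
  rewrite -ltr_pdivlMr ?ltr_wpDl//; near: h; apply: nbhs_right_lt.
  by rewrite divr_gt0 ?ltr_wpDl.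
have small (s t : R) : 0 <= s -> s <= h -> 0 <= t -> t <= h ->
    `|s *: w + t *: v| <= h * c.
  move=> s0 sh t0 th; rewrite (le_trans (ler_normD _ _))// mulrDr.
  by rewrite !normrZ !ger0_norm// lerD// ler_wpM2r.
have smallb d y : h * (c + 1) < d -> `|y| <= h * c -> ball (0 : V) d y.
  move=> hd yh; rewrite -ball_normE /= sub0r normrN (le_lt_trans yh)//.
  by rewrite (le_lt_trans _ hd)// ler_wpM2l ?lerDl// ltW.
have dfst (s t : R) : 0 <= s -> s <= h -> 0 <= t -> t <= h ->
    differentiable f (x + s *: w + t *: v).
  move=> s0 sh t0 th.
  have := Hd2 _ (smallb _ _ hc2 (small s t s0 sh t0 th)).
  by rewrite /= addrC addrA.
pose phi (t : R) : R := f (x + h *: w + t *: v) - f (x + t *: v).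
pose dphi (t : R) : R := 'D_v f (x + h *: w + t *: v) - 'D_v f (x + t *: v).
have dphiE t : t \in `[0, h]%R -> is_derive t (1 : R) phi (dphi t).
  rewrite in_itv /= => /andP[t0 th]; apply: is_deriveB.
    by apply: is_derive_line; apply: diff_derivable; apply: dfst => //; exact: ltW.
  apply: is_derive_line; apply: diff_derivable.
  by have := dfst 0 t; rewrite scale0r addr0; apply => //; exact: ltW.
have phic : {within `[0, h], continuous phi}.
  apply: derivable_within_continuous => t th.
  by have [] := dphiE t th.
have dphio t : t \in `]0, h[%R -> is_derive t (1 : R) phi (dphi t).
  by move=> th; apply: dphiE; exact: subset_itv_oo_cc th.
have [t] := MVT h0 dphio phic.
rewrite in_itv /= => /andP[t0 th]; rewrite subr0 /phi scale0r !addr0 => E.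
rewrite E /dphi.
pose D : V -> R := 'D_v f; pose L : V -> R := 'd D x.
have HD y : `|y| <= h * c -> `|D (x + y) - (D x + L y)| <= e * `|y|.
  move=> yc; have := Hd1 _ (smallb _ _ hc1 yc).
  by rewrite ![(_ - _) y]/(_ - _) /= (addrC y x).
have H1 : `|D (x + h *: w + t *: v) - (D x + L (h *: w + t *: v))|
    <= e * (h * c).
  have sm := small h t (ltW h0) (lexx _) (ltW t0) (ltW th).
  by rewrite -addrA (le_trans (HD _ sm))// ler_wpM2l// ltW.
have H2 : `|D (x + t *: v) - (D x + L (t *: v))| <= e * (h * `|v|).
  have sm : `|t *: v| <= h * `|v|.
    by rewrite normrZ gtr0_norm// ler_wpM2r// ltW.
  have smc : `|t *: v| <= h * c by rewrite (le_trans sm)// ler_wpM2l// ltW.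
  by rewrite (le_trans (HD _ smc))// ler_wpM2l// ltW.
rewrite -/(D _) -/(D _) -/(L _).
have -> : (D (x + h *: w + t *: v) - D (x + t *: v)) * h - h * h * L w =
    ((D (x + h *: w + t *: v) - (D x + L (h *: w + t *: v)))
     - (D (x + t *: v) - (D x + L (t *: v)))) * h.
  have -> : L (h *: w + t *: v) = h * L w + L (t *: v).
    by rewrite /L linearD linearZ.
  ring.
rewrite normrM (gtr0_norm h0) ler_wpM2r ?(ltW h0)//.
by rewrite (le_trans (ler_normB _ _))// mulrDr mulrDr lerD.
Unshelve. all: by end_near. Qed.

(* The second difference is symmetric in the two directions. *)
Lemma derive_comm V (f : V -> R) x v w :
  (\near x, differentiable f x) ->
  differentiable ('D_v f) x -> differentiable ('D_w f) x ->
  'D_w ('D_v f) x = 'D_v ('D_w f) x.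
Proof.
move=> df dv dw; rewrite !deriveE//.
pose a : R := 'd ('D_v f) x w; pose b : R := 'd ('D_w f) x v.
suff : a = b by [].
(* The two second-difference errors add up to three times the sum of the norms; the extra 1 keeps
   [c] positive when both directions vanish. *)
pose c := 3 * (`|v| + `|w|) + 1.
have c0 : 0 < c by rewrite ltr_wpDl// mulr_ge0// addr_ge0.
have ab e : 0 < e -> `|a - b| <= e * c.
  move=> e0.
  have [h] : exists h : R, [/\ 0 < h,
    `|f (x + h *: w + h *: v) - f (x + h *: v) - (f (x + h *: w) - f x)
      - h * h * a| <= e * (h * (`|w| + `|v| + `|v|)) * h &
    `|f (x + h *: v + h *: w) - f (x + h *: w) - (f (x + h *: v) - f x)
      - h * h * b| <= e * (h * (`|v| + `|w| + `|w|)) * h].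
    near (0 : R)^'+ => h; exists h; split; first by [].
      by near: h; exact: second_difference.
    by near: h; exact: second_difference.
  case=> h0 H1 H2.
  rewrite -(ler_pM2r (mulr_gt0 h0 h0)).
  have -> : `|a - b| * (h * h) = `|(a - b) * (h * h)|.
    by rewrite normrM (gtr0_norm (mulr_gt0 h0 h0)).
  rewrite addrAC in H2.
  have -> : (a - b) * (h * h) =
    (f (x + h *: v + h *: w) - f (x + h *: w) - (f (x + h *: v) - f x)
      - h * h * b) -
    (f (x + h *: w + h *: v) - f (x + h *: v) - (f (x + h *: w) - f x)
      - h * h * a).
    rewrite (addrAC x); ring.
  rewrite (le_trans (ler_normB _ _))//.
  rewrite addrAC in H2.
  rewrite (le_trans (lerD H2 H1))// /c.
  have -> : e * (3 * (`|v| + `|w|) + 1) * (h * h) =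
    e * (h * (`|v| + `|w| + `|w|)) * h + e * (h * (`|w| + `|v| + `|v|)) * h
    + e * (h * h) by ring.
  by rewrite lerDl mulr_ge0 ?(ltW e0)// mulr_ge0// ltW.
apply/eqP; rewrite -subr_eq0 -normr_le0; apply/ler_addgt0Pl => e e0.
rewrite addr0 (le_trans (ab (e / c) _)) ?divr_gt0//.
by rewrite divfK// gt_eqF.
Unshelve. all: by end_near. Qed.

Lemma C_at_near V W k (f g : V -> W) x :
  (\near x, f x = g x) -> C_at k f x -> C_at k g x.
Proof.
elim: k f g => [|k IH] f g fg /=.
  move=> cf; suff : g @ x --> f x by rewrite (nbhs_singleton fg).
  by apply: cvg_trans cf; exact: near_eq_cvg.
have fg2 := near_join fg.
case=> df Cf; split.
  by move: fg2 df; apply: filterS2 => y; exact: near_eq_differentiable.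
move=> v; apply: IH (Cf v); move: fg2; apply: filterS => y.
exact: near_eq_derive.
Qed.

Lemma C_atS V W k (f : V -> W) x : C_at k.+1 f x -> C_at k f x.
Proof.
elim: k f => [|k IH] f; first by case=> /nbhs_singleton/differentiable_continuous.
by case=> df Cf; split=> // v; apply: IH; exact: Cf.
Qed.

Lemma C_at1_differentiable V W k (f : V -> W) x :
  C_at k.+1 f x -> differentiable f x.
Proof. by case=> /nbhs_singleton. Qed.

Lemma C_at2_differentiable V W k (f : V -> W) x v :
  C_at k.+2 f x -> differentiable ('D_v f) x.
Proof. by case=> _ /(_ v)/C_at1_differentiable. Qed.

Lemma C_at_cst V W k (a : W) (x : V) : C_at k (cst a) x.
Proof.
elim: k a => [|k IH] a /=; first exact: cst_continuous.
split; first by apply: nearW => y; exact: differentiable_cst.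
move=> v; apply: C_at_near (IH 0); apply: nearW => y.
by rewrite derive_cst.
Qed.

Lemma C_atD V W k (f g : V -> W) x :
  C_at k f x -> C_at k g x -> C_at k (f \+ g) x.
Proof.
elim: k f g => [|k IH] f g /=; first exact: cvgD.
case=> df Cf [dg Cg]; split.
  by move: df dg; apply: filterS2 => y; exact: differentiableD.
move=> v; apply: C_at_near (IH _ _ (Cf v) (Cg v)).
move: df dg; apply: filterS2 => y dfy dgy /=.
by rewrite deriveD//; exact: diff_derivable.
Qed.

Lemma C_at_sum V W k (I : Type) (r : seq I) (P : pred I) (f : I -> V -> W) x :
  (forall i, C_at k (f i) x) -> C_at k (fun y => \sum_(i <- r | P i) f i y) x.
Proof.
move=> Cf; elim: r => [|i r IH].
  apply: C_at_near (C_at_cst k 0 x); apply: nearW => y; by rewrite big_nil.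
case: (boolP (P i)) => Pi.
  apply: C_at_near (C_atD (Cf i) IH); apply: nearW => y; by rewrite big_cons Pi.
by apply: C_at_near IH; apply: nearW => y; rewrite big_cons (negbTE Pi).
Qed.

Lemma C_atM V k (f g : V -> R) x :
  C_at k f x -> C_at k g x -> C_at k (fun y => f y * g y) x.
Proof.
elim: k f g => [|k IH] f g; first exact: cvgM.
move=> Cf Cg; have [df Df] := Cf; have [dg Dg] := Cg; split.
  by move: df dg; apply: filterS2 => y; exact: differentiableM.
move=> v.
have := C_atD (IH _ _ (C_atS Cf) (Dg v)) (IH _ _ (C_atS Cg) (Df v)).
apply: C_at_near; move: df dg; apply: filterS2 => y dfy dgy /=.
by rewrite deriveM//; exact: diff_derivable.
Qed.

Lemma derive_rV n (g : 'rV[R]_n -> R) z w : differentiable g z ->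
  'D_w g z = \sum_j w ord0 j * 'D_(delta_mx ord0 j) g z.
Proof.
move=> dg; rewrite deriveE// {1}(row_sum_delta w) linear_sum /=.
by apply: eq_bigr => j _; rewrite linearZ deriveE.
Qed.

Lemma derive_comp_rV V n (f : V -> 'rV[R]_n) (g : 'rV[R]_n -> R) y v :
  differentiable f y -> differentiable g (f y) ->
  'D_v (g \o f) y =
  \sum_j 'D_v (fun y => f y ord0 j) y * 'D_(delta_mx ord0 j) g (f y).
Proof.
move=> df dg; rewrite deriveE; last exact: differentiable_comp.
rewrite diff_comp//= -deriveE// -(deriveE v df) derive_rV//.
by apply: eq_bigr => j _; rewrite derive_entry.
Qed.

Lemma C_at_entry V k m n (f : V -> 'M[R]_(m, n)) x i j :
  C_at k f x -> C_at k (fun y => f y i j) x.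
Proof.
elim: k f => [|k IH] f.
  move=> cf; apply: (@continuous_comp _ _ _ f (fun N => N i j)) => //.
  exact: coord_continuous.
case=> df Cf; split.
  by move: df; apply: filterS => y; exact: differentiable_entry.
move=> v; apply: C_at_near (IH _ (Cf v)).
by move: df; apply: filterS => y dfy; rewrite derive_entry.
Qed.

Lemma C_atZl V W k (f : V -> R) (a : W) x :
  C_at k f x -> C_at k (fun y => f y *: a) x.
Proof.
elim: k f => [|k IH] f; first by move=> cf; exact: cvgZr_tmp.
case=> df Cf; split.
  by move: df; apply: filterS => y; exact: differentiableZl.
move=> v; apply: C_at_near (IH _ (Cf v)).
move: df; apply: filterS => y dfy.
by rewrite [RHS]deriveE ?diffZl//= ?deriveE//; exact: differentiableZl.
Qed.

Lemma C_at_mx V k m n (f : V -> 'M[R]_(m, n)) x :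
  (forall i j, C_at k (fun y => f y i j) x) -> C_at k f x.
Proof.
move=> Cf; apply: (@C_at_near _ _ _
    (fun y => \sum_i \sum_j f y i j *: delta_mx i j)).
  by apply: nearW => y; rewrite -matrix_sum_delta.
by do 2!apply: C_at_sum => ?; exact: C_atZl.
Qed.

(** By the chain rule a directional derivative of [g \o f] is a sum of products of entries of
    ['D_v f] with partial derivatives of [g] composed with [f]; the induction on [k] then closes
    with [C_atM], for which [g] is taken scalar. *)
Lemma C_at_comp V k n (f : V -> 'rV[R]_n) (g : 'rV[R]_n -> R) x :
  C_at k f x -> C_at k g (f x) -> C_at k (g \o f) x.
Proof.
elim: k g => [|k IH] g; first by move=> cf cg; exact: continuous_comp.
move=> Cf Cg; have [df Df] := Cf; have [dg Dg] := Cg.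
have dg' : \near x, differentiable g (f x).
  have cf := differentiable_continuous (nbhs_singleton df).
  exact: (cf _ dg).
split.
  by move: df dg'; apply: filterS2 => y dfy dgy; exact: differentiable_comp.
move=> v; apply: (@C_at_near _ _ _ (fun y =>
    \sum_j 'D_v f y ord0 j * ('D_(delta_mx ord0 j) g \o f) y)).
  move: df dg'; apply: filterS2 => y dfy dgy; rewrite derive_comp_rV//.
  by apply: eq_bigr => j _; rewrite derive_entry.
apply: C_at_sum => j; apply: C_atM.
  exact: (C_at_entry (f := 'D_v f) ord0 j (Df v)).
exact: (IH _ (C_atS Cf) (Dg _)).
Qed.

Lemma smooth_at_comp V m n (f : V -> 'rV[R]_n) (g : 'rV[R]_n -> 'rV[R]_m) x :
  smooth_at f x -> smooth_at g (f x) -> smooth_at (g \o f) x.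
Proof.
move=> sf sg k; apply: C_at_mx => i j.
by apply: (@C_at_comp _ _ _ f (fun z => g z i j)) => //; exact: C_at_entry.
Qed.

Lemma derive_line V W (f : V -> W) x v w :
  (forall h : R, f (h *: v + x) = f x + h *: w) -> 'D_v f x = w.
Proof.
move=> fE; rewrite /derive; apply: lim_near_cst; first exact: norm_hausdorff.
near=> h; have h0 : h != 0 by near: h; exact: nbhs_dnbhs_neq.
by rewrite /= fE addrAC subrr add0r scalerA mulVf// scale1r.
Unshelve. all: by end_near. Qed.

Lemma smooth_at_id V (x : V) : smooth_at (id : V -> V) x.
Proof.
case=> [|k]; first exact: cvg_id.
split=> [|v]; first by near=> y; exact: ex_diff.
apply: C_at_near (C_at_cst k v x); apply: nearW => y.
by rewrite derive_id.
Unshelve. all: by end_near. Qed.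

Lemma smooth_at_affine m n (A : 'M[R]_(m, n)) b c (x : 'rV[R]_m) :
  smooth_at (fun y : 'rV[R]_m => b + (y - c) *m A) x.
Proof.
move=> k; apply: C_at_mx => i j.
apply: (@C_at_near _ _ _ (fun y : 'rV[R]_m => b i j + \sum_l (y i l - c i l) * A l j)).
  by apply: filterE => y; rewrite !mxE; congr (_ + _); apply: eq_bigr => l _;
    rewrite !mxE.
apply: C_atD; first exact: C_at_cst.
apply: C_at_sum => l; apply: C_atM; last exact: C_at_cst.
by apply: C_atD; [exact/C_at_entry/smooth_at_id|exact: C_at_cst].
Qed.

Lemma derive_affine m n (A : 'M[R]_(m, n)) b c (x v : 'rV[R]_m) :
  'D_v (fun y : 'rV[R]_m => b + (y - c) *m A) x = v *m A.
Proof.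
apply: derive_line => h.
by rewrite -(addrA (h *: v)) mulmxDl -scalemxAl (addrC (h *: _)) addrA.
Qed.

End Calculus1.

(** * Tensor algebra *)

Section Tensors.
Context {R : realType} {n : nat}.
Implicit Types (G H g : 'M[R]_n.+1) (i j : 'I_n.+1).
Local Notation tens k := (tensor R n k).

Lemma coef_mktensor k (f : k.-tuple 'I_n.+1 -> R) I : coef (mktensor f) I = f I.
Proof. by rewrite /coef /mktensor mxE enum_rankK. Qed.

Lemma tensorP k (s t : tens k) : (forall I, coef s I = coef t I) -> s = t.
Proof.
move=> E; apply/rowP => a; have := E (enum_val a).
by rewrite /coef enum_valK.
Qed.

Lemma coefD k (s t : tens k) I : coef (s + t) I = coef s I + coef t I.
Proof. by rewrite /coef mxE. Qed.

Lemma coefN k (t : tens k) I : coef (- t) I = - coef t I.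
Proof. by rewrite /coef mxE. Qed.

Lemma coefZ k (a : R) (t : tens k) I : coef (a *: t) I = a * coef t I.
Proof. by rewrite /coef mxE. Qed.

Lemma coef0 k I : coef (0 : tens k) I = 0.
Proof. by rewrite /coef mxE. Qed.

Lemma coef_sum k (J : finType) (f : J -> tens k) I :
  coef (\sum_j f j) I = \sum_j coef (f j) I.
Proof. by rewrite /coef summxE. Qed.

Lemma tuple1P (I : 1.-tuple 'I_n.+1) : I = [tuple tnth I ord0].
Proof. by apply: eq_from_tnth => a; rewrite ord1. Qed.

Lemma tuple2P (I : 2.-tuple 'I_n.+1) : I = [tuple tnth I ord0; tnth I ord_max].
Proof.
apply: eq_from_tnth => -[[|[|//]] h]; rewrite [RHS](tnth_nth ord0) /=.
  by congr (tnth I _); exact/val_inj.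
by congr (tnth I _); exact/val_inj.
Qed.

Lemma coef1_mktensor1 (f : 'I_n.+1 -> R) i : coef1 (mktensor1 f) i = f i.
Proof. by rewrite /coef1 coef_mktensor (tnth_nth ord0). Qed.

Lemma coef2_mktensor2 (f : 'I_n.+1 -> 'I_n.+1 -> R) i j :
  coef2 (mktensor2 f) i j = f i j.
Proof. by rewrite /coef2 coef_mktensor !(tnth_nth ord0). Qed.

Lemma tensor1P (s t : tens 1) : (forall i, coef1 s i = coef1 t i) -> s = t.
Proof. by move=> E; apply: tensorP => I; rewrite (tuple1P I); exact: E. Qed.

Lemma tensor2P (s t : tens 2) : (forall i j, coef2 s i j = coef2 t i j) -> s = t.
Proof. by move=> E; apply: tensorP => I; rewrite (tuple2P I); exact: E. Qed.

Lemma coef1D (s t : tens 1) i : coef1 (s + t) i = coef1 s i + coef1 t i.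
Proof. exact: coefD. Qed.

Lemma coef1N (t : tens 1) i : coef1 (- t) i = - coef1 t i.
Proof. exact: coefN. Qed.

Lemma coef1Z a (t : tens 1) i : coef1 (a *: t) i = a * coef1 t i.
Proof. exact: coefZ. Qed.

Lemma coef10 i : coef1 (0 : tens 1) i = 0.
Proof. exact: coef0. Qed.

Lemma coef2D (s t : tens 2) i j : coef2 (s + t) i j = coef2 s i j + coef2 t i j.
Proof. exact: coefD. Qed.

Lemma coef2N (t : tens 2) i j : coef2 (- t) i j = - coef2 t i j.
Proof. exact: coefN. Qed.

Lemma coef2Z a (t : tens 2) i j : coef2 (a *: t) i j = a * coef2 t i j.
Proof. exact: coefZ. Qed.

Lemma sum_tuple0 (f : 0.-tuple 'I_n.+1 -> R) : \sum_I f I = f [tuple].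
Proof. by rewrite (big_pred1 [tuple]) // => I; apply/esym/eqP; exact: tuple0. Qed.

Lemma sum_tupleS k (f : k.+1.-tuple 'I_n.+1 -> R) :
  \sum_I f I = \sum_i \sum_(J : k.-tuple 'I_n.+1) f [tuple of i :: J].
Proof.
rewrite pair_big /=.
rewrite (reindex (fun p : 'I_n.+1 * k.-tuple 'I_n.+1 => [tuple of p.1 :: p.2])) //=.
exists (fun I => (thead I, [tuple of behead I])) => [[i J] _ | I _] /=.
  by congr pair; exact/val_inj.
by rewrite -tuple_eta.
Qed.

Lemma sum_tuple1 (f : 1.-tuple 'I_n.+1 -> R) :
  \sum_I f I = \sum_i f [tuple i].
Proof.
rewrite sum_tupleS; apply: eq_bigr => i _; rewrite sum_tuple0.
by congr f; exact/val_inj.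
Qed.

Lemma sum_tuple2 (f : 2.-tuple 'I_n.+1 -> R) :
  \sum_I f I = \sum_i \sum_j f [tuple i; j].
Proof.
rewrite sum_tupleS; apply: eq_bigr => i _; rewrite sum_tuple1.
by apply: eq_bigr => j _; congr f; exact/val_inj.
Qed.

Lemma coef1_act G (t : tens 1) i :
  coef1 (act G t) i = \sum_j G i j * coef1 t j.
Proof.
rewrite /coef1 coef_mktensor sum_tuple1; apply: eq_bigr => j _.
by rewrite big_ord1 !(tnth_nth ord0).
Qed.

Lemma coef2_act G (t : tens 2) i j :
  coef2 (act G t) i j = \sum_k \sum_l G i k * G j l * coef2 t k l.
Proof.
rewrite /coef2 coef_mktensor sum_tuple2; apply: eq_bigr => k _.
apply: eq_bigr => l _; rewrite big_ord_recl big_ord1.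
by rewrite !(tnth_nth ord0).
Qed.

Lemma contr1E (p t : tens 1) : contr p t = \sum_i coef1 p i * coef1 t i.
Proof. by rewrite /contr invr1 mul1r sum_tuple1. Qed.

(** Ranks one and two as matrices, where [act] becomes multiplication and index identities become
    matrix algebra. *)
Definition vec (t : tens 1) : 'rV[R]_n.+1 := \row_i coef1 t i.
Definition mat (t : tens 2) : 'M[R]_n.+1 := \matrix_(i, j) coef2 t i j.

Lemma vec_act G t : vec (act G t) = vec t *m G^T.
Proof.
apply/rowP => i; rewrite !mxE coef1_act; apply: eq_bigr => j _.
by rewrite !mxE mulrC.
Qed.

Lemma mat_act G t : mat (act G t) = G *m mat t *m G^T.
Proof.
apply/matrixP => i j; rewrite !mxE coef2_act exchange_big.
apply: eq_bigr => l _; rewrite !mxE big_distrl /=.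
by apply: eq_bigr => k _; rewrite !mxE mulrAC.
Qed.

Lemma vec_inj : injective vec.
Proof.
by move=> s t /rowP E; apply: tensor1P => i; have := E i; rewrite !mxE.
Qed.

Lemma mat_inj : injective mat.
Proof.
by move=> s t /matrixP E; apply: tensor2P => i j; have := E i j; rewrite !mxE.
Qed.

Lemma trtens1E (p t : tens 1) i j : trtens p t i j = coef1 p i * coef1 t j.
Proof.
rewrite mxE invr1 mul1r sum_tuple0.
by congr (coef _ _ * coef _ _); exact/val_inj.
Qed.

Lemma trtens2E (p t : tens 2) i j :
  trtens p t i j = \sum_l coef2 p i l * coef2 t j l.
Proof.
rewrite mxE invr1 mul1r sum_tuple1; apply: eq_bigr => l _.
by congr (coef _ _ * coef _ _); exact/val_inj.
Qed.

Lemma coef1_wedge_basis i j :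
  coef1 (wedge_basis R [tuple i]) j = (i == j)%:R.
Proof.
by rewrite /coef1 coef_mktensor det_mx11 mxE !(tnth_nth ord0).
Qed.

Lemma coef2_wedge_basis i j k l :
  coef2 (wedge_basis R [tuple i; j]) k l =
  (i == k)%:R * (j == l)%:R - (i == l)%:R * (j == k)%:R.
Proof.
rewrite /coef2 coef_mktensor (expand_det_row _ ord0) big_ord_recl big_ord1.
rewrite /cofactor !det_mx11 !mxE /= !(tnth_nth ord0) /= expr0 expr1 !mul1r.
by rewrite mulN1r mulrN.
Qed.

End Tensors.

(** * The Levi-Civita symbol *)

Section LeviCivita.
Context {R : realType} {n : nat}.
Implicit Types (i j : 'I_n.+1) (I : seq 'I_n.+1).
Local Notation lc := (@levi_civita R n).

Definition lc_mx I : 'M[R]_n.+1 := \matrix_(a, b) (nth ord0 I a == b)%:R.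

Lemma levi_civitaE I : size I = n.+1 -> lc I = \det (lc_mx I).
Proof. by move=> sI; rewrite /levi_civita sI eqxx. Qed.

(* Cramer's rule for the 0-1 matrix of [I]; equivalently, antisymmetrization
   over n+2 indices vanishes. *)
Lemma levi_civita_subst I i j : size I = n.+1 ->
  (i == j)%:R * lc I =
  \sum_(a < n.+1) (nth ord0 I a == i)%:R * lc (set_nth ord0 I a j).
Proof.
move=> sI; set M := lc_mx I.
(* After the substitution row [a] is the basis row of [j], so the expansion along that row leaves a
   single cofactor. *)
have lcs (a : 'I_n.+1) : lc (set_nth ord0 I a j) = cofactor M a j.
  rewrite levi_civitaE; last first.
    by rewrite size_set_nth sI; apply/maxn_idPr; exact: ltn_ord.
  rewrite (expand_det_row _ a) (bigD1 j) //= big1 ?addr0; last first.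
    by move=> b bj; rewrite mxE nth_set_nth /= eqxx eq_sym (negbTE bj) mul0r.
  rewrite mxE nth_set_nth /= eqxx eqxx mul1r /cofactor.
  congr (_ * \det _); apply/matrixP => b b'; rewrite !mxE nth_set_nth /=.
  by rewrite [bump a b == a]eq_sym (negbTE (neq_bump a b)).
under eq_bigr do rewrite lcs.
(* The sum to be computed is entry [(j, i)] of the adjugate times [M], which is the determinant
   times the identity. *)
have := congr1 (fun N : 'M[R]_n.+1 => N j i) (mul_adj_mx M).
rewrite !mxE => E; rewrite levi_civitaE// -/M mulrC mulr_natr eq_sym -E.
apply: eq_bigr => a _.
by rewrite [in LHS]mxE [M a i]mxE mulrC.
Qed.

Lemma levi_civita_tperm I I' (a b : 'I_n.+1) :
  size I = n.+1 -> size I' = n.+1 -> a != b ->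
  (forall c : 'I_n.+1, nth ord0 I' c = nth ord0 I (tperm a b c)) ->
  lc I' = - lc I.
Proof.
move=> sI sI' ab II'; rewrite !levi_civitaE//.
have -> : lc_mx I' = row_perm (tperm a b) (lc_mx I).
  by apply/matrixP => c d; rewrite !mxE II'.
by rewrite row_permE det_mulmx det_perm odd_tperm ab expr1 mulN1r.
Qed.

Lemma levi_civita_rot i I : size I = n ->
  lc (i :: I) = (-1) ^+ n * lc (rcons I i).
Proof.
move=> sI; rewrite !levi_civitaE ?size_rcons /= ?sI//.
(* [s] sends 0 to the last position and keeps the order of the other entries; its parity is that of
   [n]. *)
pose s : 'S_n.+1 := lift_perm ord0 ord_max 1.
have -> : lc_mx (i :: I) = row_perm s (lc_mx (rcons I i)).
  apply/matrixP => c d; rewrite !mxE.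
  case: (unliftP ord0 c) => [c'|] ->.
    rewrite lift_perm_lift perm1 /= nth_rcons sI.
    have c'n : (c' < n)%N := ltn_ord c'.
    by rewrite /bump (leqNgt n c') c'n !add0n c'n.
  by rewrite lift_perm_id /= nth_rcons sI ltnn eqxx.
by rewrite row_permE det_mulmx det_perm odd_lift_perm odd_perm1 /= addbF
  signr_odd.
Qed.

(** Three rotations of n+1 entries, each of sign (-1)^n. This is the sign that the factor (-1)^n in
    the Poynting one-form compensates. *)
Lemma levi_civita_cat3 I i j l : (size I).+2 = n ->
  lc (I ++ [:: i; j; l]) = (-1) ^+ n * lc [:: i, j, l & I].
Proof.
move=> sI.
have E1 := @levi_civita_rot i [:: j, l & I] sI.
have E2 : lc [:: j, l & rcons I i] = _ := @levi_civita_rot j (l :: rcons I i) _.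
have E3 : lc (l :: rcons (rcons I i) j) = _ :=
  @levi_civita_rot l (rcons (rcons I i) j) _.
rewrite E1 [rcons _ i]/= E2 ?[rcons _ j]/= ?E3 /= ?size_rcons//.
rewrite -!cats1 -!catA /= !mulrA -!exprD.
by rewrite -signr_odd !oddD; case: (odd n); rewrite /= ?expr1 ?expr0 ?mulrNN mul1r.
Qed.

Definition tsubst k (J : k.-tuple 'I_n.+1) (a : 'I_k) j : k.-tuple 'I_n.+1 :=
  [tuple if b == a then j else tnth J b | b < k].

Definition tswap k (J : k.-tuple 'I_n.+1) (a b : 'I_k) : k.-tuple 'I_n.+1 :=
  [tuple tnth J (tperm a b c) | c < k].

(* An alternating array and an alternating function of the same indices: all
   the slots contribute equally. *)
Lemma sum_tsubst k (p : tensor R n k.+1) (f : k.+1.-tuple 'I_n.+1 -> R) i j :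
  alternating p ->
  (forall J a b, a != b -> f (tswap J a b) = - f J) ->
  \sum_(J : k.+1.-tuple 'I_n.+1)
    coef p J * \sum_a (tnth J a == i)%:R * f (tsubst J a j) =
  k.+1%:R * \sum_(J : k.-tuple 'I_n.+1)
    coef p [tuple of i :: J] * f [tuple of j :: J].
Proof.
move=> altp altf.
have E a : \sum_(J : k.+1.-tuple 'I_n.+1)
      coef p J * ((tnth J a == i)%:R * f (tsubst J a j)) =
    \sum_(J : k.-tuple 'I_n.+1) coef p [tuple of i :: J] * f [tuple of j :: J].
  transitivity (\sum_(J : k.+1.-tuple 'I_n.+1)
      coef p J * ((tnth J ord0 == i)%:R * f (tsubst J ord0 j))).
    have [->//|a0] := eqVneq a ord0.
    have tswapK : involutive (fun J : k.+1.-tuple 'I_n.+1 => tswap J ord0 a).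
      by move=> J; apply: eq_from_tnth => b; rewrite !tnth_mktuple tpermK.
    rewrite (reindex_inj (inv_inj tswapK)) /=; apply: eq_bigr => J _.
    have -> : coef p (tswap J ord0 a) = - coef p J.
      by rewrite altp odd_tperm eq_sym a0 expr1 mulN1r.
    have -> : tsubst (tswap J ord0 a) a j = tswap (tsubst J ord0 j) ord0 a.
      apply: eq_from_tnth => b; rewrite !tnth_mktuple.
      by rewrite (canF_eq (@tpermK _ _ _)) tpermL.
    have a0' : ord0 != a by rewrite eq_sym.
    by rewrite altf// tnth_mktuple tpermR !mulrN mulNr opprK.
  rewrite sum_tupleS exchange_big [RHS]big_mkcond /=; apply: eq_bigr => J _.
  rewrite (bigD1 i) //= big1 ?addr0 => [|l li]; last first.
    by rewrite (tnth_nth ord0) /= (negbTE li) mul0r mulr0.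
  rewrite (tnth_nth ord0) /= eqxx mul1r; congr (_ * f _).
  apply: eq_from_tnth => b; rewrite tnth_mktuple.
  case: (unliftP ord0 b) => [b'|] ->; last by rewrite eqxx (tnth_nth ord0).
  by rewrite !(tnth_nth ord0).
under eq_bigr do rewrite big_distrr /=.
rewrite exchange_big /=; under eq_bigr do rewrite E.
by rewrite sumr_const card_ord mulr_natl.
Qed.

(** The [k] slots contribute equally, which turns 1/k! into the 1/(k-1)! of [trtens]; for [k = 0]
    both sides vanish. *)
Lemma sum_tsubst_trtens k (p : tensor R n k) (f : k.-tuple 'I_n.+1 -> R) i j :
  alternating p ->
  (forall J a b, a != b -> f (tswap J a b) = - f J) ->
  (k`!%:R)^-1 * \sum_(J : k.-tuple 'I_n.+1)
    coef p J * \sum_a (tnth J a == i)%:R * f (tsubst J a j) =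
  trtens p (mktensor f) i j.
Proof.
case: k p f => [|k] p f altp altf.
  by rewrite big1 ?mulr0 ?mxE// => J _; rewrite big_ord0 mulr0.
rewrite sum_tsubst// mxE factS natrM invfM [_^-1 / _]mulrC -mulrA.
rewrite [X in _ * X]mulrA mulVf ?pnatr_eq0// mul1r.
by under [in RHS]eq_bigr do rewrite coef_mktensor.
Qed.

End LeviCivita.

(** * Contraction of the Levi-Civita symbol with an (n-2)-vector *)

Section Contraction.
Context {R : realType} {k : nat}.
Let n := k.+2.
Implicit Types (i j a b c : 'I_n.+1).
Local Notation lc := (@levi_civita R n).
Lemma lc_tswap a b c (J : k.-tuple 'I_n.+1) d e : d != e ->
  lc [:: a, b, c & tswap J d e] = - lc [:: a, b, c & J].
Proof.
move=> de.
apply: (levi_civita_tperm (a := rshift 3 d) (b := rshift 3 e)).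
- by rewrite /= size_tuple.
- by rewrite /= size_map size_enum_ord.
- by apply: contra de => /eqP de; apply/eqP/(@rshift_inj 3 k).
move=> m.
case: (@splitP 3 k m) => [m' mm'|m' mm'].
  have -> : m = @lshift 3 k m' by exact/val_inj.
  have ne q : @rshift 3 k q != lshift k m' by rewrite eq_rlshift.
  rewrite (tpermD (ne d) (ne e)).
  by case: m' {mm' ne} => -[|[|[|//]]].
have -> : m = @rshift 3 k m' by exact/val_inj.
rewrite -(inj_tperm _ _ _ (@rshift_inj 3 k)).
rewrite -[LHS]/(nth ord0 (tswap J d e) m') -[RHS]/(nth ord0 J (tperm d e m')).
by rewrite -!tnth_nth tnth_mktuple.
Qed.

(** The third index is the one contracted with [u] in the magnetic form. Its antisymmetry against
    any slot of [J] is the reason why that form vanishes when [u] is inserted. *)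
Lemma lc_tsubst_swap a b c (J : k.-tuple 'I_n.+1) d j :
  lc [:: a, b, j & tsubst J d c] = - lc [:: a, b, c & tsubst J d j].
Proof.
pose two : 'I_n.+1 := @lshift 3 k ord_max.
have ne q : @lshift 3 k ord_max != @rshift 3 k q by rewrite eq_lrshift.
apply: (levi_civita_tperm (a := two) (b := rshift 3 d)).
- by rewrite /= size_map size_enum_ord.
- by rewrite /= size_map size_enum_ord.
- exact: ne.
move=> m.
case: (@splitP 3 k m) => [m' mm'|m' mm'].
  have -> : m = @lshift 3 k m' by exact/val_inj.
  have [->|m2] := eqVneq m' ord_max.
    rewrite tpermL -[LHS]/j -[RHS]/(nth ord0 (tsubst J d j) d).
    by rewrite -tnth_nth tnth_mktuple eqxx.
  have m3 : @lshift 3 k ord_max != @lshift 3 k m'.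
    by rewrite (inj_eq (@lshift_inj 3 k)) eq_sym.
  have m4 : @rshift 3 k d != @lshift 3 k m' by rewrite eq_rlshift.
  rewrite (tpermD m3 m4).
  by case: m' m2 {mm' m3 m4} => -[|[|[|//]]].
have -> : m = @rshift 3 k m' by exact/val_inj.
rewrite -[LHS]/(nth ord0 (tsubst J d c) m') -tnth_nth tnth_mktuple.
have [->|md] := eqVneq m' d; first by rewrite tpermR.
have m3 : @rshift 3 k d != @rshift 3 k m'.
  by rewrite (inj_eq (@rshift_inj 3 k)) eq_sym.
rewrite (tpermD (ne m') m3).
rewrite -[RHS]/(nth ord0 (tsubst J d j) m') -tnth_nth tnth_mktuple.
by rewrite (negbTE md).
Qed.

Variable p : tensor R n k.
Hypothesis altp : alternating p.

(** Up to the factor [(-1) ^+ n * vol g], the components of the 3-form [hodge 3 g (flat g p)] when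
    [g] is invertible. *)
Definition lc_contr a b c : R :=
  (k`!%:R)^-1 * \sum_(J : k.-tuple 'I_n.+1) coef p J * lc [:: a, b, c & J].

Definition lc_contr4 i a b c j : R :=
  trtens p (mktensor (fun J => lc [:: a, b, c & J])) i j.

Lemma lc_contr_swap12 a b c : lc_contr b a c = - lc_contr a b c.
Proof.
rewrite /lc_contr -mulrN; congr (_ * _); rewrite -sumrN; apply: eq_bigr => J _.
rewrite -mulrN; congr (_ * _).
apply: (levi_civita_tperm (a := ord0) (b := lift ord0 ord0)) => //=.
- by rewrite size_tuple.
- by rewrite size_tuple.
- move=> d; case: (unliftP ord0 d) => [d'|] ->; last by rewrite tpermL.
  case: (unliftP ord0 d') => [d''|] ->; last by rewrite tpermR.
  by rewrite tpermD.
Qed.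

(** This is [levi_civita_subst] contracted with [p]: the substitutions in the three free slots stay
    explicit, while those in the slots of [J] add up, by antisymmetry of [p], to the tensor product
    [lc_contr4]. All identities for the magnetic terms are obtained by contracting this one. *)
Lemma lc_contr_subst i j a b c :
  (i == j)%:R * lc_contr a b c =
  (a == i)%:R * lc_contr j b c + (b == i)%:R * lc_contr a j c
  + (c == i)%:R * lc_contr a b j + lc_contr4 i a b c j.
Proof.
pose f (J : k.-tuple 'I_n.+1) := lc [:: a, b, c & J].
have E (J : k.-tuple 'I_n.+1) : (i == j)%:R * f J =
   (a == i)%:R * lc [:: j, b, c & J] + (b == i)%:R * lc [:: a, j, c & J]
  + (c == i)%:R * lc [:: a, b, j & J]
  + \sum_(d < k) (tnth J d == i)%:R * f (tsubst J d j).
  rewrite [LHS]levi_civita_subst /= ?size_tuple// 3!big_ord_recl /= -!addrA.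
  congr (_ + (_ + (_ + _))); apply: eq_bigr => d _.
  rewrite !add0n (tnth_nth ord0); congr (_ * lc [:: _, _, _ & _]).
  apply: (@eq_from_nth _ ord0); first by
    rewrite size_set_nth !size_tuple; apply/maxn_idPr; exact: ltn_ord.
  move=> m; rewrite size_set_nth size_tuple (maxn_idPr _) ?ltn_ord// => mk.
  have := tnth_mktuple (fun b : 'I_k => if b == d then j else tnth J b) (Ordinal mk).
  by rewrite !(tnth_nth ord0) /= nth_set_nth => ->.
have X (x : R) (h : k.-tuple 'I_n.+1 -> R) :
    (k`!%:R)^-1 * (\sum_J coef p J * (x * h J)) =
    x * ((k`!%:R)^-1 * \sum_J coef p J * h J).
  by rewrite [RHS]mulrCA; congr (_ * _); rewrite big_distrr /=; apply: eq_bigr => J _;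
    rewrite mulrCA.
rewrite -X; under eq_bigr do rewrite E !mulrDr.
rewrite !big_split /= !mulrDr !X; congr (_ + _).
by rewrite sum_tsubst_trtens// => J d e de; exact: lc_tswap.
Qed.

End Contraction.

(** * Linearity of the contractions *)

Section TrtensLinear.
Context {R : realType} {n : nat}.
Implicit Types (i j a b c : 'I_n.+1).

Lemma sum_delta m (f : 'I_m -> R) (i : 'I_m) : \sum_a (a == i)%:R * f a = f i.
Proof.
rewrite (bigD1 i) //= eqxx mul1r big1 ?addr0// => a ai.
by rewrite (negbTE ai) mul0r.
Qed.

Lemma trtensDr k (p s t : tensor R n k) : trtens p (s + t) = trtens p s + trtens p t.
Proof.
case: k p s t => [|k] p s t; first by rewrite addr0.
apply/matrixP => i j; rewrite !mxE -mulrDr; congr (_ * _).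
by rewrite -big_split; apply: eq_bigr => J _; rewrite coefD mulrDr.
Qed.

Lemma trtensDl k (p s t : tensor R n k) : trtens (s + t) p = trtens s p + trtens t p.
Proof.
case: k p s t => [|k] p s t; first by rewrite addr0.
apply/matrixP => i j; rewrite !mxE -mulrDr; congr (_ * _).
by rewrite -big_split; apply: eq_bigr => J _; rewrite coefD mulrDl.
Qed.

Lemma trtensZr k (p t : tensor R n k) x : trtens p (x *: t) = x *: trtens p t.
Proof.
case: k p t => [|k] p t; first by rewrite scaler0.
apply/matrixP => i j; rewrite !mxE [RHS]mulrCA; congr (_ * _).
by rewrite big_distrr /=; apply: eq_bigr => J _; rewrite coefZ mulrCA.
Qed.

Lemma trtensZl k (p t : tensor R n k) x : trtens (x *: t) p = x *: trtens t p.
Proof.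
case: k p t => [|k] p t; first by rewrite scaler0.
apply/matrixP => i j; rewrite !mxE [RHS]mulrCA; congr (_ * _).
by rewrite big_distrr /=; apply: eq_bigr => J _; rewrite coefZ mulrA.
Qed.

Lemma trtens0r k (p : tensor R n k) : trtens p 0 = 0.
Proof. by rewrite -(scale0r 0) trtensZr scale0r. Qed.

Lemma trtens_sumr k (p : tensor R n k) (I : finType) (f : I -> tensor R n k) :
  trtens p (\sum_x f x) = \sum_x trtens p (f x).
Proof.
by apply: (big_morph (trtens p) (trtensDr p) (trtens0r p)).
Qed.

Lemma contrDr k (p s t : tensor R n k) : contr p (s + t) = contr p s + contr p t.
Proof.
rewrite -mulrDr; congr (_ * _).
by rewrite -big_split; apply: eq_bigr => J _; rewrite coefD mulrDr.
Qed.

Lemma contrZr k (p t : tensor R n k) x : contr p (x *: t) = x * contr p t.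
Proof.
rewrite mulrCA; congr (_ * _); rewrite big_distrr /=.
by apply: eq_bigr => J _; rewrite coefZ mulrCA.
Qed.

Lemma contr0r k (p : tensor R n k) : contr p 0 = 0.
Proof. by rewrite -(scale0r 0) contrZr mul0r. Qed.

Lemma contr_sumr k (p : tensor R n k) (I : finType) (f : I -> tensor R n k) :
  contr p (\sum_x f x) = \sum_x contr p (f x).
Proof. by apply: (big_morph (contr p) (contrDr p) (contr0r p)). Qed.

Lemma coef_iprod k (X : tensor R n 1) (t : tensor R n k.+1) J :
  coef (iprod X t) J = \sum_i coef1 X i * coef t [tuple of i :: J].
Proof. by rewrite coef_mktensor. Qed.

End TrtensLinear.

(** * The action of matrices on tensors of any rank *)

Section ActGeneral.
Context {R : realType} {n : nat}.
Implicit Types (G H : 'M[R]_n.+1).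

Lemma sum_tuple_prod k (f : 'I_k -> 'I_n.+1 -> R) :
  \sum_(J : k.-tuple 'I_n.+1) \prod_(a < k) f a (tnth J a) =
  \prod_(a < k) \sum_i f a i.
Proof.
elim: k f => [|k IH] f; first by rewrite sum_tuple0 !big_ord0.
rewrite sum_tupleS big_ord_recl -IH big_distrl /=; apply: eq_bigr => i _.
rewrite big_distrr /=; apply: eq_bigr => J _; rewrite big_ord_recl.
rewrite (tnth_nth ord0) /=; congr (_ * _); apply: eq_bigr => a _.
by rewrite !(tnth_nth ord0).
Qed.

Lemma prod_delta k (I J : k.-tuple 'I_n.+1) :
  \prod_(a < k) (tnth I a == tnth J a)%:R = (I == J)%:R :> R.
Proof.
have [->|IJ] := eqVneq I J; first by rewrite big1// => a _; rewrite eqxx.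
have [a Ia] : exists a, tnth I a != tnth J a.
  apply/existsP; apply: contraR IJ; rewrite negb_exists => /forallP E.
  by apply/eqP/eq_from_tnth => a; have := E a; rewrite negbK => /eqP.
by rewrite (bigD1 a) //= (negbTE Ia) mul0r.
Qed.

Lemma act1 k (t : tensor R n k) : act 1%:M t = t.
Proof.
apply: tensorP => I; rewrite coef_mktensor (bigD1 I) //=.
rewrite [X in _ + X]big1 ?addr0 => [|J JI].
  by rewrite big1 ?mul1r// => a _; rewrite mxE eqxx.
rewrite (eq_bigr (fun a => (tnth I a == tnth J a)%:R)).
  by rewrite prod_delta eq_sym (negbTE JI) mul0r.
by move=> a _; rewrite mxE.
Qed.

Lemma actM k G H (t : tensor R n k) : act (G *m H) t = act G (act H t).
Proof.
apply: tensorP => I; rewrite !coef_mktensor.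
under [RHS]eq_bigr do rewrite coef_mktensor big_distrr /=.
rewrite exchange_big /=; apply: eq_bigr => K _.
under [RHS]eq_bigr do rewrite mulrA -big_split /=.
rewrite -big_distrl /=; congr (_ * _).
rewrite (sum_tuple_prod (fun a i => G (tnth I a) i * H i (tnth K a))).
by apply: eq_bigr => a _; rewrite mxE.
Qed.

Lemma alternating2 (F : tensor R n 2) i j :
  alternating F -> coef2 F j i = - coef2 F i j.
Proof.
move=> altF; have := altF (tperm ord0 ord_max) [tuple i; j].
rewrite odd_tperm /= expr1 mulN1r => <-; congr coef.
rewrite [RHS]tuple2P !tnth_mktuple tpermL tpermR.
by rewrite !(tnth_nth ord0).
Qed.

Lemma alternating2_act G (F : tensor R n 2) i j :
  alternating F -> coef2 (act G F) j i = - coef2 (act G F) i j.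
Proof.
move=> altF; rewrite !coef2_act exchange_big -sumrN; apply: eq_bigr => c _.
rewrite -sumrN; apply: eq_bigr => d _; rewrite (alternating2 _ _ altF); ring.
Qed.

Lemma coef_act_cons k G (t : tensor R n k.+1) i (I : k.-tuple 'I_n.+1) :
  coef (act G t) [tuple of i :: I] =
  \sum_j G i j * \sum_(J : k.-tuple 'I_n.+1)
    (\prod_(a < k) G (tnth I a) (tnth J a)) * coef t [tuple of j :: J].
Proof.
rewrite coef_mktensor sum_tupleS; apply: eq_bigr => j _.
rewrite big_distrr /=; apply: eq_bigr => J _; rewrite big_ord_recl mulrA.
rewrite !(tnth_nth ord0) /=; congr (_ * _ * _); apply: eq_bigr => a _.
by rewrite !(tnth_nth ord0).
Qed.

(** The sum over [I] factors slot by slot into entries of [G^T *m H], hence into one Kronecker delta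
    per slot. *)
Lemma sum_act_act k G H (s t : k.-tuple 'I_n.+1 -> R) : G^T *m H = 1%:M ->
  \sum_(I : k.-tuple 'I_n.+1)
    (\sum_(J : k.-tuple 'I_n.+1) (\prod_(a < k) G (tnth I a) (tnth J a)) * s J) *
    (\sum_(K : k.-tuple 'I_n.+1) (\prod_(a < k) H (tnth I a) (tnth K a)) * t K) =
  \sum_(J : k.-tuple 'I_n.+1) s J * t J.
Proof.
move=> GH; under eq_bigr do rewrite big_distrl /=.
rewrite exchange_big /=; apply: eq_bigr => J _.
under eq_bigr do rewrite big_distrr /=.
rewrite exchange_big /= (bigD1 J) //= [X in _ + X]big1 ?addr0 => [|K KJ].
  under eq_bigr do rewrite mulrACA -big_split /=.
  rewrite -big_distrl /=.
  rewrite (sum_tuple_prod (fun a i => G i (tnth J a) * H i (tnth J a))).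
  rewrite big1 ?mul1r// => a _.
  have := congr1 (fun M : 'M[R]_n.+1 => M (tnth J a) (tnth J a)) GH.
  rewrite !mxE eqxx => E; rewrite -[RHS]E.
  by apply: eq_bigr => i _; rewrite mxE.
under eq_bigr do rewrite mulrACA -big_split /=.
rewrite -big_distrl /=.
rewrite (sum_tuple_prod (fun a i => G i (tnth J a) * H i (tnth K a))).
rewrite (eq_bigr (fun a => (tnth J a == tnth K a)%:R)).
  by rewrite prod_delta eq_sym (negbTE KJ) mul0r.
move=> a _.
have := congr1 (fun M : 'M[R]_n.+1 => M (tnth J a) (tnth K a)) GH.
by rewrite !mxE => <-; apply: eq_bigr => i _; rewrite mxE.
Qed.

Lemma sum_bilinear (I : finType) m1 m2 (x : 'I_m1 -> R) (y : 'I_m2 -> R)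
    (A : 'I_m1 -> I -> R) (B : 'I_m2 -> I -> R) :
  \sum_K (\sum_i x i * A i K) * (\sum_j y j * B j K) =
  \sum_j (\sum_i x i * \sum_K A i K * B j K) * y j.
Proof.
under eq_bigr do rewrite big_distrr /=.
rewrite exchange_big /=; apply: eq_bigr => j _.
under eq_bigr do rewrite big_distrl /=.
rewrite exchange_big /= big_distrl /=; apply: eq_bigr => i _.
rewrite big_distrr big_distrl /=; apply: eq_bigr => K _; ring.
Qed.

Lemma contr_act k G H (s t : tensor R n k) : G^T *m H = 1%:M ->
  contr (act G s) (act H t) = contr s t.
Proof.
move=> GH; congr (_ * _); rewrite -[RHS](sum_act_act _ _ GH).
by apply: eq_bigr => I _; rewrite !coef_mktensor.
Qed.

Lemma trtens_act k G H (s t : tensor R n k) : G^T *m H = 1%:M ->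
  trtens (act G s) (act H t) = G *m trtens s t *m H^T.
Proof.
case: k s t => [|k] s t GH; first by rewrite mulmx0 mul0mx.
apply/matrixP => i j; rewrite !mxE.
under eq_bigr do rewrite !coef_act_cons.
rewrite sum_bilinear big_distrr /=; apply: eq_bigr => j' _.
rewrite !mxE mulrA; congr (_ * _); rewrite big_distrr /=.
by apply: eq_bigr => i' _; rewrite mxE mulrCA (sum_act_act _ _ GH).
Qed.

Lemma mxD (X Y : 'M[R]_n.+1) i j : (X + Y) i j = X i j + Y i j.
Proof. by rewrite mxE. Qed.

Lemma mxB (X Y : 'M[R]_n.+1) i j : (X - Y) i j = X i j - Y i j.
Proof. by rewrite !mxE. Qed.

Lemma mxN (X : 'M[R]_n.+1) i j : (- X) i j = - X i j.
Proof. by rewrite !mxE. Qed.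

Lemma mxZ (y : R) (X : 'M[R]_n.+1) i j : (y *: X) i j = y * X i j.
Proof. by rewrite mxE. Qed.

Lemma trtens_sym m (s t : tensor R n m) i j : trtens s t i j = trtens t s j i.
Proof.
case: m s t => [|m] s t; first by rewrite !mxE.
by rewrite !mxE; congr (_ * _); apply: eq_bigr => J _; rewrite mulrC.
Qed.

Lemma trmx_invmx_sym G : G^T = G -> (invmx G)^T = invmx G.
Proof. by move=> Gs; rewrite trmx_inv Gs. Qed.

Lemma sharp_flat G m (t : tensor R n m) : G \in unitmx -> sharp G (flat G t) = t.
Proof. by move=> Gu; rewrite /sharp /flat -actM mulVmx// act1. Qed.

Lemma vec_flat G (t : tensor R n 1) : G^T = G -> vec (flat G t) = vec t *m G.
Proof. by move=> Gs; rewrite /flat vec_act Gs. Qed.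

End ActGeneral.

(** * The magnetic form and its derivatives in velocity and field *)

Section FluidAlgebra.
Context {R : realType} {k : nat} (x : R).
Let n := k.+2.
Implicit Types (i j a b c : 'I_n.+1).
Local Notation lc := (@levi_civita R n).
Variable p : tensor R n k.
Hypothesis altp : alternating p.
Variables (g : 'M[R]_n.+1) (u : tensor R n 1).
Local Notation V := (vol g).

(** The magnetic form for [n = k + 2], with degree [k] in place of [n - 2], so that no degrees need
    to be converted. The letter [x] stands for the speed of light. *)
Definition mag (v : tensor R n 1) (F : tensor R n 2) : tensor R n k :=
  - x^-1 *: iprod v (hodge k.+1 g F).

Definition lc_tensor a b c : tensor R n k := mktensor (fun J => lc [:: a, b, c & J]).

Lemma coef_lc_tensor a b c J : coef (lc_tensor a b c) J = lc [:: a, b, c & J].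
Proof. exact: coef_mktensor. Qed.

Lemma contr_lc_tensor a b c : contr p (lc_tensor a b c) = lc_contr p a b c.
Proof. by congr (_ * _); apply: eq_bigr => J _; rewrite coef_mktensor. Qed.

Lemma magE v F : mag v F =
  \sum_a \sum_b \sum_c (- x^-1 * V * 2^-1 * coef2 (sharp g F) a b * coef1 v c)
    *: lc_tensor a b c.
Proof.
apply: tensorP => J; rewrite coefZ coef_iprod coef_sum.
under [RHS]eq_bigr do rewrite coef_sum.
under [RHS]eq_bigr do under eq_bigr do rewrite coef_sum.
under [RHS]eq_bigr do rewrite exchange_big.
rewrite [RHS]exchange_big /= big_distrr /=; apply: eq_bigr => c _.
rewrite coef_mktensor sum_tuple2 mulrA !big_distrr /=; apply: eq_bigr => a _.
rewrite !big_distrr /=; apply: eq_bigr => b _.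
rewrite coefZ coef_lc_tensor /coef2 -[2`!]/2%N; ring.
Qed.

(** By [contr_mag], the gradient of the linear function [contr p (mag v F)] of [v]. *)
Definition dmag_du F c : R := - x^-1 * V * 2^-1 *
  \sum_a \sum_b coef2 (sharp g F) a b * lc_contr p a b c.

Lemma contr_mag v F : contr p (mag v F) = \sum_c coef1 v c * dmag_du F c.
Proof.
rewrite magE contr_sumr.
under eq_bigr do rewrite contr_sumr.
under eq_bigr do under eq_bigr do rewrite contr_sumr.
under eq_bigr do rewrite exchange_big.
rewrite exchange_big /=; apply: eq_bigr => c _.
rewrite /dmag_du mulrCA big_distrr /= big_distrr /=; apply: eq_bigr => a _.
rewrite !big_distrr /=; apply: eq_bigr => b _.
by rewrite contrZr contr_lc_tensor; ring.
Qed.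

(** The gradient of [contr p (mag u F)] with respect to [sharp g F], for the pairing with factor
    1/2. The gradient with respect to [F] itself is obtained by raising both indices. *)
Definition dmag_dF a b : R := - x^-1 * V * \sum_c coef1 u c * lc_contr p a b c.

Lemma dmag_dF_swap a b : dmag_dF b a = - dmag_dF a b.
Proof.
rewrite /dmag_dF -mulrN; congr (_ * _); rewrite -sumrN; apply: eq_bigr => c _.
by rewrite (lc_contr_swap12 p) mulrN.
Qed.

Lemma contr_mag_dF F :
  contr p (mag u F) = 2^-1 * \sum_a \sum_b coef2 (sharp g F) a b * dmag_dF a b.
Proof.
rewrite contr_mag /dmag_du /dmag_dF.
under eq_bigr do rewrite mulrCA big_distrr /= big_distrr /=.
rewrite exchange_big big_distrr /=; apply: eq_bigr => a _.
under eq_bigr do rewrite big_distrr /= big_distrr /=.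
rewrite exchange_big big_distrr /=; apply: eq_bigr => b _.
by rewrite !big_distrr /=; apply: eq_bigr => c _; ring.
Qed.

(** Multiply [lc_contr_subst] by the coefficients [K] of [mag u F] and sum. The substitutions in the
    two slots of [F] each give half of the left-hand side, because [F] is antisymmetric; the one in
    the slot of [u] gives the term with [dmag_du]; the slots of [J] give [trtens p (mag u F)]. *)
Lemma sharp_dmag_dF F i j : alternating F ->
  \sum_b coef2 (sharp g F) i b * dmag_dF j b =
  (i == j)%:R * contr p (mag u F) - coef1 u i * dmag_du F j
  - trtens p (mag u F) i j.
Proof.
move=> altF.
pose K a b c := - x^-1 * V * 2^-1 * coef2 (sharp g F) a b * coef1 u c.
have -> : (i == j)%:R * contr p (mag u F) =
    \sum_a \sum_b \sum_c K a b c * ((i == j)%:R * lc_contr p a b c).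
  rewrite magE contr_sumr big_distrr /=; apply: eq_bigr => a _.
  rewrite contr_sumr big_distrr /=; apply: eq_bigr => b _.
  rewrite contr_sumr big_distrr /=; apply: eq_bigr => c _.
  by rewrite contrZr contr_lc_tensor mulrCA.
have -> : trtens p (mag u F) i j =
    \sum_a \sum_b \sum_c K a b c * lc_contr4 p i a b c j.
  rewrite magE trtens_sumr summxE; apply: eq_bigr => a _.
  rewrite trtens_sumr summxE; apply: eq_bigr => b _.
  rewrite trtens_sumr summxE; apply: eq_bigr => c _.
  by rewrite trtensZr mxE.
under [in RHS]eq_bigr do under eq_bigr do under eq_bigr do
  rewrite lc_contr_subst// !mulrDr.
under [in RHS]eq_bigr do under eq_bigr do rewrite !big_split /=.
under [in RHS]eq_bigr do rewrite !big_split /=.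
rewrite !big_split /=.
have T1 : \sum_a \sum_b \sum_c K a b c * ((a == i)%:R * lc_contr p j b c) =
    2^-1 * \sum_b coef2 (sharp g F) i b * dmag_dF j b.
  under eq_bigr => a _.
    under eq_bigr do under eq_bigr do rewrite mulrCA.
    under eq_bigr do rewrite -big_distrr /=.
    rewrite -big_distrr /=; over.
  rewrite sum_delta big_distrr /=; apply: eq_bigr => b _.
  by rewrite /dmag_dF !big_distrr /=; apply: eq_bigr => c _; rewrite /K; ring.
have T2 : \sum_a \sum_b \sum_c K a b c * ((b == i)%:R * lc_contr p a j c) =
    2^-1 * \sum_b coef2 (sharp g F) i b * dmag_dF j b.
  under eq_bigr => a _.
    under eq_bigr do under eq_bigr do rewrite mulrCA.
    under eq_bigr do rewrite -big_distrr /=.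
    rewrite sum_delta; over.
  rewrite big_distrr /=; apply: eq_bigr => a _.
  rewrite /dmag_dF !big_distrr /=; apply: eq_bigr => c _.
  by rewrite /K (lc_contr_swap12 p j a) (alternating2_act _ _ _ altF); ring.
have T3 : \sum_a \sum_b \sum_c K a b c * ((c == i)%:R * lc_contr p a b j) =
    coef1 u i * dmag_du F j.
  rewrite /dmag_du mulrCA !big_distrr /=; apply: eq_bigr => a _.
  rewrite !big_distrr /=; apply: eq_bigr => b _.
  under eq_bigr do rewrite mulrCA.
  by rewrite sum_delta /K; ring.
rewrite T1 T2 T3; lra.
Qed.

End FluidAlgebra.

(** * The Poynting one-form of a tangential multivector *)

Section Poynting.
Context {R : realType} {k : nat} (x : R).
Let n := k.+2.
Implicit Types (i j a b c : 'I_n.+1).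
Local Notation lc := (@levi_civita R n).
Variable p : tensor R n k.
Hypothesis altp : alternating p.
Variables (g : 'M[R]_n.+1) (u : tensor R n 1) (F : tensor R n 2).
Hypothesis altF : alternating F.
Hypothesis gsym : g^T = g.
Hypothesis gunit : g \in unitmx.
Hypothesis x0 : x != 0.
Hypothesis unorm : sqnorm g u = - x ^+ 2.
Hypothesis tang : forall (t : tensor R n k) j,
  \sum_i coef1 (flat g u) i * trtens p t i j = 0.
Local Notation V := (vol g).
Local Notation ub := (flat g u).
Local Notation Fs := (sharp g F).

Definition poynting : tensor R n 1 := ((-1) ^+ n * x^-1) *:
  iprod (sharp g (electric x u F)) (iprod u (hodge 3 g (flat g p))).

Lemma coef_poynting c : coef1 poynting c = x^-1 * V *
  \sum_b coef1 (sharp g (electric x u F)) b *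
    \sum_a coef1 u a * lc_contr p a b c.
Proof.
rewrite /coef1 coefZ coef_iprod.
(* The sign in the definition and the one from moving the three free indices to the front are the
   same [s], so they cancel. *)
have [s sE ss] : exists2 s : R, (-1) ^+ n = s & s * s = 1.
  by exists ((-1) ^+ n) => //; rewrite -expr2 sqrr_sign.
rewrite sE.
rewrite (mulrC s) -!mulrA; congr (_ * _).
rewrite !big_distrr /=; apply: eq_bigr => b _.
rewrite coef_iprod mulrCA [RHS]mulrCA; congr (_ * _).
rewrite !big_distrr /=; apply: eq_bigr => a _.
rewrite mulrCA [RHS]mulrCA; congr (_ * _).
rewrite coef_mktensor sharp_flat// /lc_contr mulrCA [RHS]mulrCA; congr (_ * _).
rewrite !big_distrr /=; apply: eq_bigr => I _.
rewrite levi_civita_cat3 ?size_tuple// sE.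
by rewrite -[RHS]mul1r -ss; ring.
Qed.

Lemma sum_u_ub : \sum_i coef1 u i * coef1 ub i = - x ^+ 2.
Proof. by rewrite -unorm /sqnorm contr1E. Qed.

Lemma sum_ub_Fs b :
  \sum_a coef1 ub a * coef2 Fs a b = - x * coef1 (sharp g (electric x u F)) b.
Proof.
have E : vec ub *m mat Fs = - x *: vec (sharp g (electric x u F)).
  rewrite vec_flat// /sharp mat_act vec_act (trmx_invmx_sym gsym) !mulmxA mulmxK//.
  rewrite scalemxAl; congr (_ *m _); apply/rowP => j.
  rewrite !mxE coef1Z mulrA mulrNN mulfV// mul1r /coef1 coef_iprod.
  apply: eq_bigr => i _; rewrite !mxE; congr (_ * _); congr (coef _ _).
have := congr1 (fun M : 'rV[R]_n.+1 => M ord0 b) E; rewrite !mxE => <-.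
by apply: eq_bigr => a _; rewrite !mxE.
Qed.

(** Contract [lc_contr_subst] with [u] and its covector: tangency of [p] kills the fourth term. For
    the 3-form [omega] with components [lc_contr p], this says that [- x ^+ 2] times [omega] is the
    exterior product of the covector of [u] with the interior product of [u] and [omega]. *)
Lemma lc_contr_ub a b c :
  - x ^+ 2 * lc_contr p a b c =
  coef1 ub a * (\sum_j coef1 u j * lc_contr p j b c)
  - coef1 ub b * (\sum_j coef1 u j * lc_contr p j a c)
  + coef1 ub c * (\sum_j coef1 u j * lc_contr p a b j).
Proof.
have E : \sum_j coef1 u j * \sum_i coef1 ub i * ((i == j)%:R * lc_contr p a b c)
   = - x ^+ 2 * lc_contr p a b c.
  rewrite -sum_u_ub big_distrl /=; apply: eq_bigr => j _.
  rewrite -mulrA; congr (_ * _).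
  under eq_bigr do rewrite mulrCA.
  by rewrite sum_delta.
rewrite -E.
have D (f : 'I_n.+1 -> R) d : \sum_i coef1 ub i * ((d == i)%:R * f d) =
    coef1 ub d * f d.
  under eq_bigr do rewrite mulrCA eq_sym.
  by rewrite (sum_delta (fun i => coef1 ub i * f d)).
under eq_bigr => j _.
  under eq_bigr do rewrite lc_contr_subst// !mulrDr.
  rewrite !big_split /= (tang (lc_tensor a b c)) addr0.
  have -> : \sum_i coef1 ub i * ((a == i)%:R * lc_contr p j b c) =
     coef1 ub a * lc_contr p j b c by exact: (D (fun=> _)).
  have -> : \sum_i coef1 ub i * ((b == i)%:R * lc_contr p a j c) =
     coef1 ub b * lc_contr p a j c by exact: (D (fun=> _)).
  have -> : \sum_i coef1 ub i * ((c == i)%:R * lc_contr p a b j) =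
     coef1 ub c * lc_contr p a b j by exact: (D (fun=> _)).
  rewrite !mulrDr (lc_contr_swap12 p j a c); over.
rewrite !big_split /= -!mulrN -sumrN !big_distrr /=.
by congr (_ + _ + _); apply: eq_bigr => j _; ring.
Qed.

(** Insert [lc_contr_ub] into [dmag_du]. The first two terms agree by antisymmetry of [F] and
    contract [F] with the covector of [u], which yields the electric field and hence the Poynting
    one-form; in the third term the pairing of [p] with the magnetic form reappears. *)
Lemma poyntingE c : coef1 poynting c =
  - x * dmag_du x p g F c - x^-1 * coef1 ub c * contr p (mag x g u F).
Proof.
pose L1 b c := \sum_j coef1 u j * lc_contr p j b c.
have SE : x * coef1 poynting c =
    - x^-1 * V * \sum_b (\sum_a coef1 ub a * coef2 Fs a b) * L1 b c.
  have -> : \sum_b (\sum_a coef1 ub a * coef2 Fs a b) * L1 b c =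
     - x * \sum_b coef1 (sharp g (electric x u F)) b *
       \sum_a coef1 u a * lc_contr p a b c.
    by rewrite big_distrr; apply: eq_bigr => b _; rewrite sum_ub_Fs -mulrA.
  by rewrite coef_poynting; field.
have UE : - x ^+ 2 * dmag_du x p g F c =
   - x^-1 * V * (\sum_b (\sum_a coef1 ub a * coef2 Fs a b) * L1 b c)
   + coef1 ub c * contr p (mag x g u F).
  rewrite contr_mag.
  have -> : \sum_j coef1 u j * dmag_du x p g F j =
    - x^-1 * V * 2^-1 * \sum_a \sum_b coef2 Fs a b *
       \sum_j coef1 u j * lc_contr p a b j.
    under eq_bigr do rewrite /dmag_du mulrCA.
    rewrite -big_distrr /=; congr (_ * _).
    under eq_bigr do rewrite big_distrr /=.
    rewrite exchange_big /=; apply: eq_bigr => a _.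
    under eq_bigr do rewrite big_distrr /=.
    rewrite exchange_big /=; apply: eq_bigr => b _.
    by rewrite big_distrr /=; apply: eq_bigr => j _; rewrite mulrCA.
  rewrite /dmag_du mulrCA.
  have -> : - x ^+ 2 * \sum_a \sum_b coef2 Fs a b * lc_contr p a b c =
     \sum_a \sum_b (coef2 Fs a b * coef1 ub a * L1 b c) -
     \sum_a \sum_b (coef2 Fs a b * coef1 ub b * L1 a c) +
     coef1 ub c * \sum_a \sum_b coef2 Fs a b *
       \sum_j coef1 u j * lc_contr p a b j.
    rewrite !big_distrr /= -sumrN -!big_split /=; apply: eq_bigr => a _.
    rewrite !big_distrr /= -sumrN -!big_split /=; apply: eq_bigr => b _.
    by rewrite mulrCA lc_contr_ub /L1; ring.
  have -> : \sum_a \sum_b (coef2 Fs a b * coef1 ub b * L1 a c) =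
     - \sum_a \sum_b (coef2 Fs a b * coef1 ub a * L1 b c).
    rewrite exchange_big /= -sumrN; apply: eq_bigr => a _.
    by rewrite -sumrN; apply: eq_bigr => b _; rewrite (alternating2_act _ _ _ altF); ring.
  have -> : \sum_b (\sum_a coef1 ub a * coef2 Fs a b) * L1 b c =
     \sum_a \sum_b (coef2 Fs a b * coef1 ub a * L1 b c).
    rewrite [RHS]exchange_big /=; apply: eq_bigr => b _.
    by rewrite big_distrl /=; apply: eq_bigr => a _; rewrite (mulrC (coef1 _ _)).
  by lra.
have : x * coef1 poynting c = x * (- x * dmag_du x p g F c
    - x^-1 * coef1 ub c * contr p (mag x g u F)).
  by rewrite SE; rewrite -[LHS](addrK (coef1 ub c * contr p (mag x g u F))) -UE;
    field.
exact: mulfI.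
Qed.

End Poynting.

(** * Comparison of the energy tensors in the variables (u, F) and (E, B) *)

Section TensorIdentity.
Context {R : realType} {k : nat} (x : R).
Let n := k.+2.
Implicit Types (i j a b c : 'I_n.+1).
Variables (p : tensor R n k) (e : tensor R n 1).
Hypothesis altp : alternating p.
Variables (g : 'M[R]_n.+1) (u : tensor R n 1) (F : tensor R n 2).
Hypothesis altF : alternating F.
Hypothesis gsym : g^T = g.
Hypothesis gunit : g \in unitmx.
Hypothesis x0 : x != 0.
Hypothesis unorm : sqnorm g u = - x ^+ 2.
Hypothesis tang : forall (t : tensor R n k) j,
  \sum_i coef1 (flat g u) i * trtens p t i j = 0.
Local Notation ub := (flat g u).
Local Notation E := (electric x u F).
Local Notation B := (mag x g u F).
Local Notation pB := (contr p B).

Lemma coef_electric v j :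
  coef1 (electric x v F) j = - x^-1 * \sum_i coef1 v i * coef2 F i j.
Proof.
rewrite /coef1 coefZ coef_iprod; congr (_ * _); exact: eq_bigr.
Qed.

(** [M1] is [sharp_dmag_dF] written with matrices; transposing it and conjugating by the metric
    moves the raised indices from [F] to [f]. *)
Lemma trtens_dmag_dF i j (f : tensor R n 2) :
  (forall a b, coef2 f a b = dmag_dF x p g u a b) ->
  trtens (act (invmx g) f) F i j =
  (i == j)%:R * pB - coef1 ub j * (\sum_a invmx g i a * dmag_du x p g F a)
  - trtens (sharp g B) (flat g p) i j.
Proof.
move=> fE.
have gT := trmx_invmx_sym gsym.
pose q : 'rV[R]_n.+1 := \row_a dmag_du x p g F a.
have M1 : mat (sharp g F) *m (mat f)^T =
    pB%:M - (vec u)^T *m q - trtens p B.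
  apply/matrixP => a b; rewrite !mxE big_ord1 !mxE -mulr_natl.
  rewrite -(sharp_dmag_dF x altp g u a b altF).
  by apply: eq_bigr => l _; rewrite !mxE fE.
have M2 : mat (act (invmx g) f) *m (mat F)^T =
    invmx g *m (mat (sharp g F) *m (mat f)^T)^T *m g.
  by rewrite /sharp !mat_act !trmx_mul !trmxK gT !mulmxA mulmxKV.
have T : trtens (sharp g B) (flat g p) = invmx g *m (trtens p B)^T *m g.
  rewrite trtens_act ?gT ?mulVmx// gsym; congr (_ *m _ *m _).
  by apply/matrixP => a b; rewrite trtens_sym mxE.
have -> : trtens (act (invmx g) f) F i j =
    (mat (act (invmx g) f) *m (mat F)^T) i j.
  by rewrite trtens2E mxE; apply: eq_bigr => l _; rewrite !mxE.
rewrite M2 M1 T.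
have -> : (pB%:M - (vec u)^T *m q - trtens p B)^T =
    pB%:M - q^T *m vec u - (trtens p B)^T.
  by rewrite linearB linearB /= tr_scalar_mx trmx_mul trmxK.
rewrite mulmxBr mulmxBr mulmxBl mulmxBl mul_mx_scalar -scalemxAl mulVmx//.
rewrite mulmxA -[in X in _ - X - _]mulmxA -vec_flat//.
rewrite mxB mxB mxZ; congr (_ - _ - _); first by rewrite mxE mulrC.
rewrite !mxE big_ord1 !mxE mulrC; congr (_ * _).
by apply: eq_bigr => a _; rewrite !mxE.
Qed.

(** The derivatives of e(u, F) = eps(E, B) in F and in u, where [e] = d eps/dE and
    [p] = d eps/dB. *)
Definition den_dF : tensor R n 2 :=
  mktensor2 (fun i j => - x^-1 * (coef1 u i * coef1 e j - coef1 u j * coef1 e i))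
  + act (invmx g) (mktensor2 (dmag_dF x p g u)).

Definition den_du : tensor R n 1 :=
  mktensor1 (fun i => - x^-1 * \sum_j coef2 F i j * coef1 e j + dmag_du x p g F i).

(** [E] and [B] are linear in [u], so the derivative along [u] itself reproduces both pairings, as
    in Euler's identity. *)
Lemma contr_den_du : contr den_du u = contr e E + pB.
Proof.
rewrite contr_mag !contr1E.
under eq_bigr do rewrite coef1_mktensor1 mulrDl.
rewrite big_split /=; congr (_ + _); last by apply: eq_bigr => i _; rewrite mulrC.
under [RHS]eq_bigr do rewrite coef_electric mulrCA big_distrr /=.
rewrite -big_distrr /= exchange_big /= big_distrr /=; apply: eq_bigr => i _.
rewrite -mulrA; congr (_ * _); rewrite big_distrl /=.
by apply: eq_bigr => j _; ring.
Qed.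

Lemma trtens_den_dF i j : trtens den_dF F i j =
  coef1 u i * (- x^-1 * \sum_l coef2 F j l * coef1 e l) + coef1 e i * coef1 E j
  + (i == j)%:R * pB - coef1 ub j * (\sum_a invmx g i a * dmag_du x p g F a)
  - trtens (sharp g B) (flat g p) i j.
Proof.
rewrite /den_dF trtensDl mxE trtens_dmag_dF; last by move=> a b; rewrite coef2_mktensor2.
rewrite !addrA; congr (_ + _ - _ - _).
rewrite trtens2E coef_electric.
under eq_bigr do rewrite coef2_mktensor2.
rewrite [X in _ + X]mulrCA ![in RHS]big_distrr /= -big_split /=.
apply: eq_bigr => l _; rewrite (alternating2 l j altF); ring.
Qed.

(** By [poyntingE] the Poynting one-form and its raised version are combinations of [dmag_du] and
    [pB] times [u]. After the expansions of [den_dF] and [den_du] both sides contain the same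
    entries, and the multiples of [pB] reassemble into the projector. *)
Lemma energy_tensor_identity :
  trtens den_dF F - trtens u den_du - contr den_du u *: (x ^- 2 *: uu g u) =
  x^-1 *: (trtens u (poynting x p g u F) +
           trtens (sharp g (poynting x p g u F)) ub)
  + trtens e E - trtens (sharp g B) (flat g p) + pB *: proj_orth x g u
  - contr e E *: (x ^- 2 *: uu g u).
Proof.
have P i : coef1 (poynting x p g u F) i =
    - x * dmag_du x p g F i - x^-1 * coef1 ub i * pB by exact: poyntingE.
have Ps i : coef1 (sharp g (poynting x p g u F)) i =
    - x * (\sum_a invmx g i a * dmag_du x p g F a) - x^-1 * coef1 u i * pB.
  rewrite coef1_act; under eq_bigr do rewrite P mulrBr.
  rewrite sumrB; congr (_ - _).
    by rewrite big_distrr /=; apply: eq_bigr => a _; rewrite mulrCA.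
  have -> : coef1 u i = \sum_a invmx g i a * coef1 ub a.
    by rewrite -coef1_act -/(sharp g ub) sharp_flat.
  rewrite -mulrA big_distrl big_distrr /=; apply: eq_bigr => a _; ring.
apply/matrixP => i j.
rewrite contr_den_du /uu /proj_orth /uu.
rewrite !(mxN, mxD, mxZ).
rewrite trtens_den_dF !trtens1E.
set t := trtens (sharp g B) _ i j.
rewrite coef1_mktensor1 P Ps.
rewrite [(1%:M) i j]mxE.
by field.
Qed.

End TensorIdentity.

(** * The reflection along a timelike vector and its action on forms *)

Section Reflection.
Context {R : realType} {n : nat} (x : R).
Implicit Types (i j : 'I_n.+1).
Variables (g : 'M[R]_n.+1) (u : tensor R n 1).
Hypothesis gsym : g^T = g.
Hypothesis x0 : x != 0.
Hypothesis unorm : sqnorm g u = - x ^+ 2.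
Local Notation ub := (flat g u).

(** It preserves g and has determinant -1. *)
Definition reflection : 'M[R]_n.+1 :=
  1%:M + (2 * x ^- 2) *: ((vec ub)^T *m vec u).

Lemma reflectionE i j :
  reflection i j = (i == j)%:R + 2 * x ^- 2 * coef1 ub i * coef1 u j.
Proof. by rewrite /reflection mxD mxZ !mxE big_ord1 !mxE mulrA. Qed.

Lemma u_ub : vec u *m (vec ub)^T = (- x ^+ 2)%:M.
Proof.
apply/matrixP => i j; rewrite !ord1 !mxE eqxx mulr1n -unorm /sqnorm contr1E.
by apply: eq_bigr => l _; rewrite !mxE.
Qed.

Lemma reflection_sq : reflection *m reflection = 1%:M.
Proof.
rewrite /reflection mulmxDl mul1mx mulmxDr mulmx1 -[RHS]addr0 -!addrA.
congr (_ + _); rewrite -scalemxAl -scalemxAr mulmxA -(mulmxA _ (vec u)) u_ub.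
rewrite mul_mx_scalar -scalemxAl !scalerA -!scalerDl.
rewrite [X in X *: _](_ : _ = 0) ?scale0r//.
by field.
Qed.

Lemma reflection_unit : reflection \in unitmx.
Proof. by case: (mulmx1_unit reflection_sq). Qed.

Lemma reflection_metric : reflection *m g *m reflection^T = g.
Proof.
have ug : vec u *m g = vec ub by rewrite vec_flat.
have gu : g *m (vec u)^T = (vec ub)^T by rewrite -ug trmx_mul gsym.
rewrite /reflection; set y := 2 * _.
have -> : (1%:M + y *: ((vec ub)^T *m vec u))^T = 1%:M + y *: ((vec u)^T *m vec ub).
  by rewrite linearD /= trmx1 linearZ /= trmx_mul trmxK.
rewrite mulmxDl mul1mx -scalemxAl -mulmxA ug mulmxDr mulmx1 mulmxDl.
rewrite -!scalemxAr mulmxA gu -scalemxAl mulmxA -(mulmxA _ (vec ub)).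
have -> : vec ub *m (vec u)^T = (- x ^+ 2)%:M.
  by rewrite -[LHS]trmxK trmx_mul trmxK u_ub tr_scalar_mx.
rewrite mul_mx_scalar -scalemxAl !scalerA -!addrA -!scalerDl.
rewrite [X in X *: _](_ : _ = 0) ?scale0r ?addr0//.
by rewrite /y; field.
Qed.

(** In each slot the reflection differs from the identity by a contraction with [u], which vanishes
    here; the induction removes the first slot. *)
Lemma act_reflection k (t : tensor R n k) :
  (forall (I : k.-tuple 'I_n.+1) a, \sum_j coef1 u j * coef t (tsubst I a j) = 0) ->
  act reflection t = t.
Proof.
elim: k t => [|k IH] t ut.
  apply: tensorP => I; rewrite coef_mktensor sum_tuple0 big_ord0 mul1r.
  by congr coef; apply/esym/eqP; rewrite -val_eqE /= tuple0.
apply: tensorP => I; rewrite [I]tuple_eta coef_act_cons.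
set i := thead I; set J := behead_tuple I.
pose ti : tensor R n k := mktensor (fun K => coef t [tuple of i :: K]).
transitivity (coef (act reflection ti) J); last first.
  rewrite IH ?coef_mktensor// => K a.
  rewrite -[RHS](ut [tuple of i :: K] (lift ord0 a)).
  apply: eq_bigr => j _; rewrite coef_mktensor; congr (_ * coef t _).
  apply: eq_from_tnth => b; rewrite [RHS]tnth_mktuple.
  case: (unliftP ord0 b) => [b'|] ->; last first.
    by rewrite (negbTE (neq_lift _ _)) !(tnth_nth ord0).
  by rewrite (inj_eq lift_inj) !tnthS tnth_mktuple.
rewrite coef_mktensor.
under eq_bigr do rewrite reflectionE mulrDl.
rewrite big_split /= [X in _ + X](_ : _ = 0) ?addr0; last first.
  under eq_bigr do rewrite big_distrr /=.
  rewrite exchange_big /= big1// => K _.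
  under eq_bigr do rewrite mulrCA -!mulrA.
  rewrite -!big_distrr /=.
  have := ut [tuple of i :: K] ord0.
  rewrite [X in X = 0 -> _](_ : _ = \sum_j coef1 u j * coef t [tuple of j :: K]).
    by move=> ->; rewrite !mulr0.
  apply: eq_bigr => j _; congr (_ * coef t _).
  apply: eq_from_tnth => b; rewrite tnth_mktuple.
  case: (unliftP ord0 b) => [b'|] ->; last by rewrite eqxx (tnth_nth ord0).
  by rewrite !(tnth_nth ord0).
under eq_bigr do rewrite eq_sym.
rewrite sum_delta; apply: eq_bigr => K _.
by rewrite [in RHS]coef_mktensor.
Qed.

(** The exterior product of the rows of [M]. In this form the action of a matrix is a right
    multiplication of [M], and row operations contribute their determinant. *)
Definition det_tensor k (M : 'M[R]_(k, n.+1)) : tensor R n k :=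
  mktensor (fun J => \det (\matrix_(b, a) M a (tnth J b))).

Lemma act_det_tensor k G (M : 'M[R]_(k, n.+1)) :
  act G (det_tensor M) = det_tensor (M *m G^T).
Proof.
apply: tensorP => I; rewrite !coef_mktensor.
under eq_bigr do rewrite coef_mktensor big_distrr /=.
rewrite exchange_big /=; apply: eq_bigr => s _.
under eq_bigr do rewrite mulrCA -big_split /=.
rewrite -big_distrr /=; congr (_ * _).
transitivity (\prod_(a < k) \sum_i G (tnth I a) i * M (s a) i).
  rewrite -sum_tuple_prod; apply: eq_bigr => J _.
  by apply: eq_bigr => a _; rewrite mxE.
by apply: eq_bigr => a _; rewrite !mxE; apply: eq_bigr => i _;
  rewrite mxE mulrC.
Qed.

Lemma det_tensorM k (A : 'M[R]_k) (M : 'M[R]_(k, n.+1)) :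
  det_tensor (A *m M) = \det A *: det_tensor M.
Proof.
apply: tensorP => I; rewrite coefZ !coef_mktensor mulrC -(det_tr A) -det_mulmx.
congr (\det _); apply/matrixP => a b; rewrite !mxE.
by apply: eq_bigr => c _; rewrite !mxE mulrC.
Qed.

Lemma alternating_det_tensor k (M : 'M[R]_(k, n.+1)) : alternating (det_tensor M).
Proof.
move=> s I; rewrite !coef_mktensor -det_perm -det_mulmx -row_permE.
by congr (\det _); apply/matrixP => a b; rewrite !mxE tnth_mktuple.
Qed.

Lemma wedge_basis_det k (I : k.-tuple 'I_n.+1) :
  wedge_basis R I = det_tensor (\matrix_(a, i) (tnth I a == i)%:R).
Proof.
apply: tensorP => J; rewrite !coef_mktensor -det_tr; congr (\det _).
by apply/matrixP => a b; rewrite !mxE.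
Qed.

Lemma alternating_wedge_basis k (I : k.-tuple 'I_n.+1) :
  alternating (wedge_basis R I).
Proof. by rewrite wedge_basis_det; exact: alternating_det_tensor. Qed.

(** The exterior product of the covector [v] with the basis form of [J]. *)
Definition wedge_covector k (v : tensor R n 1) (J : k.-tuple 'I_n.+1) :=
  \sum_i coef1 v i *: wedge_basis R [tuple of i :: J].

Definition wedge_mx k (v : tensor R n 1) (J : k.-tuple 'I_n.+1) :
    'M[R]_(k.+1, n.+1) := \matrix_(a, i)
  if unlift ord0 a is Some b then (tnth J b == i)%:R else coef1 v i.

Lemma wedge_covector_det k v (J : k.-tuple 'I_n.+1) :
  wedge_covector v J = det_tensor (wedge_mx v J).
Proof.
apply: tensorP => I; rewrite coef_sum coef_mktensor.
set N : 'M[R]_k.+1 := \matrix_(b, a) _.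
rewrite (expand_det_col N ord0).
transitivity (\sum_i \sum_b coef1 v i * ((i == tnth I b)%:R * cofactor N b ord0)).
  apply: eq_bigr => i _; rewrite coefZ wedge_basis_det coef_mktensor.
  rewrite (expand_det_col _ ord0) big_distrr /=; apply: eq_bigr => b _.
  rewrite !mxE tnth0; congr (_ * (_ * _)).
  congr (_ * \det _); apply/matrixP => c d; rewrite !mxE liftK.
  by rewrite tnthS.
rewrite exchange_big /=; apply: eq_bigr => b _.
under eq_bigr do rewrite mulrCA.
by rewrite sum_delta !mxE unlift_none.
Qed.

(** The reflection sends [ub] to its opposite and changes the other factors only by multiples of
    [ub]. On the rows of [wedge_mx] it thus acts by a triangular matrix whose diagonal is -1
    followed by ones. *)
Lemma reflection_wedge_covector k (J : k.-tuple 'I_n.+1) :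
  act reflection (wedge_covector ub J) = - wedge_covector ub J.
Proof.
rewrite wedge_covector_det act_det_tensor; set M := wedge_mx _ _.
have M0 i : M ord0 i = coef1 ub i by rewrite mxE unlift_none.
pose A : 'M[R]_k.+1 := \matrix_(a, b)
  ((a == b)%:R + (b == ord0)%:R * (2 * x ^- 2 * \sum_i M a i * coef1 u i)).
have -> : M *m reflection^T = A *m M.
  apply/matrixP => a i; rewrite [LHS]mxE [RHS]mxE.
  transitivity (M a i + 2 * x ^- 2 * coef1 ub i * \sum_j M a j * coef1 u j).
    under eq_bigr => j _.
      rewrite [reflection^T _ _]mxE reflectionE mulrDr eq_sym (mulrC (M a j)).
      rewrite mulrCA; over.
    by rewrite big_split /= sum_delta -big_distrr.
  have -> : \sum_b A a b * M b i = \sum_b ((b == a)%:R * M b i +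
      (b == ord0)%:R * ((2 * x ^- 2 * \sum_l M a l * coef1 u l) * M b i)).
    by apply: eq_bigr => b _; rewrite mxE eq_sym; ring.
  by rewrite big_split /= !sum_delta M0 mulrAC.
rewrite det_tensorM.
have -> : \det A = -1.
  rewrite det_trig.
    rewrite big_ord_recl big1 ?mulr1 => [|a _].
      rewrite mxE eqxx mul1r.
      have -> : \sum_i M ord0 i * coef1 u i = - x ^+ 2.
        rewrite -unorm /sqnorm contr1E; apply: eq_bigr => i _.
        by rewrite M0 mulrC.
      have -> : true%:R = 1 :> R by [].
      by field.
    by rewrite mxE eqxx eq_sym (negbTE (neq_lift _ _)) mul0r addr0.
  apply/is_trig_mxP => a b ab; rewrite mxE.
  have -> : (a == b) = false by apply/negP => /eqP E; rewrite E ltnn in ab.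
  have -> : (b == ord0) = false by apply/negP => /eqP E; rewrite E in ab.
  by rewrite mul0r addr0.
by rewrite scaleN1r.
Qed.

End Reflection.

(** * The Lagrangian of an energy density *)

Section Curves.
Context {R : realType}.
Implicit Types V W : normedModType R.

Lemma derive_lineE V W (f : V -> W) a v :
  'D_v f a = 'D_1 (fun t : R => f (a + t *: v)) 0.
Proof.
have E : (fun h : R => h^-1 *: (f (h *: v + a) - f a)) =
    (fun h : R => h^-1 *: (f (a + (h *: 1 + 0) *: v) - f (a + 0 *: v))).
  by apply/funext => h; rewrite scale0r !addr0 [h *: 1]mulr1 [a + _]addrC.
by rewrite /derive /= E.
Qed.

Lemma is_derive_curve V W (h : V -> W) (gam : R -> V) t gam' :
  differentiable h (gam t) -> is_derive t 1 gam gam' ->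
  is_derive t 1 (fun t => h (gam t)) ('d h (gam t) gam').
Proof.
move=> dh dg; have dg' : differentiable gam t by apply/derivable1_diffP.
have dc : differentiable (h \o gam) t by exact: differentiable_comp.
split; first exact/diff_derivable.
have gE : 'd gam t 1 = gam' by rewrite -deriveE//; exact: derive_val.
by rewrite deriveE// diff_comp//= gE.
Qed.

Lemma is_derive_pair V W (U : normedModType R) (f : U -> V) (g : U -> W) x v df dg :
  is_derive x v f df -> is_derive x v g dg ->
  is_derive x v (fun y => (f y, g y)) (df, dg).
Proof.
move=> [fv fE] [gv gE].
have : (fun h : R => h^-1 *: ((f (h *: v + x), g (h *: v + x)) - (f x, g x)))
    @ 0^' --> (df, dg).
  by rewrite -fE -gE; exact: (cvg_pair fv gv).
move=> H; split; first by apply/cvg_ex; exists (df, dg).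
exact: cvg_lim H.
Qed.

Lemma is_derive_affine1 V (a v : V) (t : R) :
  is_derive t 1 (fun t : R => a + t *: v) v.
Proof.
have E : (fun t : R => a + t *: v) = cst a + ( *:%R^~ v).
  by apply/funext.
split; last first.
  by apply: derive_line => h; rewrite [h *: 1]mulr1 scalerDl addrCA addrC.
by rewrite E; apply/diff_derivable/differentiableD.
Qed.

(** The two difference quotients coincide. This turns a derivative in one argument into a
    directional derivative of the function of all arguments. *)
Lemma derive_embed V W (U : normedModType R) (f : V -> W) (emb : U -> V) a v w :
  (forall t : R, emb (t *: v + a) = t *: w + emb a) ->
  'D_v (fun y => f (emb y)) a = 'D_w f (emb a).
Proof.
move=> E; rewrite /derive /=.
have -> : (fun h : R => h^-1 *: (f (emb (h *: v + a)) - f (emb a))) =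
    (fun h : R => h^-1 *: (f (h *: w + emb a) - f (emb a))).
  by apply/funext => h; rewrite E.
by [].
Qed.

End Curves.

Section LinearExpansion.
Context {R : realType} {n : nat}.

Lemma tensor1_sum (t : tensor R n 1) :
  t = \sum_i coef1 t i *: wedge_basis R [tuple i].
Proof.
apply: tensor1P => j; rewrite [in RHS]/coef1 coef_sum.
under eq_bigr do rewrite coefZ -/(coef1 _ j) coef1_wedge_basis mulrC.
by rewrite sum_delta.
Qed.

Lemma linear_tensor1 (phi : tensor R n 1 -> R) t :
  (forall a x y, phi (a *: x + y) = a * phi x + phi y) ->
  phi t = \sum_i coef1 t i * phi (wedge_basis R [tuple i]).
Proof.
move=> lphi.
have phi0 : phi 0 = 0 by have := lphi (-1) 0 0; rewrite scaler0 addr0 mulN1r addNr.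
have phiD x y : phi (x + y) = phi x + phi y.
  by have := lphi 1 x y; rewrite scale1r mul1r.
rewrite {1}(tensor1_sum t) (big_morph phi phiD phi0); apply: eq_bigr => i _.
by have := lphi (coef1 t i) (wedge_basis R [tuple i]) 0; rewrite !addr0 phi0 addr0.
Qed.

End LinearExpansion.

(** * Lorentzian metrics and timelike vectors *)

Section Lorentz.
Context {R : realType} {n : nat}.
Implicit Types (g : 'M[R]_n.+1) (w v : tensor R n 1).

Lemma lorentzian_det g : lorentzian g -> \det g < 0.
Proof.
case=> _ [P Pu PgP].
have : \det (P *m g *m P^T) = -1.
  rewrite PgP det_diag big_ord_recl !mxE eqxx big1 ?mulr1// => i _.
  by rewrite mxE.
rewrite !det_mulmx det_tr => E.
have P0 : \det P != 0 by move: Pu; rewrite unitmxE unitfE.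
have : 0 < \det P ^+ 2 by rewrite exprn_even_gt0.
have : \det g * \det P ^+ 2 < 0.
  rewrite (_ : _ * _ = -1) ?ltrN10// -E; ring.
move=> H1 H2; by rewrite -(pmulr_llt0 _ H2).
Qed.

Lemma lorentzian_unit g : lorentzian g -> g \in unitmx.
Proof. by move=> /lorentzian_det g0; rewrite unitmxE unitfE lt_eqF. Qed.

Lemma vol_gt0 g : lorentzian g -> 0 < vol g.
Proof. by move=> /lorentzian_det g0; rewrite sqrtr_gt0 oppr_gt0. Qed.

Lemma contr_flat_sym g w v : g^T = g ->
  contr w (flat g v) = contr v (flat g w).
Proof.
move=> gs; rewrite !contr1E.
under eq_bigr do rewrite coef1_act big_distrr /=.
rewrite exchange_big /=; apply: eq_bigr => i _.
rewrite coef1_act big_distrr /=; apply: eq_bigr => j _.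
by rewrite -{1}gs mxE; ring.
Qed.

Lemma contr1C w v : contr w v = contr v w.
Proof. by rewrite !contr1E; apply: eq_bigr => i _; rewrite mulrC. Qed.

Lemma sqnorm_line g w v t : g^T = g -> sqnorm g (w + t *: v) =
  sqnorm g w + t * (2 * contr v (flat g w)) + t * t * sqnorm g v.
Proof.
move=> gs; have flatD (s s' : tensor R n 1) : flat g (s + s') = flat g s + flat g s'.
  apply: tensor1P => i; rewrite coef1D !coef1_act -big_split /=.
  by apply: eq_bigr => j _; rewrite coef1D mulrDr.
have flatZ a (s : tensor R n 1) : flat g (a *: s) = a *: flat g s.
  apply: tensor1P => i; rewrite coef1Z !coef1_act big_distrr /=.
  by apply: eq_bigr => j _; rewrite coef1Z mulrCA.
rewrite /sqnorm flatD flatZ contrDr contrZr ![contr (w + _) _]contr1C.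
rewrite !contrDr !contrZr ![contr (flat _ _) _]contr1C (contr_flat_sym w v gs).
ring.
Qed.

End Lorentz.

(** * Derivatives of the Lagrangian of an energy density in (u, F) *)

Section EnergyLagrangian.
Context {R : realType} {n : nat} (c q : R).
Hypothesis c0 : 0 < c.
Local Notation T1 := (tensor R n 1).
Local Notation T2 := (tensor R n 2).
Variable g : 'M[R]_n.+1.
Hypothesis gL : lorentzian g.
Variable h : R * R * T1 * T2 -> R.
Local Notation V := (vol g).

(** The relation between [f] and [h] is assumed only near 0, because a perturbed [w] remains
    timelike only for small parameters. The affine part is the charge term, which is affine in every
    single argument. *)
Lemma derivative_energy (f : R -> R) (gam : R -> R * R * T1 * T2) S gam'
    (k a b : R) :
  gam 0 = S -> differentiable h S -> is_derive (0 : R) (1 : R) gam gam' ->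
  (\forall t \near (0 : R), f t = - h (gam t) * V + (k + t * a + b)) ->
  'D_1 f 0 = - 'd h S gam' * V + a.
Proof.
move=> <- dh dg fE.
have d1 : is_derive (0 : R) (1 : R) (fun t => h (gam t)) ('d h (gam 0) gam').
  exact: is_derive_curve.
have d2 : is_derive (0 : R) (1 : R) (fun t : R => k + t * a + b) a.
  have -> : (fun t : R => k + t * a + b) = (fun t : R => (k + b) + t *: a).
    by apply/funext => t; rewrite -[t *: a]/(t * a); ring.
  exact: is_derive_affine1.
have fE' : \forall t \near 0, (fun t => - V * h (gam t) + (k + t * a + b)) t = f t.
  by apply: filterS fE => t ->; ring.
have : is_derive (0 : R) (1 : R) (fun t => - V * h (gam t) + (k + t * a + b))
    ('d h (gam 0) gam' * - V + a).
  apply: is_deriveD.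
  apply: is_derive_eq (is_deriveZ (- V) d1) _.
  by rewrite mulrC.
move=> /(near_eq_is_derive fE')[_ ->].
by ring.
Qed.

Variable L : T1 -> T2 -> T1 -> R -> R -> R.
Hypothesis HL : forall A F w r s, alternating F -> timelike g w ->
  L A F w r s = - h (proper_density c g w r, proper_density c g w s,
    proper_velocity c g w, F) * V - q * r * contr w A.
Variables (A : T1) (F : T2) (w : T1) (r s : R).
Hypothesis altF : alternating F.
Hypothesis wt : timelike g w.
Local Notation u := (proper_velocity c g w).
Local Notation rho := (proper_density c g w r).
Local Notation sig := (proper_density c g w s).
Hypothesis dh : differentiable h (rho, sig, u, F).
Local Notation Dh := ('d h (rho, sig, u, F)).
Local Notation N := (Num.sqrt (- sqnorm g w)).

Lemma alternating_line k (t v : tensor R n k) (y : R) :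
  alternating t -> alternating v -> alternating (t + y *: v).
Proof.
by move=> at_ av p I; rewrite !coefD !coefZ at_ av mulrDr mulrCA.
Qed.

Lemma contr_wedge_basis (t : T1) i : contr t (wedge_basis R [tuple i]) = coef1 t i.
Proof.
rewrite contr1E; under eq_bigr do rewrite coef1_wedge_basis mulrC eq_sym.
by rewrite sum_delta.
Qed.

Lemma coef1_pderiv (f : T1 -> R) t i :
  coef1 (pderiv f t) i = 'D_(wedge_basis R [tuple i]) f t.
Proof. exact: coef_mktensor. Qed.

Lemma coef2_pderiv (f : T2 -> R) t i j :
  coef2 (pderiv f t) i j = 'D_(wedge_basis R [tuple i; j]) f t.
Proof. exact: coef_mktensor. Qed.

Lemma is_derive4 (a b : R -> R) (U : R -> T1) (f : R -> T2) da db dU df :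
  is_derive (0 : R) (1 : R) a da -> is_derive (0 : R) (1 : R) b db ->
  is_derive (0 : R) (1 : R) U dU -> is_derive (0 : R) (1 : R) f df ->
  is_derive (0 : R) (1 : R) (fun t => (a t, b t, U t, f t)) (da, db, dU, df).
Proof. by move=> *; do 3 apply: is_derive_pair => //. Qed.

Lemma dL_dA i :
  coef1 (pderiv (fun A => L A F w r s) A) i = - (q * r * coef1 w i).
Proof.
rewrite coef1_pderiv derive_lineE.
have D : is_derive (0 : R) (1 : R) (fun _ : R => (rho, sig, u, F)) 0.
  exact: is_derive_cst.
rewrite (@derivative_energy _ _ (rho, sig, u, F) _ (- (q * r * contr w A))
  (- (q * r * coef1 w i)) 0 _ dh D)//.
  by rewrite linear0 oppr0 mul0r add0r.
apply: filterE => t; rewrite HL// contrDr contrZr contr_wedge_basis; ring.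
Qed.

Lemma dL_dF i j : coef2 (pderiv (fun F => L A F w r s) F) i j =
  - Dh (0, 0, 0, wedge_basis R [tuple i; j]) * V.
Proof.
rewrite coef2_pderiv derive_lineE; set v := wedge_basis _ _.
have D : is_derive (0 : R) (1 : R) (fun t : R => (rho, sig, u, F + t *: v))
    (0, 0, 0, v).
  by apply: is_derive4; try exact: is_derive_cst; exact: is_derive_affine1.
rewrite (@derivative_energy _ _ (rho, sig, u, F) _ (- (q * r * contr w A)) 0 0
  _ dh D) ?scale0r ?addr0//.
apply: filterE => t; rewrite HL//; first by rewrite mulr0 !addr0.
by apply: alternating_line => //; exact: alternating_wedge_basis.
Qed.

Lemma proper_densityD (y t : R) : proper_density c g w (y + t *: 1) =
  proper_density c g w y + t *: (N / (c * V)).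
Proof.
by rewrite /proper_density [t *: 1]mulr1 -[_ *: _]/(_ * _) mulrDr mulrDl; ring.
Qed.

Lemma dL_dr : derive1 (fun r => L A F w r s) r =
  - Dh (N / (c * V), 0, 0, 0) * V - q * contr w A.
Proof.
rewrite derive1E derive_lineE.
have D : is_derive (0 : R) (1 : R)
    (fun t : R => (rho + t *: (N / (c * V)), sig, u, F)) (N / (c * V), 0, 0, 0).
  by apply: is_derive4; try exact: is_derive_cst; exact: is_derive_affine1.
rewrite (@derivative_energy _ _ (rho, sig, u, F) _ (- (q * r * contr w A))
  (- (q * contr w A)) 0 _ dh D) ?scale0r ?addr0//.
apply: filterE => t; rewrite HL// proper_densityD [t *: 1]mulr1; ring.
Qed.

Lemma dL_ds : derive1 (fun s => L A F w r s) s = - Dh (0, N / (c * V), 0, 0) * V.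
Proof.
rewrite derive1E derive_lineE.
have D : is_derive (0 : R) (1 : R)
    (fun t : R => (rho, sig + t *: (N / (c * V)), u, F)) (0, N / (c * V), 0, 0).
  by apply: is_derive4; try exact: is_derive_cst; exact: is_derive_affine1.
rewrite (@derivative_energy _ _ (rho, sig, u, F) _ (- (q * r * contr w A)) 0 0
  _ dh D) ?scale0r ?addr0//.
by apply: filterE => t; rewrite HL// proper_densityD mulr0 !addr0.
Qed.

Lemma is_derive_Zl (W : normedModType R) (f : R -> R) (a : W) (t df : R) :
  is_derive t (1 : R) f df -> is_derive t (1 : R) (fun y => f y *: a) (df *: a).
Proof.
move=> fd; have dl : differentiable (fun y : R => y *: a) (f t) by [].
by have := is_derive_curve dl fd; rewrite diff_val.
Qed.

Lemma is_derive_at0 (f : R -> R) (a b e : R) :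
  f = (fun t => a + t * b + t * t * e) -> is_derive (0 : R) (1 : R) f b.
Proof.
move=> ->.
have D1 : is_derive (0 : R) (1 : R) (fun t : R => a + t * b) b.
  exact: is_derive_affine1.
have D2 : is_derive (0 : R) (1 : R) (fun t : R => t * t * e) 0.
  have := is_derive_Zl e (is_deriveM (is_derive_id (0 : R) (1 : R))
    (is_derive_id (0 : R) (1 : R))).
  by rewrite !scale0r addr0 scale0r.
have := is_deriveD D1 D2; by rewrite addr0.
Qed.

Local Notation wv := (fun v => contr v (flat g w)).

Lemma sqnorm_w : 0 < - sqnorm g w. Proof. by rewrite oppr_gt0. Qed.

Lemma N_gt0 : 0 < N. Proof. by rewrite sqrtr_gt0 sqnorm_w. Qed.

Lemma is_derive_norm (v : T1) : is_derive (0 : R) (1 : R)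
  (fun t : R => Num.sqrt (- sqnorm g (w + t *: v))) (- (wv v / N)).
Proof.
have [gs _] := gL.
have S : is_derive (0 : R) (1 : R) (fun t : R => - sqnorm g (w + t *: v))
    (- (2 * wv v)).
  apply: (is_derive_at0 (a := - sqnorm g w) (e := - sqnorm g v)).
  by apply/funext => t; rewrite sqnorm_line//; ring.
have S0 : 0 < - sqnorm g (w + 0 *: v) by rewrite scale0r addr0 sqnorm_w.
have := @is_derive1_comp _ Num.sqrt (fun t : R => - sqnorm g (w + t *: v)) 0 _ _
  (is_derive1_sqrt S0) S.
move=> D; apply: (is_derive_eq D); rewrite scale0r addr0.
by field; rewrite gt_eqF ?N_gt0.
Qed.

Lemma near_timelike (v : T1) : \forall t \near (0 : R), timelike g (w + t *: v).
Proof.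
have D := is_derive_norm v.
have cN : {for (0 : R), continuous (fun t : R => Num.sqrt (- sqnorm g (w + t *: v)))}.
  by apply/differentiable_continuous/derivable1_diffP.
have : \forall t \near (0 : R), 0 < Num.sqrt (- sqnorm g (w + t *: v)).
  by apply: (cvgr_gt _ cN); rewrite scale0r addr0 N_gt0.
by apply: filterS => t; rewrite sqrtr_gt0 oppr_gt0.
Qed.

(** The first term comes from the normalization and is a multiple of [u]; the second is the
    variation of [w] itself. *)
Lemma is_derive_velocity (v : T1) : is_derive (0 : R) (1 : R)
  (fun t : R => proper_velocity c g (w + t *: v))
  ((wv v / N ^+ 2) *: u + (c / N) *: v).
Proof.
pose m t := (Num.sqrt (- sqnorm g (w + t *: v)))^-1.
have m0 : m 0 = N^-1 by rewrite /m scale0r addr0.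
have Dm : is_derive (0 : R) (1 : R) m (wv v / N ^+ 3).
  have := @is_deriveV _ (fun t : R => Num.sqrt (- sqnorm g (w + t *: v))) 0 _ 1 _
    (is_derive_norm v).
  rewrite scale0r addr0 => /(_ (lt0r_neq0 N_gt0)).
  move=> D; apply: (is_derive_eq D); rewrite -[_ *: _]/(_ * _).
  by field; rewrite gt_eqF ?N_gt0.
have Dcm : is_derive (0 : R) (1 : R) (fun t => c * m t) (c * (wv v / N ^+ 3)).
  exact: (is_deriveZ c Dm).
have Dtm : is_derive (0 : R) (1 : R) (fun t => t * (c * m t)) (c / N).
  have := is_deriveM (is_derive_id (0 : R) (1 : R)) Dcm.
  by move=> D; apply: (is_derive_eq D); rewrite scale0r add0r m0 [_ *: _]mulr1.
have := is_deriveD (is_derive_Zl w Dcm) (is_derive_Zl v Dtm).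
have -> : (fun t => proper_velocity c g (w + t *: v)) =
    (fun t => (c * m t) *: w) + (fun t => (t * (c * m t)) *: v).
  apply/funext => t; rewrite fctE /proper_velocity -/(m t) scalerDr scalerA.
  by rewrite (mulrC _ t).
move=> D; apply: (is_derive_eq D); rewrite /proper_velocity scalerA.
by congr (_ *: _ + _); field; rewrite gt_eqF ?N_gt0.

Qed.

(** A variation of [w] moves the proper densities and the velocity together. If [y] is the relative
    change of 1/N, the densities change by [-y] times themselves, and [u] changes by [y] times
    itself in addition to the explicit variation; this gives the bracket of three derivatives. *)
Lemma dL_dw i : coef1 (pderiv (fun w => L A F w r s) w) i =
  - (Dh (0, 0, wedge_basis R [tuple i], 0) * (c / N) +
     coef1 (flat g w) i / N ^+ 2 *
       (Dh (0, 0, u, 0) - Dh (rho, 0, 0, 0) - Dh (0, sig, 0, 0))) * V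
  - q * r * coef1 A i.
Proof.
rewrite coef1_pderiv derive_lineE; set v := wedge_basis _ _.
have wvE : wv v = coef1 (flat g w) i by rewrite contr1C contr_wedge_basis.
pose y := wv v / N ^+ 2.
have Dd x : is_derive (0 : R) (1 : R)
    (fun t : R => proper_density c g (w + t *: v) x)
    (- y * proper_density c g w x).
  have := is_derive_Zl (x / (c * V)) (is_derive_norm v).
  have -> : (fun t : R => Num.sqrt (- sqnorm g (w + t *: v)) *: (x / (c * V))) =
      (fun t : R => proper_density c g (w + t *: v) x).
    by apply/funext => t; rewrite /proper_density -mulrA.
  move=> D; apply: (is_derive_eq D); rewrite /proper_density /y.
  rewrite -[_ *: _]/(_ * _).
  by have V0 := vol_gt0 gL; field; rewrite !gt_eqF ?N_gt0.
have D : is_derive (0 : R) (1 : R)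
    (fun t : R => (proper_density c g (w + t *: v) r,
      proper_density c g (w + t *: v) s, proper_velocity c g (w + t *: v), F))
    (- y * rho, - y * sig, y *: u + (c / N) *: v, 0).
  by apply: is_derive4; exact: is_derive_velocity.
rewrite (@derivative_energy _ _ (rho, sig, u, F) _ (- (q * r * contr w A))
  (- (q * r * coef1 A i)) 0 _ dh D) ?scale0r ?addr0//; last first.
  apply: filterS (near_timelike v) => t wvt; rewrite HL//.
  rewrite [contr (w + _) A]contr1C contrDr contrZr [contr A w]contr1C.
  by rewrite contr_wedge_basis; ring.
have -> : (- y * rho, - y * sig, y *: u + (c / N) *: v, 0) =
    - y *: (rho, 0, 0, 0) + - y *: (0, sig, 0, 0) + y *: (0, 0, u, 0)
    + (c / N) *: (0, 0, v, 0) :> R * R * T1 * T2.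
  congr (_, _, _, _) => /=; rewrite ?scaler0 ?addr0 ?add0r//.
have DD x z : Dh (x + z) = Dh x + Dh z by rewrite linearD.
have DZ b x : Dh (b *: x) = b * Dh x by rewrite linearZ.
rewrite !DD !DZ /y wvE; ring.
Qed.

Lemma den_drho : derive1 (fun y => h (y, sig, u, F)) rho = Dh (1, 0, 0, 0).
Proof.
rewrite derive1E (derive_embed h (emb := fun y => (y, sig, u, F)) (w := (1, 0, 0, 0))).
  by rewrite deriveE.
by move=> t; congr (_, _, _, _); rewrite /= ?scaler0 ?add0r.
Qed.

Lemma den_dsig : derive1 (fun y => h (rho, y, u, F)) sig = Dh (0, 1, 0, 0).
Proof.
rewrite derive1E (derive_embed h (emb := fun y => (rho, y, u, F)) (w := (0, 1, 0, 0))).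
  by rewrite deriveE.
by move=> t; congr (_, _, _, _); rewrite /= ?scaler0 ?add0r.
Qed.

Lemma den_dvel i : coef1 (pderiv (fun y => h (rho, sig, y, F)) u) i =
  Dh (0, 0, wedge_basis R [tuple i], 0).
Proof.
rewrite coef1_pderiv (derive_embed h (emb := fun y => (rho, sig, y, F))
  (w := (0, 0, wedge_basis R [tuple i], 0))); first by rewrite deriveE.
by move=> t; congr (_, _, _, _); rewrite /= ?scaler0 ?add0r.
Qed.

Lemma den_dfar i j : coef2 (pderiv (fun y => h (rho, sig, u, y)) F) i j =
  Dh (0, 0, 0, wedge_basis R [tuple i; j]).
Proof.
rewrite coef2_pderiv (derive_embed h (emb := fun y => (rho, sig, u, y))
  (w := (0, 0, 0, wedge_basis R [tuple i; j]))); first by rewrite deriveE.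
by move=> t; congr (_, _, _, _); rewrite /= ?scaler0 ?add0r.
Qed.

Lemma contr_den_dvel : contr (pderiv (fun y => h (rho, sig, y, F)) u) u =
  Dh (0, 0, u, 0).
Proof.
rewrite (linear_tensor1 (phi := fun U => Dh (0, 0, U, 0))) => [|a x y].
  by rewrite contr1E; apply: eq_bigr => i _; rewrite den_dvel mulrC.
rewrite -[a * _]/(a *: _) -linearZ -linearD; congr ('d h _ _).
by congr (_, _, _, _); rewrite /= ?scaler0 ?add0r.
Qed.

(** The charge terms cancel: the multiple of the identity between the Lagrangian and its derivative
    in [r], the product of [w] and [A] between the derivatives in [w] and in [A]. In the remaining
    terms the bracket in [dL_dw], multiplied by [w], supplies the part of the projector along
    [u]. *)
Lemma lagrangian_tensor_en :
  (L A F w r s - r * derive1 (fun r => L A F w r s) r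
    - s * derive1 (fun s => L A F w r s) s) *: 1%:M
  + trtens w (pderiv (fun w => L A F w r s) w)
  - trtens (pderiv (fun A => L A F w r s) A) A
  - trtens (pderiv (fun F => L A F w r s) F) F =
  V *: ((h (rho, sig, u, F) - contr (pderiv (fun y => h (rho, sig, y, F)) u) u)
        *: (c ^- 2 *: uu g u)
     - trtens u (pderiv (fun y => h (rho, sig, y, F)) u) + trtens (pderiv (fun y => h (rho, sig, u, y)) F) F
     + (rho * derive1 (fun y => h (y, sig, u, F)) rho
        + sig * derive1 (fun y => h (rho, y, u, F)) sig
        - h (rho, sig, u, F)) *: proj_orth c g u).
Proof.
rewrite contr_den_dvel den_drho den_dsig dL_dr dL_ds HL//.
have Z1 y : Dh (y, 0, 0, 0) = y * Dh (1, 0, 0, 0).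
  rewrite -[RHS]/(y *: _) -linearZ; congr ('d h _ _).
  by congr (_, _, _, _); rewrite /= ?scaler0 // [RHS]mulr1.
have Z2 y : Dh (0, y, 0, 0) = y * Dh (0, 1, 0, 0).
  rewrite -[RHS]/(y *: _) -linearZ; congr ('d h _ _).
  by congr (_, _, _, _); rewrite /= ?scaler0 // [RHS]mulr1.
apply/matrixP => i j; rewrite /uu /proj_orth /uu.
rewrite !(mxD, mxN, mxZ) !trtens1E dL_dw dL_dA den_dvel.
rewrite !trtens2E; under eq_bigr do rewrite dL_dF.
under [in RHS]eq_bigr do rewrite den_dfar.
have -> : \sum_l - Dh (0, 0, 0, wedge_basis R [tuple i; l]) * V * coef2 F j l =
    - V * \sum_l Dh (0, 0, 0, wedge_basis R [tuple i; l]) * coef2 F j l.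
  by rewrite big_distrr /=; apply: eq_bigr => l _; ring.
set S := \sum_l _; rewrite [1%:M i j]mxE; set d := (i == j)%:R.
have uE a : coef1 u a = c / N * coef1 w a by rewrite coef1Z.
have ubE a : coef1 (flat g u) a = c / N * coef1 (flat g w) a.
  rewrite !coef1_act big_distrr /=; apply: eq_bigr => b _; rewrite uE; ring.
rewrite uE ubE (Z1 (N / (c * V))) (Z2 (N / (c * V))) (Z1 rho) (Z2 sig).
have rE : r * (N / (c * V)) = rho by rewrite /proper_density; ring.
have sE : s * (N / (c * V)) = sig by rewrite /proper_density; ring.
have N0 : N != 0 by rewrite gt_eqF ?N_gt0.
have V0 : V != 0 by rewrite gt_eqF ?vol_gt0.
have c00 : c != 0 by rewrite gt_eqF.
(* With the values of the differential replaced by real variables, the identity is a field equation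
   once [y] and [z] are eliminated. *)
have alg (hS hr hs hu hi y z : R) : r * (N / (c * V)) = y ->
    s * (N / (c * V)) = z ->
  (- hS * V - q * r * contr w A - r * (- (N / (c * V) * hr) * V - q * contr w A)
    - s * (- (N / (c * V) * hs) * V)) * d +
  coef1 w i * (- (hi * (c / N) + coef1 (flat g w) j / N ^+ 2 *
    (hu - y * hr - z * hs)) * V - q * r * coef1 A j)
  - - (q * r * coef1 w i) * coef1 A j - - V * S =
  V * ((hS - hu) * (c ^- 2 * (c / N * coef1 w i * (c / N * coef1 (flat g w) j)))
   - c / N * coef1 w i * hi + S +
   (y * hr + z * hs - hS) *
    (d + c ^- 2 * (c / N * coef1 w i * (c / N * coef1 (flat g w) j)))).
  by move=> <- <-; field; rewrite N0 V0 c00.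
exact: alg.
Qed.

End EnergyLagrangian.

(** * Alternating tensors and derivatives along them *)

Section Alternating.
Context {R : realType} {n : nat}.

Lemma actD k G (s t : tensor R n k) : act G (s + t) = act G s + act G t.
Proof.
apply: tensorP => I; rewrite coefD !coef_mktensor -big_split /=.
by apply: eq_bigr => J _; rewrite coefD mulrDr.
Qed.

Lemma actZ k G a (t : tensor R n k) : act G (a *: t) = a *: act G t.
Proof.
apply: tensorP => I; rewrite coefZ !coef_mktensor big_distrr /=.
by apply: eq_bigr => J _; rewrite coefZ mulrCA.
Qed.

Lemma alternatingD k (s t : tensor R n k) :
  alternating s -> alternating t -> alternating (s + t).
Proof. by move=> as_ at_ p I; rewrite !coefD as_ at_ mulrDr. Qed.

Lemma alternatingZ k a (t : tensor R n k) : alternating t -> alternating (a *: t).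
Proof. by move=> at_ p I; rewrite !coefZ at_ mulrCA. Qed.

Lemma alternating0 k : alternating (0 : tensor R n k).
Proof. by move=> p I; rewrite !coef0 mulr0. Qed.

Lemma alternating_sum k (J : Type) (r : seq J) (f : J -> tensor R n k) :
  (forall j, alternating (f j)) -> alternating (\sum_(j <- r) f j).
Proof.
move=> af; elim: r => [|j r IH]; first by rewrite big_nil; exact: alternating0.
by rewrite big_cons; apply: alternatingD.
Qed.

Lemma perm2P (s : 'S_2) : s = 1%g \/ s = tperm ord0 ord_max.
Proof.
have two (a : 'I_2) : a = ord0 \/ a = ord_max.
  by case: a => -[|[|//]] h; [left|right]; exact/val_inj.
case: (two (s ord0)) => s0; [left|right]; apply/permP => a.
  have [->|a1] := two a; first by rewrite s0 perm1.
  rewrite perm1 a1; case: (two (s ord_max)) => // s1.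
  by have := @perm_inj _ s ord_max ord0; rewrite s0 s1 => /(_ erefl).
have [->|->] := two a; first by rewrite s0 tpermL.
rewrite tpermR; case: (two (s ord_max)) => // s1.
by have := @perm_inj _ s ord_max ord0; rewrite s0 s1 => /(_ erefl).
Qed.

Lemma alternating_tswap k (t : tensor R n k) :
  (forall J a b, a != b -> coef t (tswap J a b) = - coef t J) -> alternating t.
Proof.
move=> tt s; have [ts -> dts] := prod_tpermP s; elim: ts dts => [|[a b] ts IH] /=.
  move=> _ I; rewrite big_nil odd_perm1 mul1r; congr coef.
  by apply: eq_from_tnth => c; rewrite tnth_mktuple perm1.
case/andP => ab dts I; rewrite big_cons odd_permM odd_tperm /= in ab *.
rewrite ab signr_addb expr1 mulN1r mulNr -(IH dts) -(tt _ _ _ ab); congr coef.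
by apply: eq_from_tnth => c; rewrite !tnth_mktuple permM.
Qed.

Lemma alternating2P (F : tensor R n 2) :
  (forall i j, coef2 F j i = - coef2 F i j) -> alternating F.
Proof.
move=> F2 s I; case: (perm2P s) => ->.
  rewrite odd_perm1 mul1r; congr coef; apply: eq_from_tnth => a.
  by rewrite tnth_mktuple perm1.
rewrite odd_tperm /= expr1 mulN1r [in RHS](tuple2P I).
rewrite -/(coef2 F _ _) -F2; congr coef.
by rewrite [LHS]tuple2P !tnth_mktuple tpermL tpermR.
Qed.

(** Expanding the determinants in the basis forms gives one summand per permutation, all equal to
    [coef t J] by antisymmetry, and there are k! of them. *)
Lemma alternating_expansion k (t : tensor R n k) : alternating t ->
  t = (k`!%:R)^-1 *: \sum_(I : k.-tuple 'I_n.+1) coef t I *: wedge_basis R I.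
Proof.
move=> at_; apply: tensorP => J; rewrite coefZ coef_sum.
have -> : \sum_I coef (coef t I *: wedge_basis R I) J =
    \sum_(s : 'S_k) coef t J.
  under eq_bigr do rewrite coefZ coef_mktensor big_distrr /=.
  rewrite exchange_big /=; apply: eq_bigr => s _.
  have := at_ s J => /(congr1 (fun y => (-1) ^+ s * y)).
  rewrite mulrA -expr2 sqrr_sign mul1r => <-.
  set Js := [tuple _ | _ < _].
  rewrite (bigD1 Js) //= [X in _ + X]big1 ?addr0 => [|I IJ].
    rewrite big1 ?mulr1 1?mulrC// => a _.
    by rewrite mxE tnth_mktuple eqxx.
  rewrite (eq_bigr (fun a => (tnth I a == tnth Js a)%:R)).
    by rewrite prod_delta (negbTE IJ) !mulr0.
  by move=> a _; rewrite mxE tnth_mktuple.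
rewrite sumr_const card_Sn -[coef t J *+ _]mulr_natl mulrA mulVf ?mul1r//.
Qed.

(** The factor 1/k! of [contr] is that of [alternating_expansion]. Alternation of [v] is essential,
    since [pderiv] probes only the span of the basis forms. *)
Lemma contr_pderiv k (f : tensor R n k -> R) t v : differentiable f t ->
  alternating v -> contr (pderiv f t) v = 'd f t v.
Proof.
move=> df av; rewrite {2}(alternating_expansion av) linearZ linear_sum.
rewrite /contr; congr (_ * _); apply: eq_bigr => I _.
by rewrite linearZ coef_mktensor deriveE// mulrC.
Qed.

Lemma alternating_pderiv k (f : tensor R n k -> R) t : differentiable f t ->
  alternating (pderiv f t).
Proof.
move=> df s I; rewrite !coef_mktensor !deriveE// -[RHS]/(_ *: _) -linearZ.
congr ('d f _ _); apply: tensorP => J; rewrite coefZ !coef_mktensor.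
rewrite -det_perm -det_mulmx -row_permE; congr (\det _).
by apply/matrixP => a b; rewrite !mxE tnth_mktuple.
Qed.

End Alternating.

(** * Tangency of derivatives that are invariant under the reflection *)

Section Tangent.
Context {R : realType} {n : nat} (c : R).
Variables (g : 'M[R]_n.+1) (u : tensor R n 1).
Hypothesis gsym : g^T = g.
Hypothesis c0 : c != 0.
Hypothesis unorm : sqnorm g u = - c ^+ 2.

(** Contracting the derivative with the covector of [u] evaluates the differential on forms
    divisible by that covector. The reflection changes their sign while the differential is
    invariant, so the value equals its opposite. *)
Lemma pderiv_tangent k (f : tensor R n k -> R) x t j : differentiable f x ->
  (forall v, alternating v -> 'd f x (act (reflection c g u) v) = 'd f x v) ->
  \sum_i coef1 (flat g u) i * trtens (pderiv f x) t i j = 0.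
Proof.
case: k f x t => [|k] f x t df fG.
  by rewrite big1// => i _; rewrite mxE mulr0.
transitivity ((k`!%:R)^-1 * \sum_(J : k.-tuple 'I_n.+1)
    'd f x (wedge_covector (flat g u) J) * coef t [tuple of j :: J]).
  under eq_bigr do rewrite mxE mulrCA big_distrr /=.
  rewrite -big_distrr /=; congr (_ * _).
  rewrite exchange_big /=; apply: eq_bigr => J _.
  rewrite linear_sum big_distrl /=; apply: eq_bigr => i _.
  by rewrite linearZ /= coef_mktensor deriveE// mulrA.
rewrite big1 ?mulr0// => J _.
have aw : alternating (wedge_covector (flat g u) J).
  by apply: alternating_sum => i; apply/alternatingZ/alternating_wedge_basis.
have := fG _ aw; rewrite reflection_wedge_covector// linearN.
by move=> /eqP; rewrite eq_sym -addr_eq0 -mulr2n mulrn_eq0 => /eqP ->; rewrite mul0r.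
Qed.

End Tangent.

(** * Linearity of the electric and magnetic forms *)

Section FieldsLinear.
Context {R : realType} {n : nat}.
Implicit Types (g : 'M[R]_n.+1).

Lemma iprod_linearl k a (X Y : tensor R n 1) (t : tensor R n k.+1) :
  iprod (a *: X + Y) t = a *: iprod X t + iprod Y t.
Proof.
apply: tensorP => J; rewrite coefD coefZ !coef_iprod big_distrr -big_split /=.
by apply: eq_bigr => i _; rewrite coef1D coef1Z mulrDl mulrA.
Qed.

Lemma iprod_linearr k a (X : tensor R n 1) (s t : tensor R n k.+1) :
  iprod X (a *: s + t) = a *: iprod X s + iprod X t.
Proof.
apply: tensorP => J; rewrite coefD coefZ !coef_iprod big_distrr -big_split /=.
by apply: eq_bigr => i _; rewrite coefD coefZ mulrDr mulrCA.
Qed.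

Lemma hodge_linear k m g a (s t : tensor R n k) :
  hodge m g (a *: s + t) = a *: hodge m g s + hodge m g t.
Proof.
apply: tensorP => J; rewrite coefD coefZ !coef_mktensor mulrCA -mulrDr.
congr (_ * _); rewrite big_distrr -big_split /=; apply: eq_bigr => I _.
by rewrite /sharp actD actZ coefD coefZ; ring.
Qed.

Lemma electric_linearl c a (v u : tensor R n 1) F :
  electric c (a *: v + u) F = a *: electric c v F + electric c u F.
Proof. by rewrite /electric iprod_linearl scalerDr !scalerA mulrC. Qed.

Lemma electric_linearr c a (u : tensor R n 1) F F' :
  electric c u (a *: F + F') = a *: electric c u F + electric c u F'.
Proof. by rewrite /electric iprod_linearr scalerDr !scalerA mulrC. Qed.

End FieldsLinear.

(** * The tensor of an energy density in (E, B) *)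

Section EpsTensor.
Context {R : realType} {k : nat} (c : R).
Let n := k.+2.
Implicit Types (i j : 'I_n.+1).
Local Notation T1 := (tensor R n 1).
Local Notation T2 := (tensor R n 2).
Hypothesis c0 : 0 < c.
Variable g : 'M[R]_n.+1.
Hypothesis gL : lorentzian g.
Variables (rho sig : R) (u : T1) (F : T2).
Hypothesis altF : alternating F.
Hypothesis unorm : sqnorm g u = - c ^+ 2.
Variable eps : R * R * T1 * tensor R n k * 'M[R]_n.+1 -> R.
Local Notation E := (electric c u F).
Local Notation B := (mag c g u F).
Hypothesis deps : differentiable eps (rho, sig, E, B, g).
Local Notation e_E := (pderiv (fun y => eps (rho, sig, y, B, g)) E).
Local Notation e_B := (pderiv (fun y => eps (rho, sig, E, y, g)) B).
Local Notation D := ('d eps (rho, sig, E, B, g)).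
Local Notation G := (reflection c g u).
Hypothesis cov : forall B', alternating B' ->
  eps (rho, sig, act G E, act G B', G *m g *m G^T) = eps (rho, sig, E, B', g).

Lemma alternating_lc_tensor (a b d : 'I_n.+1) :
  alternating (lc_tensor a b d : tensor R n k).
Proof.
by apply: alternating_tswap => J d' e de; rewrite !coef_mktensor lc_tswap.
Qed.

Lemma alternating_mag v F' : alternating (mag c g v F' : tensor R n k).
Proof.
rewrite magE; do 3 (apply: alternating_sum => ?).
by apply: alternatingZ; exact: alternating_lc_tensor.
Qed.

Lemma derive_B v : 'D_v (fun y => eps (rho, sig, E, y, g)) B = D (0, 0, 0, v, 0).
Proof.
rewrite (derive_embed eps (emb := fun y => (rho, sig, E, y, g))
  (w := (0, 0, 0, v, 0))); first by rewrite deriveE.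
by move=> t; congr (_, _, _, _, _); rewrite /= ?scaler0 ?add0r.
Qed.

Lemma derive_E v : 'D_v (fun y => eps (rho, sig, y, B, g)) E = D (0, 0, v, 0, 0).
Proof.
rewrite (derive_embed eps (emb := fun y => (rho, sig, y, B, g))
  (w := (0, 0, v, 0, 0))); first by rewrite deriveE.
by move=> t; congr (_, _, _, _, _); rewrite /= ?scaler0 ?add0r.
Qed.

Lemma differentiable_B : differentiable (fun y => eps (rho, sig, E, y, g)) B.
Proof.
apply: (@differentiable_comp _ _ _ _ (fun y => (rho, sig, E, y, g)) eps) => //.
by apply: differentiable_pair => //; apply: differentiable_pair.
Qed.

Lemma contr_e_B v : alternating v -> contr e_B v = D (0, 0, 0, v, 0).
Proof.
move=> av; rewrite contr_pderiv//; last exact: differentiable_B.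
by rewrite -derive_B deriveE//; exact: differentiable_B.
Qed.

Lemma contr_e_E v : contr e_E v = D (0, 0, v, 0, 0).
Proof.
rewrite (linear_tensor1 (phi := fun U => D (0, 0, U, 0, 0))) => [|a x y].
  rewrite contr1E; apply: eq_bigr => i _.
  by rewrite coef1_pderiv derive_E mulrC.
rewrite -[a * _]/(a *: _) -linearZ -linearD; congr ('d eps _ _).
by congr (_, _, _, _, _); rewrite /= ?scaler0 ?add0r.
Qed.

Lemma c_neq0 : c != 0. Proof. by rewrite gt_eqF. Qed.

Lemma u_E : \sum_j coef1 u j * coef1 E j = 0.
Proof.
under eq_bigr do rewrite coef_electric mulrCA big_distrr /=.
rewrite -big_distrr /=; set S := \sum_i _.
have : S = - S.
  rewrite {1}/S exchange_big /= -sumrN; apply: eq_bigr => i _.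
  rewrite -sumrN; apply: eq_bigr => j _.
  by rewrite (alternating2 i j altF); ring.
by move=> /eqP; rewrite -addr_eq0 -mulr2n mulrn_eq0 => /eqP ->; rewrite mulr0.
Qed.

Lemma act_reflection_E : act G E = E.
Proof.
apply: act_reflection => // I a; rewrite -[RHS]u_E; apply: eq_bigr => j _.
congr (_ * coef _ _); apply: eq_from_tnth => b.
by rewrite tnth_mktuple (ord1 a) (ord1 b) eqxx (tnth_nth ord0).
Qed.

Lemma act_reflection_B : act G B = B.
Proof.
apply: act_reflection => // I d.
rewrite magE; under eq_bigr do rewrite coef_sum big_distrr /=.
rewrite exchange_big big1//= => a _.
under eq_bigr do rewrite coef_sum big_distrr /=.
rewrite exchange_big big1//= => b _.
under eq_bigr do rewrite coef_sum big_distrr /=.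
set S := \sum_i _.
have : S = - S.
  rewrite {1}/S exchange_big -sumrN; apply: eq_bigr => j _.
  rewrite -sumrN; apply: eq_bigr => e _.
  by rewrite !coefZ !coef_lc_tensor lc_tsubst_swap; ring.
by move=> /eqP; rewrite -addr_eq0 -mulr2n mulrn_eq0 => /eqP.
Qed.

(** The reflection fixes [E], [B] and [g], so covariance identifies the values of [eps] at
    [h *: v + B] and at [h *: act G v + B]; the difference quotients are therefore equal. *)
Lemma derive_B_reflection v : alternating v ->
  D (0, 0, 0, act G v, 0) = D (0, 0, 0, v, 0).
Proof.
have [gs _] := gL; move=> av; rewrite -!derive_B /derive /=.
have -> : (fun h : R => h^-1 *: (eps (rho, sig, E, h *: v + B, g) -
      eps (rho, sig, E, B, g))) =
    (fun h : R => h^-1 *: (eps (rho, sig, E, h *: act G v + B, g) -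
      eps (rho, sig, E, B, g))).
  apply/funext => h; rewrite -cov; last first.
    by apply: alternatingD; [exact: alternatingZ|exact: alternating_mag].
  rewrite act_reflection_E reflection_metric ?c_neq0//.
  by rewrite actD actZ act_reflection_B.
by [].
Qed.

Lemma e_B_tangent (t : tensor R n k) j :
  \sum_i coef1 (flat g u) i * trtens e_B t i j = 0.
Proof.
have [gs _] := gL.
have := @pderiv_tangent _ _ c g u c_neq0 unorm _ _ _ t j differentiable_B.
apply=> v av.
by rewrite -!deriveE; [rewrite !derive_B derive_B_reflection|
  exact: differentiable_B..].
Qed.

Lemma mag_linearl a v w F' : mag c g (a *: v + w) F' =
  a *: mag c g v F' + mag c g w F' :> tensor R n k.
Proof. by rewrite /mag iprod_linearl scalerDr !scalerA mulrC. Qed.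

Lemma mag_linearr a v F1 F2 : mag c g v (a *: F1 + F2) =
  a *: mag c g v F1 + mag c g v F2 :> tensor R n k.
Proof. by rewrite /mag hodge_linear iprod_linearr scalerDr !scalerA mulrC. Qed.

Definition eps_en (z : R * R * T1 * T2) : R :=
  eps (z.1.1.1, z.1.1.2, electric c z.1.2 z.2, mag c g z.1.2 z.2, g).

Lemma D_split v w : alternating w ->
  D (0, 0, v, w, 0) = contr e_E v + contr e_B w.
Proof.
move=> aw; rewrite contr_e_E contr_e_B// -linearD; congr ('d eps _ _).
by congr (_, _, _, _, _); rewrite /= ?addr0 ?add0r.
Qed.

Lemma eps_en_du :
  pderiv (fun y => eps_en (rho, sig, y, F)) u = den_du c e_B e_E g F.
Proof.
apply: tensor1P => i; rewrite coef1_pderiv coef1_mktensor1.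
set v := wedge_basis _ _.
rewrite (derive_embed eps
  (emb := fun y => (rho, sig, electric c y F, mag c g y F, g))
  (w := (0, 0, electric c v F, mag c g v F, 0))); last first.
  move=> t; rewrite electric_linearl mag_linearl.
  by congr (_, _, _, _, _); rewrite /= ?scaler0 ?add0r.
rewrite deriveE// D_split; last exact: alternating_mag.
congr (_ + _).
  rewrite contr1E big_distrr /=; apply: eq_bigr => j _.
  rewrite coef_electric.
  under eq_bigr do rewrite coef1_wedge_basis eq_sym.
  by rewrite sum_delta; ring.
rewrite contr_mag; under eq_bigr do rewrite coef1_wedge_basis eq_sym.
by rewrite sum_delta.
Qed.

Lemma eps_en_dF :
  pderiv (fun y => eps_en (rho, sig, u, y)) F = den_dF c e_B e_E g u.
Proof.
have [gs _] := gL.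
apply: tensor2P => i j; rewrite coef2_pderiv coef2D coef2_mktensor2.
set v := wedge_basis _ _.
rewrite (derive_embed eps
  (emb := fun y => (rho, sig, electric c u y, mag c g u y, g))
  (w := (0, 0, electric c u v, mag c g u v, 0))); last first.
  move=> t; rewrite electric_linearr mag_linearr.
  by congr (_, _, _, _, _); rewrite /= ?scaler0 ?add0r.
rewrite deriveE// D_split; last exact: alternating_mag.
congr (_ + _).
  rewrite contr1E.
  transitivity (\sum_l - c^-1 * ((l == j)%:R * (coef1 u i * coef1 e_E l) -
     (l == i)%:R * (coef1 u j * coef1 e_E l))); last first.
    by rewrite -big_distrr sumrB !sum_delta.
  apply: eq_bigr => l _; rewrite coef_electric.
  have -> : \sum_a coef1 u a * coef2 v a l = \sum_a ((a == i)%:R *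
      (coef1 u a * (l == j)%:R) - (a == j)%:R * (coef1 u a * (l == i)%:R)).
    apply: eq_bigr => a _; rewrite coef2_wedge_basis (eq_sym i) (eq_sym j).
    by rewrite (eq_sym i) (eq_sym j); ring.
  by rewrite sumrB !sum_delta; ring.
rewrite contr_mag_dF coef2_act.
(* The raised basis form is an antisymmetrized product of inverse metric entries. Against the
   antisymmetric [dmag_dF] its two halves agree and absorb the factor 1/2. *)
transitivity (2^-1 * (\sum_a \sum_b invmx g a i * invmx g b j * dmag_dF c e_B g u a b
   - \sum_a \sum_b invmx g a j * invmx g b i * dmag_dF c e_B g u a b)).
  congr (_ * _); rewrite -sumrB; apply: eq_bigr => a _.
  rewrite -sumrB; apply: eq_bigr => b _; rewrite -mulrBl; congr (_ * _).
  rewrite coef2_act.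
  transitivity (\sum_l invmx g a l * ((l == i)%:R * invmx g b j -
      (l == j)%:R * invmx g b i)).
    apply: eq_bigr => l _.
    transitivity (invmx g a l * \sum_m ((m == j)%:R * ((l == i)%:R * invmx g b m)
        - (m == i)%:R * ((l == j)%:R * invmx g b m))).
      rewrite big_distrr /=; apply: eq_bigr => m _.
      rewrite coef2_wedge_basis (eq_sym i l) (eq_sym j m) (eq_sym i m) (eq_sym j l).
      by ring.
    by rewrite sumrB !sum_delta.
  rewrite -[X in X - _](sum_delta (fun l => invmx g a l * invmx g b j)).
  rewrite -(sum_delta (fun l => invmx g a l * invmx g b i)) -sumrB.
  by apply: eq_bigr => l _; ring.
have -> : \sum_a \sum_b invmx g a j * invmx g b i * dmag_dF c e_B g u a b =
   - \sum_a \sum_b invmx g a i * invmx g b j * dmag_dF c e_B g u a b.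
  rewrite exchange_big -sumrN; apply: eq_bigr => a _; rewrite -sumrN.
  by apply: eq_bigr => b _; rewrite dmag_dF_swap; ring.
transitivity (\sum_a \sum_b invmx g a i * invmx g b j * dmag_dF c e_B g u a b).
  by field.
apply: eq_bigr => a _; apply: eq_bigr => b _; rewrite coef2_mktensor2.
have sy d e : invmx g d e = invmx g e d.
  by rewrite -{1}(trmx_invmx_sym gs) mxE.
by rewrite (sy a) (sy b).
Qed.

(** The derivatives in the densities are the same in both sets of variables and enter only as
    numbers, so they are left arbitrary. *)
Lemma tensor_en_eps (ePr ePs : R) :
  (eps (rho, sig, E, B, g) - contr (pderiv (fun y => eps_en (rho, sig, y, F)) u) u)
     *: (c ^- 2 *: uu g u)
     - trtens u (pderiv (fun y => eps_en (rho, sig, y, F)) u)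
     + trtens (pderiv (fun y => eps_en (rho, sig, u, y)) F) F
     + (rho * ePr + sig * ePs - eps (rho, sig, E, B, g)) *: proj_orth c g u =
  (eps (rho, sig, E, B, g) - contr e_E E) *: (c ^- 2 *: uu g u)
     + c^-1 *: (trtens u (poynting c e_B g u F) +
         trtens (sharp g (poynting c e_B g u F)) (flat g u))
     + trtens e_E E - trtens (sharp g B) (flat g e_B)
     + (ePr * rho + ePs * sig + contr e_B B - eps (rho, sig, E, B, g))
       *: proj_orth c g u.
Proof.
have [gs _] := gL.
have := energy_tensor_identity e_E (alternating_pderiv differentiable_B) altF gs
  (lorentzian_unit gL) c_neq0 unorm e_B_tangent.
rewrite -eps_en_du -eps_en_dF => I.
apply/matrixP => i j; move/matrixP/(_ i j): I.
rewrite !(mxD, mxN, mxZ) => Iij.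
lra.
Qed.

End EpsTensor.

(** * Charts *)

Section Partial.
Context {R : realType} {N : nat}.
Implicit Types (i j k : 'I_N).

Definition partial i (f : 'rV[R]_N -> R) (x : 'rV[R]_N) : R :=
  'D_(delta_mx ord0 i) f x.

Lemma near_partial i (f g : 'rV[R]_N -> R) x :
  (\near x, f x = g x) -> partial i f x = partial i g x.
Proof. exact: near_eq_derive. Qed.

Lemma partialM i (f g : 'rV[R]_N -> R) x :
  differentiable f x -> differentiable g x ->
  partial i (fun y => f y * g y) x = partial i f x * g x + f x * partial i g x.
Proof.
move=> df dg; rewrite /partial deriveM; try exact: diff_derivable.
by rewrite addrC mulrC [X in _ + X]mulrC addrC; congr (_ + _); rewrite mulrC.
Qed.

Lemma partialD i (f g : 'rV[R]_N -> R) x :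
  differentiable f x -> differentiable g x ->
  partial i (fun y => f y + g y) x = partial i f x + partial i g x.
Proof. by move=> df dg; rewrite /partial deriveD//; exact: diff_derivable. Qed.

Lemma partialB i (f g : 'rV[R]_N -> R) x :
  differentiable f x -> differentiable g x ->
  partial i (fun y => f y - g y) x = partial i f x - partial i g x.
Proof. by move=> df dg; rewrite /partial deriveB//; exact: diff_derivable. Qed.

Lemma differentiable_sumf (V : normedModType R) m (f : 'I_m -> V -> R) x :
  (forall l, differentiable (f l) x) -> differentiable (fun y => \sum_l f l y) x.
Proof.
move=> df; have -> : (fun y => \sum_l f l y) = \sum_l f l.
  by apply/funext => y; rewrite fct_sumE.
exact: differentiable_sum.
Qed.

Lemma partial_sum i m (f : 'I_m -> 'rV[R]_N -> R) x :
  (forall l, differentiable (f l) x) ->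
  partial i (fun y => \sum_l f l y) x = \sum_l partial i (f l) x.
Proof.
move=> df; have -> : (fun y => \sum_l f l y) = \sum_l f l.
  by apply/funext => y; rewrite fct_sumE.
by rewrite /partial derive_sum// => l; exact: diff_derivable.
Qed.

Lemma jacobianE m (f : 'rV[R]_N -> 'rV[R]_m) x i (j : 'I_m) : differentiable f x ->
  'J f x i j = partial i (fun y => f y ord0 j) x.
Proof. by move=> df; rewrite mxE /partial derive_entry// deriveE. Qed.

Lemma partial_comp i m (f : 'rV[R]_m -> R) (tau : 'rV[R]_N -> 'rV[R]_m) x :
  differentiable tau x -> differentiable f (tau x) ->
  partial i (fun y => f (tau y)) x =
  \sum_l 'J tau x i l * 'D_(delta_mx ord0 l) f (tau x).
Proof.
move=> dt df; rewrite [LHS](derive_comp_rV _ dt df); apply: eq_bigr => j _.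
by rewrite jacobianE.
Qed.

Lemma near_jacobian m (f g : 'rV[R]_N -> 'rV[R]_m) x :
  (\near x, f x = g x) -> differentiable f x -> 'J f x = 'J g x.
Proof.
move=> fg df; have dg := near_eq_differentiable fg df.
apply/matrixP => i j.
transitivity (partial i (fun y => f y ord0 j) x); first exact: jacobianE.
transitivity (partial i (fun y => g y ord0 j) x); last exact/esym/jacobianE.
apply: near_partial.
by move: fg; apply: filterS => y ->.
Qed.

Lemma jacobian_id (x : 'rV[R]_N) : 'J (id : 'rV[R]_N -> 'rV[R]_N) x = 1%:M.
Proof.
apply/matrixP => i j; rewrite mxE -deriveE// derive_id !mxE eqxx /=.
by rewrite eq_sym.
Qed.

End Partial.

Lemma jacobian_comp (R : realType) (a b d : nat) (f : 'rV[R]_a -> 'rV[R]_b)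
    (g : 'rV[R]_b -> 'rV[R]_d) x :
  differentiable f x -> differentiable g (f x) ->
  'J (g \o f) x = 'J f x *m 'J g (f x).
Proof.
move=> df dg; have dc : differentiable (g \o f) x by exact: differentiable_comp.
apply/matrixP => i j; rewrite jacobianE// [RHS]mxE.
have dgj : differentiable (fun z => g z ord0 j) (f x) by exact: differentiable_entry.
rewrite (partial_comp i df dgj); apply: eq_bigr => k _.
by rewrite (jacobianE _ _ dg).
Qed.

Section Charts.
Context {R : realType} {n : nat} (M : oriented_manifold R n.+1).
Implicit Types (p q m : M) (i j k : 'I_n.+1).

Definition transition p q : 'rV[R]_n.+1 -> 'rV[R]_n.+1 := mchart q \o mchartV p.

Lemma near_mchartV p m (P : set M) : mdom p m -> nbhs m P ->
  \forall y \near mchart p m, P (mchartV p y).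
Proof.
move=> pm; have := mchartV_cts pm; rewrite /prop_for /continuous_at mchartK//.
exact.
Qed.

Lemma near_mdom p q m : mdom p m -> mdom q m ->
  \forall y \near mchart p m, mdom q (mchartV p y).
Proof. by move=> pm qm; apply: near_mchartV => //; apply: open_nbhs_nbhs; split => //; exact: mdom_open. Qed.

Lemma near_mchart_mchartV p m : mdom p m ->
  \forall y \near mchart p m, mchart p (mchartV p y) = y.
Proof.
move=> pm; have : nbhs (mchart p m) (mchart p @` mdom p).
  by apply: open_nbhs_nbhs; split; [exact: mim_open|exists m].
by apply: filterS => y [m' pm' <-]; rewrite mchartK.
Qed.

Lemma transition_smooth p q m : mdom p m -> mdom q m ->
  smooth_at (transition p q) (mchart p m).
Proof. exact: mtrans_smooth. Qed.

Lemma transition_differentiable p q m : mdom p m -> mdom q m ->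
  differentiable (transition p q) (mchart p m).
Proof. by move=> pm qm; apply: C_at1_differentiable; exact: (transition_smooth pm qm 1). Qed.

Lemma transitionE p q m : mdom p m -> transition p q (mchart p m) = mchart q m.
Proof. by move=> pm; rewrite /transition /= mchartK. Qed.

Lemma jacobian_transition p q r m : mdom p m -> mdom q m -> mdom r m ->
  'J (transition p r) (mchart p m) =
  'J (transition p q) (mchart p m) *m 'J (transition q r) (mchart q m).
Proof.
move=> pm qm rm; rewrite -(transitionE q pm) -jacobian_comp; last 2 first.
- exact: transition_differentiable.
- by rewrite transitionE//; exact: transition_differentiable.
apply: near_jacobian; last exact: transition_differentiable.
apply: filterS (near_mdom pm qm) => y qy.
by rewrite /transition /= mchartK.
Qed.

Lemma jacobian_transition_id p m : mdom p m ->
  'J (transition p p) (mchart p m) = 1%:M.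
Proof.
move=> pm; rewrite -(jacobian_id (mchart p m)); apply/esym/near_jacobian => //.
by apply: filterS (near_mchart_mchartV pm) => y /esym.
Qed.

Lemma jacobian_transitionK p q m : mdom p m -> mdom q m ->
  'J (transition p q) (mchart p m) *m 'J (transition q p) (mchart q m) = 1%:M.
Proof. by move=> pm qm; rewrite -jacobian_transition// jacobian_transition_id. Qed.

Lemma jacobian_transition_unit p q m : mdom p m -> mdom q m ->
  'J (transition p q) (mchart p m) \in unitmx.
Proof. move=> pm qm; have [U _] := mulmx1_unit (jacobian_transitionK pm qm).
exact: U. Qed.

Lemma in_chartE (X : Type) (pull : 'M[R]_n.+1 -> X -> X) (s : M -> X) p m :
  mdom p m ->
  in_chart pull s p (mchart p m) = pull ('J (transition p m) (mchart p m)) (s m).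
Proof. by move=> pm; rewrite /in_chart mchartK. Qed.

Lemma in_chart_base (X : Type) (pull : 'M[R]_n.+1 -> X -> X) (s : M -> X) p :
  pull 1%:M (s p) = s p -> in_chart pull s p (mchart p p) = s p.
Proof.
by move=> p1; rewrite in_chartE ?jacobian_transition_id//; exact: mdom_self.
Qed.

Definition functorial (X : Type) (pull : 'M[R]_n.+1 -> X -> X) :=
  forall G H s, G \in unitmx -> H \in unitmx ->
    pull (G *m H) s = pull G (pull H s).

Lemma in_chart_transition (X : Type) (pull : 'M[R]_n.+1 -> X -> X) (s : M -> X)
    p q m : functorial pull -> mdom p m -> mdom q m ->
  in_chart pull s q (mchart q m) =
  pull ('J (transition q p) (mchart q m)) (in_chart pull s p (mchart p m)).
Proof.
move=> fp pm qm; rewrite !in_chartE// (jacobian_transition qm pm) ?fp//.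
- exact: jacobian_transition_unit.
- by apply: jacobian_transition_unit => //; exact: mdom_self.
- exact: mdom_self.
Qed.

(** Near [m] the expressions of a field in two charts differ by the Jacobian of the transition map.
    As this holds on a neighbourhood, it can be differentiated. *)
Lemma near_in_chart (X : Type) (pull : 'M[R]_n.+1 -> X -> X) (s : M -> X)
    p q m : functorial pull -> mdom p m -> mdom q m ->
  \forall y \near mchart q m, in_chart pull s q y =
    pull ('J (transition q p) y) (in_chart pull s p (transition q p y)).
Proof.
move=> fp pm qm.
have H := near_mdom qm pm.
move: (near_mdom qm qm) H (near_mchart_mchartV qm); apply: filterS3 => y qy py yE.
by rewrite -{1 2}yE (in_chart_transition s fp py qy).
Qed.

End Charts.

Lemma invmx_eq (R : comUnitRingType) m (A B : 'M[R]_m) : A *m B = 1%:M -> invmx A = B.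
Proof.
move=> AB; have [U _] := mulmx1_unit AB.
by rewrite -[LHS]mulmx1 -AB mulmxA mulVmx// mul1mx.
Qed.

Lemma invmxM (R : comUnitRingType) m (A B : 'M[R]_m) : A \in unitmx -> B \in unitmx ->
  invmx (A *m B) = invmx B *m invmx A.
Proof.
move=> uA uB; apply: invmx_eq.
by rewrite -mulmxA (mulmxA B) mulmxV// mul1mx mulmxV.
Qed.

(** * Exterior and Lie derivatives under a change of coordinates *)

Section Pullback.
Context {R : realType} {N : nat}.
Implicit Types (i j k l : 'I_N).
Variables (tau : 'rV[R]_N -> 'rV[R]_N) (y0 : 'rV[R]_N).
Hypothesis ctau : C_at 2 tau y0.
Variable A : 'I_N -> 'rV[R]_N -> R.
Hypothesis dA : forall j, differentiable (A j) (tau y0).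
Local Notation J := ('J tau y0).

Lemma near_jacobianE : \forall y \near y0, forall i j,
  'J tau y i j = partial i (fun z => tau z ord0 j) y.
Proof.
have [dt _] := ctau; apply: filterS dt => y dty i j; exact: jacobianE.
Qed.

Lemma differentiable_partial_entry i j :
  differentiable (partial i (fun z => tau z ord0 j)) y0.
Proof.
apply: (@C_at2_differentiable _ _ _ 0 (fun z => tau z ord0 j)).
exact: (C_at_entry ord0 j ctau).
Qed.

Lemma differentiable_jacobian i j : differentiable (fun y => 'J tau y i j) y0.
Proof.
apply: near_eq_differentiable (differentiable_partial_entry i j).
by apply: filterS near_jacobianE => y.
Qed.

Lemma partial_jacobianC k i j :
  partial k (fun y => 'J tau y i j) y0 = partial i (fun y => 'J tau y k j) y0.
Proof.
transitivity (partial k (partial i (fun z => tau z ord0 j)) y0).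
  by apply: near_partial; apply: filterS near_jacobianE => y.
transitivity (partial i (partial k (fun z => tau z ord0 j)) y0).
  apply: derive_comm; [|exact: differentiable_partial_entry..].
  have [dt _] := ctau.
  by apply: filterS dt => y; exact: differentiable_entry.
by apply: near_partial; apply: filterS near_jacobianE => y.
Qed.

Lemma partial_pullback k i (A' : 'I_N -> 'rV[R]_N -> R) :
  (\forall y \near y0, forall i, A' i y = \sum_j 'J tau y i j * A j (tau y)) ->
  partial k (A' i) y0 =
  \sum_j (partial k (fun y => 'J tau y i j) y0 * A j (tau y0) +
    J i j * \sum_l J k l * partial l (A j) (tau y0)).
Proof.
move=> A'E.
have dt : differentiable tau y0 by exact: C_at1_differentiable ctau.
transitivity (partial k (fun y => \sum_j 'J tau y i j * A j (tau y)) y0).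
  by apply: near_partial; apply: filterS A'E => y; exact.
have dAt j : differentiable (fun y => A j (tau y)) y0 by exact: differentiable_comp.
rewrite partial_sum => [|j]; last first.
  by apply: differentiableM => //; exact: differentiable_jacobian.
apply: eq_bigr => j _; rewrite partialM//; last exact: differentiable_jacobian.
by congr (_ + _ * _); exact: partial_comp.
Qed.

(** The terms with second derivatives of [tau] are symmetric in [k] and [i] by [partial_jacobianC]
    and cancel. *)
Lemma curl_pullback k i (A' : 'I_N -> 'rV[R]_N -> R) :
  (\forall y \near y0, forall i, A' i y = \sum_j 'J tau y i j * A j (tau y)) ->
  partial k (A' i) y0 - partial i (A' k) y0 =
  \sum_l \sum_j J k l * J i j *
    (partial l (A j) (tau y0) - partial j (A l) (tau y0)).
Proof.
move=> A'E; rewrite !(partial_pullback _ _ A'E) !big_split /=.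
have -> : \sum_j partial i (fun y => 'J tau y k j) y0 * A j (tau y0) =
   \sum_j partial k (fun y => 'J tau y i j) y0 * A j (tau y0).
  by apply: eq_bigr => j _; rewrite partial_jacobianC.
rewrite opprD addrACA subrr add0r.
under [RHS]eq_bigr do under eq_bigr do rewrite mulrBr.
under [RHS]eq_bigr do rewrite sumrB.
rewrite sumrB; congr (_ - _).
  rewrite exchange_big; apply: eq_bigr => j _; rewrite big_distrr /=.
  by apply: eq_bigr => l _; ring.
apply: eq_bigr => l _; rewrite big_distrr /=.
by apply: eq_bigr => j _; ring.
Qed.

(** Cartan's formula: the Lie derivative is the contraction of [Z] with the curl of [A] plus the
    differential of the function [A] on [Z]. The first part is transported by [curl_pullback], the
    second by the chain rule, and no derivative of an inverse Jacobian occurs. *)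
Lemma lie_pullback i (Z A' Z' : 'I_N -> 'rV[R]_N -> R) :
  (forall j, differentiable (Z j) (tau y0)) ->
  (forall j, differentiable (Z' j) y0) ->
  (\forall y \near y0, forall i, A' i y = \sum_j 'J tau y i j * A j (tau y)) ->
  (\forall y \near y0, forall l, \sum_k 'J tau y k l * Z' k y = Z l (tau y)) ->
  \sum_k (Z' k y0 * partial k (A' i) y0 + A' k y0 * partial i (Z' k) y0) =
  \sum_j J i j * \sum_l (Z l (tau y0) * partial l (A j) (tau y0)
    + A l (tau y0) * partial j (Z l) (tau y0)).
Proof.
move=> dZ dZ' A'E Z'E.
have dt : differentiable tau y0 by exact: C_at1_differentiable ctau.
have dA' k : differentiable (A' k) y0.
  apply: (@near_eq_differentiable _ _ _ (fun y => \sum_j 'J tau y k j * A j (tau y))).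
    by apply: filterS A'E => y ->.
  apply: differentiable_sumf => j; apply: differentiableM.
    exact: differentiable_jacobian.
  exact: differentiable_comp.
transitivity (\sum_k Z' k y0 * (partial k (A' i) y0 - partial i (A' k) y0)
    + partial i (fun y => \sum_k A' k y * Z' k y) y0).
  rewrite partial_sum => [|k]; last exact: differentiableM.
  rewrite -big_split; apply: eq_bigr => k _; rewrite partialM//=; ring.
have -> : partial i (fun y => \sum_k A' k y * Z' k y) y0 =
    \sum_j J i j * partial j (fun x => \sum_l A l x * Z l x) (tau y0).
  transitivity (partial i (fun y => \sum_l A l (tau y) * Z l (tau y)) y0).
    apply: near_partial; move: A'E Z'E; apply: filterS2 => y Ay Zy.
    under eq_bigr do rewrite Ay big_distrl /=.
    rewrite exchange_big; apply: eq_bigr => l _; rewrite -Zy big_distrr /=.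
    by apply: eq_bigr => k _; ring.
  apply: (@partial_comp _ _ i _ (fun x => \sum_l A l x * Z l x)) => //.
  by apply: differentiable_sumf => l; exact: differentiableM.
under eq_bigr do rewrite (curl_pullback _ _ A'E).
have -> : \sum_k Z' k y0 * (\sum_l \sum_j J k l * J i j *
      (partial l (A j) (tau y0) - partial j (A l) (tau y0))) =
    \sum_j J i j * \sum_l Z l (tau y0) *
      (partial l (A j) (tau y0) - partial j (A l) (tau y0)).
  under eq_bigr do rewrite big_distrr /=.
  rewrite exchange_big /=.
  under eq_bigr do under eq_bigr do rewrite big_distrr /=.
  under eq_bigr do rewrite exchange_big /=.
  rewrite exchange_big /=; apply: eq_bigr => j _.
  rewrite big_distrr /=; apply: eq_bigr => l _.
  rewrite -(nbhs_singleton Z'E) big_distrl big_distrr /=.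
  by apply: eq_bigr => k _; ring.
rewrite -big_split; apply: eq_bigr => j _ /=; rewrite -mulrDr; congr (_ * _).
rewrite partial_sum => [|l]; last exact: differentiableM.
rewrite -big_split; apply: eq_bigr => l _; rewrite partialM//=; ring.
Qed.

End Pullback.

(** * Exterior and Lie derivatives read in a fixed chart *)

Section ChartFields.
Context {R : realType} {n : nat} (M : oriented_manifold R n.+1).
Implicit Types (p q m : M) (i j k l : 'I_n.+1).
Local Notation T1 := (tensor R n 1).
Local Notation pf := (@pull_form R n 1).
Local Notation pv := (@pull_vec R n).

Lemma functorial_form1 : functorial pf.
Proof. by move=> G H s _ _; exact: actM. Qed.

Lemma functorial_vec : functorial pv.
Proof.
move=> G H s Gu Hu; rewrite /pull_vec -actM; congr (act _ s).
by rewrite invmxM// trmx_mul.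
Qed.

Lemma differentiable_coef1 (V : normedModType R) (f : V -> T1) x i :
  differentiable f x -> differentiable (fun y => coef1 (f y) i) x.
Proof. exact: differentiable_entry. Qed.

Variables (p m : M).
Hypothesis pm : mdom p m.
Local Notation x := (mchart p m).
Local Notation y0 := (mchart m m).
Local Notation tau := (transition m p).

Lemma tau_y0 : tau y0 = x. Proof. by apply: transitionE; exact: mdom_self. Qed.

Lemma C_at_tau (r : nat) : C_at r tau y0.
Proof. by apply: transition_smooth => //; exact: mdom_self. Qed.

Lemma near_loc1_form (A : M -> T1) : \forall y \near y0, forall i,
  loc1 pf A m i y = \sum_j 'J tau y i j * loc1 pf A p j (tau y).
Proof.
have := near_in_chart A functorial_form1 pm (mdom_self m).
by apply: filterS => y E i; rewrite /loc1 E coef1_act.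
Qed.

Lemma near_jacobian_tauK : \forall y \near y0, 'J tau y *m 'J (transition p m) (tau y) = 1%:M.
Proof.
have := near_mdom (mdom_self m) pm.
move: (near_mdom (mdom_self m) (mdom_self m)) (near_mchart_mchartV (mdom_self m)).
apply: filterS3 => y my yE py.
have := jacobian_transitionK my py.
by rewrite yE /transition /=.
Qed.

(** The Jacobian multiplies the new components, which is the form wanted by [lie_pullback]: an
    inverse matrix would have to be differentiated. *)
Lemma near_loc1_vec (Z : M -> T1) : \forall y \near y0, forall l,
  \sum_k 'J tau y k l * loc1 pv Z m k y = loc1 pv Z p l (tau y).
Proof.
move: (near_in_chart Z functorial_vec pm (mdom_self m)) near_jacobian_tauK.
apply: filterS2 => y E K l; rewrite /loc1 E.
have Ju : 'J tau y \in unitmx by have [U _] := mulmx1_unit K; exact: U.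
transitivity (coef1 (act ('J tau y)^T (pv ('J tau y) (in_chart pv Z p (tau y)))) l).
  by rewrite coef1_act; apply: eq_bigr => k _; rewrite [X in _ = X * _]mxE.
by rewrite /pull_vec -actM -trmx_mul mulVmx// trmx1 act1.
Qed.

(** The inverse Jacobian is replaced by the Jacobian of the inverse transition, whose
    differentiability is known. *)
Lemma differentiable_loc1_vec (Z : M -> T1) k :
  differentiable (in_chart pv Z p) x -> differentiable (loc1 pv Z m k) y0.
Proof.
move=> dZ.
have ds : differentiable tau y0 by exact: (@C_at1_differentiable _ _ _ 0 _ _ (C_at_tau 1)).
apply: (@near_eq_differentiable _ _ _
   (fun y => \sum_l 'J (transition p m) (tau y) l k * loc1 pv Z p l (tau y))).
  move: (near_in_chart Z functorial_vec pm (mdom_self m)) near_jacobian_tauK.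
  apply: filterS2 => y E K; rewrite {2}/loc1 E coef1_act; apply: eq_bigr => l _.
  by rewrite (invmx_eq K) [X in _ = X * _]mxE.
apply: differentiable_sumf => l; apply: differentiableM.
  apply: (@differentiable_comp _ _ _ _ tau (fun z => 'J (transition p m) z l k)) ds _.
  rewrite tau_y0; apply: differentiable_jacobian.
  by apply: transition_smooth => //; exact: mdom_self.
apply: (@differentiable_comp _ _ _ _ tau (loc1 pv Z p l)) ds _.
by rewrite tau_y0; exact: differentiable_coef1.
Qed.

(** The value of [ext_d A] at [m] is computed in the chart of [m]. Reading it in the chart of [p]
    for all [m] of its domain is what makes this field differentiable in turn. *)
Lemma ext_d_in_chart (A : M -> T1) : differentiable (in_chart pf A p) x ->
  in_chart (@pull_form R n 2) (ext_d A) p x =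
  mktensor2 (fun i j => partial i (loc1 pf A p j) x - partial j (loc1 pf A p i) x).
Proof.
move=> dA; rewrite in_chartE//.
have -> : ext_d A m = pull_form ('J tau y0) (mktensor2 (fun i j =>
    partial i (loc1 pf A p j) x - partial j (loc1 pf A p i) x)).
  apply: tensor2P => i j; rewrite coef2_mktensor2 coef2_act.
  have := @curl_pullback _ _ tau y0 (C_at_tau 2) (loc1 pf A p) _ i j _ (near_loc1_form A).
  rewrite tau_y0 => -> //; last by move=> l; exact: differentiable_coef1.
  by apply: eq_bigr => l _; apply: eq_bigr => l' _; rewrite coef2_mktensor2.
rewrite /pull_form -actM.
have -> : 'J (transition p m) x *m 'J tau y0 = 1%:M.
  by apply: jacobian_transitionK => //; exact: mdom_self.
exact: act1.
Qed.

Lemma lie_form_in_chart (Z A : M -> T1) i :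
  differentiable (in_chart pf A p) x -> differentiable (in_chart pv Z p) x ->
  loc1 pf (lie_form Z A) p i x =
  \sum_k (loc1 pv Z p k x * partial k (loc1 pf A p i) x
    + loc1 pf A p k x * partial i (loc1 pv Z p k) x).
Proof.
move=> dA dZ; rewrite /loc1 in_chartE//.
have -> : lie_form Z A m = pull_form ('J tau y0) (mktensor1 (fun i =>
    \sum_k (loc1 pv Z p k x * partial k (loc1 pf A p i) x
    + loc1 pf A p k x * partial i (loc1 pv Z p k) x))).
  apply: tensor1P => j; rewrite coef1_mktensor1 coef1_act.
  have := @lie_pullback _ _ tau y0 (C_at_tau 2) (loc1 pf A p) _ j
    (loc1 pv Z p) (loc1 pf A m) (loc1 pv Z m) _ _ (near_loc1_form A) (near_loc1_vec Z).
  rewrite tau_y0 => H.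
  transitivity (\sum_k (loc1 pv Z m k y0 * partial k (loc1 pf A m j) y0 +
     loc1 pf A m k y0 * partial j (loc1 pv Z m k) y0)).
    apply: eq_bigr => k _; rewrite /loc1 !in_chart_base//; last first.
      by rewrite /pull_vec invmx1 trmx1 act1.
    exact: act1.
  rewrite H => [|l|l|l].
  - by apply: eq_bigr => l _; rewrite coef1_mktensor1.
  - exact: differentiable_coef1.
  - exact: differentiable_coef1.
  - exact: differentiable_loc1_vec.
rewrite /pull_form -actM.
have -> : 'J (transition p m) x *m 'J tau y0 = 1%:M.
  by apply: jacobian_transitionK => //; exact: mdom_self.
by rewrite act1 coef1_mktensor1.
Qed.

End ChartFields.

(** * Local diffeomorphisms with prescribed Jacobian *)

Section AffineDiffeo.
Context {R : realType} {n : nat} (M : oriented_manifold R n.+1).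
Implicit Types (p m : M) (a b y : 'rV[R]_n.+1) (G : 'M[R]_n.+1).

Definition affine a b G y : 'rV[R]_n.+1 := b + (y - a) *m G.

Lemma affineK a b G : G \in unitmx -> cancel (affine a b G) (affine b a (invmx G)).
Proof. by move=> Gu y; rewrite /affine [b + _]addrC addrK mulmxK// subrKC. Qed.

Lemma differentiable_affine a b G y : differentiable (affine a b G) y.
Proof. exact: (@C_at1_differentiable _ _ _ 0 _ _ (smooth_at_affine G b a y 1)). Qed.

Lemma jacobian_affine a b G y : 'J (affine a b G) y = G.
Proof.
apply/matrixP => i j; rewrite mxE -deriveE; last exact: differentiable_affine.
by rewrite derive_affine -rowE mxE.
Qed.

Definition affine_map p a b G m : M := mchartV p (affine a b G (mchart p m)).

(** The affine image has to stay in the range of the chart, outside of which the values of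
    [mchartV p] are arbitrary. *)
Definition affine_dom p a b G : set M :=
  [set m | mdom p m /\ (mchart p @` mdom p) (affine a b G (mchart p m))].

Lemma affine_mapE p a b G m : affine_dom p a b G m ->
  mdom p (affine_map p a b G m) /\
  mchart p (affine_map p a b G m) = affine a b G (mchart p m).
Proof. by move=> [_ [m' pm' E]]; rewrite /affine_map -E mchartK. Qed.

Lemma affine_mapK p a b G m : G \in unitmx -> affine_dom p a b G m ->
  affine_dom p b a (invmx G) (affine_map p a b G m) /\
  affine_map p b a (invmx G) (affine_map p a b G m) = m.
Proof.
move=> Gu Om; have [pfm E] := affine_mapE Om; have [pm _] := Om.
split; last by rewrite /affine_map E affineK// mchartK.
by split=> //; rewrite E affineK//; exists m.
Qed.

Lemma affine_map_image p a b G : G \in unitmx ->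
  affine_map p a b G @` affine_dom p a b G = affine_dom p b a (invmx G).
Proof.
move=> Gu; apply/seteqP; split=> [_ [m Om <-]|m Om].
  by have [] := affine_mapK Gu Om.
have Gu' : invmx G \in unitmx by rewrite unitmx_inv.
have := affine_mapK Gu' Om; rewrite invmxK => -[dm E].
by exists (affine_map p b a (invmx G) m).
Qed.

Lemma affine_cts p a b G m : mdom p m ->
  {for m, continuous (affine a b G \o mchart p)}.
Proof.
move=> pm; apply: continuous_comp; first exact: mchart_cts.
exact/differentiable_continuous/differentiable_affine.
Qed.

Lemma affine_dom_open p a b G : open (affine_dom p a b G).
Proof.
rewrite openE => m [pm im]; rewrite /interior.
have h1 : nbhs m (mdom p) by apply: open_nbhs_nbhs; split => //; exact: mdom_open.
have h2 : \forall m' \near m, (mchart p @` mdom p) ((affine a b G \o mchart p) m').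
  have cts := affine_cts (a := a) (b := b) (G := G) pm; apply: (cts (mchart p @` mdom p)).
  by apply: open_nbhs_nbhs; split => //; exact: mim_open.
by apply: filterS2 h1 h2 => m' pm' im'.
Qed.

Lemma affine_map_smooth p a b G :
  smooth_map_on (affine_dom p a b G) (affine_map p a b G).
Proof.
move=> m Om; have [pm _] := Om; have [pfm E] := affine_mapE Om.
split.
  apply: (@continuous_comp _ _ _ (affine a b G \o mchart p) (mchartV p)).
    exact: affine_cts.
  by rewrite /= -E; exact: mchartV_cts.
set q := affine_map p a b G m.
apply: (@smooth_at_comp _ _ _ _ (affine a b G \o transition m p) (transition p q)).
  apply: (@smooth_at_comp _ _ _ _ (transition m p) (affine a b G)).
    by apply: transition_smooth => //; exact: mdom_self.
  exact: smooth_at_affine.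
rewrite /= transitionE; last exact: mdom_self.
by rewrite -E; apply: transition_smooth => //; exact: mdom_self.
Qed.

Lemma affine_map_diffeo p a b G : G \in unitmx ->
  local_diffeo (affine_dom p a b G) (affine_map p a b G).
Proof.
move=> Gu; split.
- exact: affine_dom_open.
- by rewrite affine_map_image//; exact: affine_dom_open.
- exact: affine_map_smooth.
exists (affine_map p b a (invmx G)) => [m Om|].
  by have [] := affine_mapK Gu Om.
by rewrite affine_map_image//; exact: affine_map_smooth.
Qed.

(** Every invertible matrix is the Jacobian of a local diffeomorphism taking m to
    p: this turns covariance under diffeomorphisms into covariance under the
    linear group. *)
Lemma local_diffeo_jacobian p m G : mdom p m -> G \in unitmx ->
  exists U f, [/\ local_diffeo U f, U m, f m = p &
    tmap f m = 'J (transition m p) (mchart m m) *m G].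
Proof.
move=> pm Gu; pose a := mchart p m; pose b := mchart p p.
have ab : affine a b G (mchart p m) = b by rewrite /affine subrr mul0mx addr0.
have fm : affine_map p a b G m = p.
  by rewrite /affine_map ab mchartK//; exact: mdom_self.
exists (affine_dom p a b G), (affine_map p a b G); split => //.
- exact: affine_map_diffeo.
- by split=> //; rewrite ab; exists p => //; exact: mdom_self.
have mm := mdom_self m; have pp := mdom_self p.
rewrite /tmap fm.
have d1 : differentiable (transition m p) (mchart m m) by exact: transition_differentiable.
have d2 : differentiable (affine a b G \o transition m p) (mchart m m).
  exact: (differentiable_comp d1 (differentiable_affine _ _ _ _)).
have E : affine a b G (transition m p (mchart m m)) = mchart p p.
  by rewrite transitionE.
have d3 : differentiable (transition p p) (affine a b G (transition m p (mchart m m))).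
  by rewrite E; exact: transition_differentiable.
transitivity ('J (affine a b G \o transition m p) (mchart m m) *m
    'J (transition p p) (affine a b G (transition m p (mchart m m)))).
  exact: (jacobian_comp d2 d3).
have J1 : 'J (transition p p) (affine a b G (transition m p (mchart m m))) = 1%:M.
  by rewrite E; exact: jacobian_transition_id.
transitivity ('J (affine a b G \o transition m p) (mchart m m) *m 1%:M).
  congr (_ *m _); exact: J1.
transitivity ('J (affine a b G \o transition m p) (mchart m m)); first exact: mulmx1.
transitivity ('J (transition m p) (mchart m m) *m
    'J (affine a b G) (transition m p (mchart m m))).
  exact: (jacobian_comp d1 (differentiable_affine _ _ _ _)).
by congr (_ *m _); exact: jacobian_affine.
Qed.

Lemma det_jacobian_transition p m : mdom p m ->
  0 < \det ('J (transition m p) (mchart m m)).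
Proof. by move=> pm; apply: mtrans_pos => //; exact: mdom_self. Qed.

(** Two instances are used: [G] the identity, which compares the densities at [m] and [p], and
    [m = p], which gives covariance at one point under all matrices of positive determinant. *)
Lemma lagrangian_covariance (l : lagrangian M) : covariant_lagrangian l ->
  forall p m G, mdom p m -> 0 < \det G ->
  let H := 'J (transition m p) (mchart m m) *m G in
  forall A F w r s g, alternating F -> lorentzian g -> timelike g w ->
  l m (pull_form H A, pull_form H F, pull_vec H w, pull_top H r, pull_top H s,
       pull_metric H g)
  = pull_top H (l p (A, F, w, r, s, g)).
Proof.
move=> hl p m G pm G0 H A F w r s g aF lg tw.
have Gu : G \in unitmx by rewrite unitmxE unitfE gt_eqF.
have [U [f [fU Um fm tE]]] := local_diffeo_jacobian pm Gu.
have := hl U f fU m Um; rewrite /= fm tE; apply=> //.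
by rewrite det_mulmx mulr_gt0// det_jacobian_transition.
Qed.

(** The sign of the determinant is left free, since this is applied to a reflection. *)
Lemma eps_covariance (eps : eps_density M) : covariant_eps eps ->
  forall p G, G \in unitmx -> forall rho s E B g, alternating B -> lorentzian g ->
  eps p (rho, s, pull_form G E, pull_form G B, pull_metric G g)
  = eps p (rho, s, E, B, g).
Proof.
move=> he p G Gu rho s E B g aB lg.
have [U [f [fU Um fm tE]]] := local_diffeo_jacobian (mdom_self p) Gu.
have := he U f fU p Um; rewrite /= fm tE jacobian_transition_id ?mul1mx; last exact: mdom_self.
exact.
Qed.

End AffineDiffeo.

(** * Lagrangians and their covariance *)

Section SixTuples.
Context {R : realType} {V1 V2 V3 V4 V5 V6 : normedModType R}.
Variables (t : R) (a1 v1 : V1) (a2 v2 : V2) (a3 v3 : V3) (a4 v4 : V4)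
  (a5 v5 : V5) (a6 v6 : V6).

Lemma tuple6_line :
  t *: (v1, v2, v3, v4, v5, v6) + (a1, a2, a3, a4, a5, a6) =
  (t *: v1 + a1, t *: v2 + a2, t *: v3 + a3, t *: v4 + a4, t *: v5 + a5,
   t *: v6 + a6).
Proof. by []. Qed.

End SixTuples.

Section SixSlots.
Context {R : realType} {V1 V2 V3 V4 V5 V6 : normedModType R}.
Variables (t : R) (a1 v1 : V1) (a2 v2 : V2) (a3 v3 : V3) (a4 v4 : V4)
  (a5 v5 : V5) (a6 v6 : V6).

Lemma tuple6_line1 :
  (t *: v1 + a1, a2, a3, a4, a5, a6) =
  t *: (v1, 0, 0, 0, 0, 0) + (a1, a2, a3, a4, a5, a6).
Proof. by rewrite [RHS]tuple6_line !scaler0 !add0r. Qed.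

Lemma differentiable_tuple6_1 (f : V1 * V2 * V3 * V4 * V5 * V6 -> R) :
  differentiable f (a1, a2, a3, a4, a5, a6) ->
  differentiable (fun v1 => f (v1, a2, a3, a4, a5, a6)) a1.
Proof.
move=> df; apply: (@differentiable_comp _ _ _ _
  (fun v1 => (v1, a2, a3, a4, a5, a6)) f) => //;
  by do ?[apply: differentiable_pair => //].
Qed.

Lemma tuple6_line2 :
  (a1, t *: v2 + a2, a3, a4, a5, a6) =
  t *: (0, v2, 0, 0, 0, 0) + (a1, a2, a3, a4, a5, a6).
Proof. by rewrite [RHS]tuple6_line !scaler0 !add0r. Qed.

Lemma differentiable_tuple6_2 (f : V1 * V2 * V3 * V4 * V5 * V6 -> R) :
  differentiable f (a1, a2, a3, a4, a5, a6) ->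
  differentiable (fun v2 => f (a1, v2, a3, a4, a5, a6)) a2.
Proof.
move=> df; apply: (@differentiable_comp _ _ _ _
  (fun v2 => (a1, v2, a3, a4, a5, a6)) f) => //;
  by do ?[apply: differentiable_pair => //].
Qed.

Lemma tuple6_line3 :
  (a1, a2, t *: v3 + a3, a4, a5, a6) =
  t *: (0, 0, v3, 0, 0, 0) + (a1, a2, a3, a4, a5, a6).
Proof. by rewrite [RHS]tuple6_line !scaler0 !add0r. Qed.

Lemma differentiable_tuple6_3 (f : V1 * V2 * V3 * V4 * V5 * V6 -> R) :
  differentiable f (a1, a2, a3, a4, a5, a6) ->
  differentiable (fun v3 => f (a1, a2, v3, a4, a5, a6)) a3.
Proof.
move=> df; apply: (@differentiable_comp _ _ _ _
  (fun v3 => (a1, a2, v3, a4, a5, a6)) f) => //;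
  by do ?[apply: differentiable_pair => //].
Qed.

Lemma tuple6_line4 :
  (a1, a2, a3, t *: v4 + a4, a5, a6) =
  t *: (0, 0, 0, v4, 0, 0) + (a1, a2, a3, a4, a5, a6).
Proof. by rewrite [RHS]tuple6_line !scaler0 !add0r. Qed.

Lemma differentiable_tuple6_4 (f : V1 * V2 * V3 * V4 * V5 * V6 -> R) :
  differentiable f (a1, a2, a3, a4, a5, a6) ->
  differentiable (fun v4 => f (a1, a2, a3, v4, a5, a6)) a4.
Proof.
move=> df; apply: (@differentiable_comp _ _ _ _
  (fun v4 => (a1, a2, a3, v4, a5, a6)) f) => //;
  by do ?[apply: differentiable_pair => //].
Qed.

Lemma tuple6_line5 :
  (a1, a2, a3, a4, t *: v5 + a5, a6) =
  t *: (0, 0, 0, 0, v5, 0) + (a1, a2, a3, a4, a5, a6).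
Proof. by rewrite [RHS]tuple6_line !scaler0 !add0r. Qed.

Lemma differentiable_tuple6_5 (f : V1 * V2 * V3 * V4 * V5 * V6 -> R) :
  differentiable f (a1, a2, a3, a4, a5, a6) ->
  differentiable (fun v5 => f (a1, a2, a3, a4, v5, a6)) a5.
Proof.
move=> df; apply: (@differentiable_comp _ _ _ _
  (fun v5 => (a1, a2, a3, a4, v5, a6)) f) => //;
  by do ?[apply: differentiable_pair => //].
Qed.

End SixSlots.

(** * Derivatives of a Lagrangian at a state and their behaviour under pull-back *)

Section Slots.
Context {R : realType} {n : nat}.
Implicit Types (f : lagr_arg R n -> R) (S : lagr_arg R n) (G H J g : 'M[R]_n.+1).
Local Notation T1 := (tensor R n 1).
Local Notation T2 := (tensor R n 2).

Definition slotA f S : T1 :=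
  let: (A, F, w, r, s, g) := S in pderiv (fun A => f (A, F, w, r, s, g)) A.
Definition slotF f S : T2 :=
  let: (A, F, w, r, s, g) := S in pderiv (fun F => f (A, F, w, r, s, g)) F.
Definition slotw f S : T1 :=
  let: (A, F, w, r, s, g) := S in pderiv (fun w => f (A, F, w, r, s, g)) w.
Definition slotr f S : R :=
  let: (A, F, w, r, s, g) := S in derive1 (fun r : R => f (A, F, w, r, s, g)) r.
Definition slots f S : R :=
  let: (A, F, w, r, s, g) := S in derive1 (fun s : R => f (A, F, w, r, s, g)) s.

Definition stress_mx (l r lr s ls : R) (w lw lA A : T1) (lF F : T2) : 'M[R]_n.+1 :=
  (l - r * lr - s * ls) *: 1%:M + trtens w lw - trtens lA A - trtens lF F.

(** Expression (i) at the state S. *)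
Definition stress f S : 'M[R]_n.+1 := let: (A, F, w, r, s, g) := S in
  stress_mx (f S) r (slotr f S) s (slots f S) w (slotw f S) (slotA f S) A
    (slotF f S) F.

Lemma stress_mx_pull J l r lr s ls w lw lA A lF F : J \in unitmx ->
  stress_mx (\det J * l) (\det J * r) lr (\det J * s) ls (pull_vec J w)
    (\det J *: act J lw) (pull_mvdens J lA) (pull_form J A)
    (pull_mvdens J lF) (pull_form J F) =
  pull_dens11 J (stress_mx l r lr s ls w lw lA A lF F).
Proof.
move=> Ju; rewrite /stress_mx /pull_mvdens !trtensZl !trtensZr /pull_vec /pull_form.
have K : ((invmx J)^T)^T *m J = 1%:M by rewrite trmxK mulVmx.
rewrite !(trtens_act _ _ K) /pull_dens11 !(mulmxDr, mulmxDl, mulmxN, mulNmx).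
rewrite !scalerDr !scalerN; congr (_ + _ - _ - _).
rewrite -scalemxAr -scalemxAl mulmx1 -trmx_mul mulmxV// trmx1 scalerA.
by congr (_ *: _); ring.
Qed.

Lemma coef_slotA f S I : coef (slotA f S) I = 'D_(wedge_basis R I, 0, 0, 0, 0, 0) f S.
Proof.
case: S => [[[[[A F] w] r] s] g]; rewrite coef_mktensor.
apply: (derive_embed f (emb := fun A => (A, F, w, r, s, g))) => t.
exact: tuple6_line1.
Qed.

Lemma coef_slotF f S I : coef (slotF f S) I = 'D_(0, wedge_basis R I, 0, 0, 0, 0) f S.
Proof.
case: S => [[[[[A F] w] r] s] g]; rewrite coef_mktensor.
apply: (derive_embed f (emb := fun F => (A, F, w, r, s, g))) => t.
exact: tuple6_line2.
Qed.

Lemma coef_slotw f S I : coef (slotw f S) I = 'D_(0, 0, wedge_basis R I, 0, 0, 0) f S.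
Proof.
case: S => [[[[[A F] w] r] s] g]; rewrite coef_mktensor.
apply: (derive_embed f (emb := fun w => (A, F, w, r, s, g))) => t.
exact: tuple6_line3.
Qed.

Lemma slotrE f S : slotr f S = 'D_(0, 0, 0, 1, 0, 0) f S.
Proof.
case: S => [[[[[A F] w] r] s] g]; rewrite /slotr derive1E.
apply: (derive_embed f (emb := fun r => (A, F, w, r, s, g))) => t.
exact: tuple6_line4.
Qed.

Lemma slotsE f S : slots f S = 'D_(0, 0, 0, 0, 1, 0) f S.
Proof.
case: S => [[[[[A F] w] r] s] g]; rewrite /slots derive1E.
apply: (derive_embed f (emb := fun s => (A, F, w, r, s, g))) => t.
exact: tuple6_line5.
Qed.

Lemma alternating1 (t : T1) : alternating t.
Proof.
move=> s I; have -> : s = 1%g.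
  by apply/permP => i; rewrite !ord1.
rewrite odd_perm1 expr0 mul1r; congr (coef t _).
by apply: eq_from_tnth => i; rewrite tnth_mktuple perm1.
Qed.

Lemma act_linear k G (J : finType) (a : J -> R) (f : J -> tensor R n k) :
  act G (\sum_j a j *: f j) = \sum_j a j *: act G (f j).
Proof.
apply: tensorP => I; rewrite coef_sum coef_mktensor.
under eq_bigr do rewrite coef_sum big_distrr /=.
rewrite exchange_big /=; apply: eq_bigr => j _.
rewrite coefZ coef_mktensor big_distrr /=.
by apply: eq_bigr => L _; rewrite coefZ; ring.
Qed.

Lemma alternating_act k G (t : tensor R n k) : alternating t -> alternating (act G t).
Proof.
move=> at_; rewrite (alternating_expansion at_) actZ act_linear.
apply: alternatingZ => //; apply: alternating_sum => I; apply: alternatingZ.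
by rewrite wedge_basis_det act_det_tensor; exact: alternating_det_tensor.
Qed.

Lemma contr_wedge_basis_alt k (t : tensor R n k) I : alternating t ->
  contr t (wedge_basis R I) = coef t I.
Proof.
move=> at_; rewrite {2}(alternating_expansion at_) coefZ coef_sum; congr (_ * _).
apply: eq_bigr => J _; rewrite coefZ !coef_mktensor -det_tr; congr (_ * \det _).
by apply/matrixP => a b; rewrite !mxE eq_sym.
Qed.

Lemma actZD k G a (s t : tensor R n k) : act G (s + a *: t) = act G s + a *: act G t.
Proof. by rewrite actD actZ. Qed.

(** The basis form at [act H t] is the image of the direction [v] at [t], so the derivative follows
    from a comparison of [f1] and [f2] along lines. The comparison is asked only along alternating
    directions and for small parameters, which is where the states remain admissible. *)
Lemma pderiv_pull k (f1 f2 : tensor R n k -> R) H d (t : tensor R n k) :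
  H \in unitmx -> differentiable f2 t ->
  (forall v, alternating v ->
     \forall y \near (0 : R), f1 (act H (t + y *: v)) = d * f2 (t + y *: v)) ->
  pderiv f1 (act H t) = d *: act (invmx H)^T (pderiv f2 t).
Proof.
move=> Hu df f12; apply: tensorP => I; rewrite coef_mktensor coefZ.
pose v := act (invmx H) (wedge_basis R I).
have av : alternating v by apply: alternating_act; exact: alternating_wedge_basis.
have vE : act H v = wedge_basis R I by rewrite /v -actM mulmxV// act1.
have aP := alternating_pderiv df.
rewrite derive_lineE.
transitivity ('D_1 (fun y : R => d * f2 (t + y *: v)) 0).
  apply: near_eq_derive; apply: filterS (f12 _ av) => y <-.
  by rewrite actZD vE.
have -> : (fun y : R => d * f2 (t + y *: v)) = d *: (fun y : R => f2 (t + y *: v)) by [].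
have D := is_derive_affine1 t v 0.
have dfl : differentiable f2 (t + 0 *: v) by rewrite scale0r addr0.
have [D1 D2] := is_derive_curve dfl D.
rewrite deriveZ// [LHS]/(d * _); congr (_ * _); rewrite D2 scale0r addr0.
rewrite -contr_pderiv// -contr_wedge_basis_alt; last exact: alternating_act.
by rewrite -vE contr_act// trmxK mulVmx.
Qed.

(** Argument and value are multiplied by the same factor, which therefore drops out: the derivative
    of a density in a density is a scalar. *)
Lemma derive1_scale (f1 f2 : R -> R) d r : d != 0 -> differentiable f2 r ->
  (forall y, f1 (d * y) = d * f2 y) -> derive1 f1 (d * r) = derive1 f2 r.
Proof.
move=> d0 df f12; rewrite !derive1E.
have <- : 'D_(d^-1) (fun y => f1 (d * y)) r = 'D_1 f1 (d * r).
  apply: derive_embed => t; rewrite -[t *: d^-1]/(t * d^-1) -[t *: 1]/(t * 1).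
  by rewrite mulrDr mulrCA mulfV.
have -> : (fun y => f1 (d * y)) = d *: f2 by apply/funext => y; rewrite f12.
rewrite deriveZ ?deriveE//; last exact/diff_derivable.
have -> : d^-1 = d^-1 *: 1 :> R by rewrite -[RHS]/(_ * _) mulr1.
by rewrite linearZ /= -[d *: _]/(_ * _) -[d^-1 *: _]/(_ * _) mulrA mulfV// mul1r.
Qed.

Definition pull_state H S : lagr_arg R n := let: (A, F, w, r, s, g) := S in
  (pull_form H A, pull_form H F, pull_vec H w, pull_top H r, pull_top H s,
   pull_metric H g).

(** The states at which covariance constrains a Lagrangian. *)
Definition admissible S : Prop := let: (A, F, w, r, s, g) := S in
  [/\ alternating F, lorentzian g & timelike g w].

Lemma trmx_invmxM G H : G \in unitmx -> H \in unitmx ->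
  (invmx (G *m H))^T = (invmx G)^T *m (invmx H)^T.
Proof. by move=> Gu Hu; rewrite invmxM// trmx_mul. Qed.

Lemma functorial_state : functorial pull_state.
Proof.
move=> G H [[[[[A F] w] r] s] g] Gu Hu; congr (_, _, _, _, _, _).
- exact: actM.
- exact: actM.
- by rewrite /pull_vec trmx_invmxM// actM.
- by rewrite /pull_top det_mulmx mulrA.
- by rewrite /pull_top det_mulmx mulrA.
- by rewrite /pull_metric trmx_mul !mulmxA.
Qed.

Lemma functorial_dens11 : functorial (@pull_dens11 R n).
Proof.
move=> G H T Gu Hu; rewrite /pull_dens11 trmx_invmxM// trmx_mul det_mulmx -scalerA.
by congr (_ *: _); rewrite -scalemxAr -scalemxAl !mulmxA.
Qed.

Lemma functorial_mvdens k : functorial (@pull_mvdens R n k).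
Proof.
move=> G H T Gu Hu; rewrite /pull_mvdens trmx_invmxM// det_mulmx -scalerA.
by congr (_ *: _); rewrite actZ actM.
Qed.

Lemma sqnorm_pull H g w : H \in unitmx ->
  sqnorm (pull_metric H g) (pull_vec H w) = sqnorm g w.
Proof.
move=> Hu; rewrite /sqnorm /flat /pull_vec -actM.
have -> : pull_metric H g *m (invmx H)^T = H *m g.
  by rewrite /pull_metric -mulmxA -trmx_mul mulVmx// trmx1 mulmx1.
by rewrite actM contr_act// trmxK mulVmx.
Qed.

Lemma lorentzian_pull H g : H \in unitmx -> lorentzian g ->
  lorentzian (pull_metric H g).
Proof.
move=> Hu [gs [P Pu Pg]]; split.
  by rewrite /pull_metric !trmx_mul trmxK gs mulmxA.
exists (P *m invmx H); first by rewrite unitmx_mul Pu unitmx_inv.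
rewrite -Pg /pull_metric trmx_mul !mulmxA mulmxKV//.
by rewrite -(mulmxA (P *m g)) -trmx_mul mulVmx// trmx1 mulmx1.
Qed.

Lemma admissible_pull H S : H \in unitmx -> admissible S -> admissible (pull_state H S).
Proof.
move: S => [[[[[A F] w] r] s] g] Hu [aF lg tw]; split.
- exact: alternating_act.
- exact: lorentzian_pull.
- by rewrite /timelike sqnorm_pull.
Qed.

Section Naturality.
Variables (f1 f2 : lagr_arg R n -> R) (J : 'M[R]_n.+1) (S : lagr_arg R n).
Hypothesis J0 : 0 < \det J.
Hypothesis aS : admissible S.
Hypothesis df2 : differentiable f2 S.
Hypothesis f12 : forall S', admissible S' -> f1 (pull_state J S') = \det J * f2 S'.

Let Ju : J \in unitmx. Proof. by rewrite unitmxE unitfE gt_eqF. Qed.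

Lemma slotA_pull : slotA f1 (pull_state J S) = pull_mvdens J (slotA f2 S).
Proof.
move: S aS df2 => [[[[[A F] w] r] s] g] [aF lg tw] df.
apply: pderiv_pull => //.
  exact: (differentiable_tuple6_1 df).
by move=> v av; apply: filterE => y; exact: (f12 (S' := (_, F, w, r, s, g))).
Qed.

Lemma slotF_pull : slotF f1 (pull_state J S) = pull_mvdens J (slotF f2 S).
Proof.
move: S aS df2 => [[[[[A F] w] r] s] g] [aF lg tw] df.
apply: pderiv_pull => //.
  exact: (differentiable_tuple6_2 df).
move=> v av; apply: filterE => y; apply: (f12 (S' := (A, _, w, r, s, g))).
by split=> //; exact: alternating_line.
Qed.

Lemma slotw_pull : slotw f1 (pull_state J S) = \det J *: act J (slotw f2 S).
Proof.
move: S aS df2 => [[[[[A F] w] r] s] g] [aF lg tw] df.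
(* Vectors are pulled back by the transposed inverse of [J], so [pderiv_pull] is used with that
   matrix, whose own transposed inverse is [J]. *)
have -> : act J (slotw f2 (A, F, w, r, s, g)) =
    act (invmx (invmx J)^T)^T (slotw f2 (A, F, w, r, s, g)).
  by rewrite -trmx_inv invmxK trmxK.
apply: pderiv_pull => //.
- by rewrite unitmx_tr unitmx_inv.
- exact: (differentiable_tuple6_3 df).
move=> v av; have := near_timelike lg tw v; apply: filterS => y ty.
by apply: (f12 (S' := (A, F, _, r, s, g))).
Qed.

Lemma slotr_pull : slotr f1 (pull_state J S) = slotr f2 S.
Proof.
move: S aS df2 => [[[[[A F] w] r] s] g] [aF lg tw] df.
apply: derive1_scale => //; first by rewrite gt_eqF.
  exact: (differentiable_tuple6_4 df).
by move=> y; apply: (f12 (S' := (A, F, w, y, s, g))).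
Qed.

Lemma slots_pull : slots f1 (pull_state J S) = slots f2 S.
Proof.
move: S aS df2 => [[[[[A F] w] r] s] g] [aF lg tw] df.
apply: derive1_scale => //; first by rewrite gt_eqF.
  exact: (differentiable_tuple6_5 df).
by move=> y; apply: (f12 (S' := (A, F, w, r, y, g))).
Qed.

Lemma stress_pull : stress f1 (pull_state J S) = pull_dens11 J (stress f2 S).
Proof.
have EA := slotA_pull; have EF := slotF_pull; have Ew := slotw_pull.
have Er := slotr_pull; have Es := slots_pull; have El := f12 aS.
move: S EA EF Ew Er Es El => [[[[[A F] w] r] s] g] EA EF Ew Er Es El.
rewrite /stress -stress_mx_pull// -EA -EF -Ew -El -{1}Er -{1}Es; exact: erefl.
Qed.

End Naturality.

End Slots.

(** * The Lagrangian and its derivatives in a fixed chart *)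

Section LagrangianInChart.
Context {R : realType} {n : nat} (M : oriented_manifold R n.+1).
Implicit Types (m : M) (i j k : 'I_n.+1) (x : 'rV[R]_n.+1).
Variables (l : lagrangian M) (X : fluid_fields M).
Hypothesis hl : covariant_lagrangian l.
Hypothesis hX : regular_fields X.
Hypothesis hls : forall p, smooth_at (l p) (lagr_state X p).
Variable p : M.
Local Notation x0 := (mchart p p).
Local Notation pf1 := (@pull_form R n 1).
Local Notation pf2 := (@pull_form R n 2).
Local Notation pv := (@pull_vec R n).
Local Notation hA := (in_chart pf1 (fA X) p).
Local Notation hF := (in_chart pf2 (fF X) p).
Local Notation hw := (in_chart pv (fw X) p).
Local Notation hr := (in_chart (@pull_top R n : _ -> R -> R) (fr X) p).
Local Notation hs := (in_chart (@pull_top R n : _ -> R -> R) (fs X) p).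
Local Notation hg := (in_chart (@pull_metric R n) (fg X) p).

(** Every point close to [x0] is [mchart p m] for some [m] in the domain; there the chart
    expressions are given by [in_chartE]. *)
Lemma near_chart (Q P : 'rV[R]_n.+1 -> Prop) :
  (forall m, mdom p m -> Q (mchart p m) -> P (mchart p m)) ->
  (\forall x \near x0, Q x) -> \forall x \near x0, P x.
Proof.
move=> QP nQ; have pp := mdom_self p.
move: (near_mdom pp pp) (near_mchart_mchartV pp) nQ; apply: filterS3 => x px xE.
by rewrite -xE; exact: QP.
Qed.

Lemma alternating_ext_d (A : M -> tensor R n 1) m : alternating (ext_d A m).
Proof. by apply: alternating2P => i j; rewrite !coef2_mktensor2 opprB. Qed.

Lemma admissible_state m : admissible (lagr_state X m).
Proof.
split; first exact: alternating_ext_d.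
  exact: reg_lorentz.
exact: reg_timelike.
Qed.

Definition chart_state x : lagr_arg R n := (hA x, hF x, hw x, hr x, hs x, hg x).

Lemma chart_state_mchart m : mdom p m ->
  chart_state (mchart p m) =
  pull_state ('J (transition p m) (mchart p m)) (lagr_state X m).
Proof.
move=> pm; transitivity (in_chart pull_state (lagr_state X) p (mchart p m)); first by [].
exact: in_chartE.
Qed.

Lemma pull_state1 (S : lagr_arg R n) : pull_state 1%:M S = S.
Proof.
case: S => [[[[[A F] w] r] s] g].
rewrite /pull_state /pull_form /pull_vec /pull_top /pull_metric.
by rewrite !invmx1 !trmx1 !act1 det1 !mul1r mul1mx mulmx1.
Qed.

Lemma lagr_state_pull m : mdom p m ->
  lagr_state X m =
  pull_state ('J (transition m p) (mchart m m)) (chart_state (mchart p m)).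
Proof.
move=> pm; rewrite chart_state_mchart// -functorial_state.
- have -> := jacobian_transitionK (mdom_self m) pm.
  by rewrite pull_state1.
- exact: jacobian_transition_unit (mdom_self m) pm.
- exact: jacobian_transition_unit pm (mdom_self m).
Qed.

Lemma chart_state0 : chart_state x0 = lagr_state X p.
Proof.
rewrite chart_state_mchart; last exact: mdom_self.
have -> := jacobian_transition_id (mdom_self p).
exact: pull_state1.
Qed.

Lemma admissible_chart_state m : mdom p m -> admissible (chart_state (mchart p m)).
Proof.
move=> pm; rewrite chart_state_mchart//; apply: admissible_pull.
  exact: jacobian_transition_unit pm (mdom_self m).
exact: admissible_state.
Qed.

Lemma lagrangian_chart m (S : lagr_arg R n) : mdom p m -> admissible S ->
  l m (pull_state ('J (transition m p) (mchart m m)) S) =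
  \det ('J (transition m p) (mchart m m)) * l p S.
Proof.
move: S => [[[[[A F] w] r] s] g] pm [aF lg tw].
have d1 : 0 < \det (1%:M : 'M[R]_n.+1) by rewrite det1.
have := @lagrangian_covariance _ _ _ l hl p m 1%:M pm d1 A F w r s g aF lg tw.
by rewrite mulmx1.
Qed.

Lemma smooth_hF : smooth_field_at pf2 (fF X) p.
Proof.
move=> k; have sA : smooth_at hA x0 := reg_A hX p.
apply: (@C_at_near _ _ _ _ (fun x => mktensor2 (fun i j =>
    partial i (loc1 pf1 (fA X) p j) x - partial j (loc1 pf1 (fA X) p i) x))).
  have [dA _] := sA 1; apply: near_chart dA => m pm dA.
  by rewrite ext_d_in_chart.
apply: C_at_mx => a b; rewrite ord1.
apply: (@C_at_near _ _ _ _ (fun x =>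
    partial (tnth (enum_val b) ord0) (loc1 pf1 (fA X) p (tnth (enum_val b) ord_max)) x -
    partial (tnth (enum_val b) ord_max) (loc1 pf1 (fA X) p (tnth (enum_val b) ord0)) x)).
  by apply: filterE => x; rewrite mxE.
have Cp i j : C_at k (partial i (loc1 pf1 (fA X) p j)) x0.
  have [_ C] : C_at k.+1 (loc1 pf1 (fA X) p j) x0 by exact: C_at_entry (sA k.+1).
  exact: C.
have -> : (fun x => partial (tnth (enum_val b) ord0)
     (loc1 pf1 (fA X) p (tnth (enum_val b) ord_max)) x -
    partial (tnth (enum_val b) ord_max)
     (loc1 pf1 (fA X) p (tnth (enum_val b) ord0)) x) =
   (fun x => partial (tnth (enum_val b) ord0)
     (loc1 pf1 (fA X) p (tnth (enum_val b) ord_max)) x + (-1) *: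
    partial (tnth (enum_val b) ord_max)
     (loc1 pf1 (fA X) p (tnth (enum_val b) ord0)) x).
  by apply/funext => x; rewrite scaleN1r.
apply: C_atD; first exact: Cp.
by apply: C_atM; [exact: C_at_cst|exact: Cp].
Qed.

Lemma differentiable_hA : differentiable hA x0.
Proof. exact: (@C_at1_differentiable _ _ _ 0 _ _ (reg_A hX p 1)). Qed.
Lemma differentiable_hF : differentiable hF x0.
Proof. exact: (@C_at1_differentiable _ _ _ 0 _ _ (smooth_hF 1)). Qed.
Lemma differentiable_hw : differentiable hw x0.
Proof. exact: (@C_at1_differentiable _ _ _ 0 _ _ (reg_w hX p 1)). Qed.
Lemma differentiable_hr : differentiable hr x0.
Proof. exact: (@C_at1_differentiable _ _ _ 0 _ _ (reg_r hX p 1)). Qed.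
Lemma differentiable_hs : differentiable hs x0.
Proof. exact: (@C_at1_differentiable _ _ _ 0 _ _ (reg_s hX p 1)). Qed.
Lemma differentiable_hg : differentiable hg x0.
Proof. exact: (@C_at1_differentiable _ _ _ 0 _ _ (reg_g hX p 1)). Qed.

Lemma differentiable_chart_state : differentiable chart_state x0.
Proof.
apply: differentiable_pair; last exact: differentiable_hg.
apply: differentiable_pair; last exact: differentiable_hs.
apply: differentiable_pair; last exact: differentiable_hr.
apply: differentiable_pair; last exact: differentiable_hw.
apply: differentiable_pair; last exact: differentiable_hF.
exact: differentiable_hA.
Qed.

Lemma near_differentiable_l : \forall x \near x0, differentiable (l p) (chart_state x).
Proof.
have c := differentiable_continuous differentiable_chart_state.
apply: (c [set S | differentiable (l p) S]); rewrite chart_state0.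
by have [d _] := hls p 1.
Qed.

Lemma differentiable_l : differentiable (l p) (lagr_state X p).
Proof. exact: (@C_at1_differentiable _ _ _ 0 _ _ (hls p 1)). Qed.

Lemma lagrangian_in_chart : \forall x \near x0,
  in_chart (@pull_top R n) (fun m => l m (lagr_state X m)) p x = l p (chart_state x).
Proof.
apply: (@near_chart (fun=> True)) => [m pm _|]; last by near=> x.
rewrite in_chartE// lagr_state_pull// lagrangian_chart//; last exact: admissible_chart_state.
rewrite /pull_top mulrA -det_mulmx.
have -> := jacobian_transitionK pm (mdom_self m).
by rewrite det1 mul1r.
Unshelve. all: by end_near. Qed.

Lemma slotF_in_chart : \forall x \near x0,
  in_chart (@pull_mvdens R n 2) (dl_dF l X) p x = slotF (l p) (chart_state x).
Proof.
apply: near_chart near_differentiable_l => m pm dl.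
rewrite in_chartE//; have -> : dl_dF l X m = slotF (l m) (lagr_state X m) by [].
rewrite lagr_state_pull// (slotF_pull (f2 := l p))//; last 3 first.
- exact: det_jacobian_transition.
- exact: admissible_chart_state.
- by move=> S' aS; exact: lagrangian_chart.
rewrite -functorial_mvdens; last 2 first.
- exact: jacobian_transition_unit pm (mdom_self m).
- exact: jacobian_transition_unit (mdom_self m) pm.
have -> := jacobian_transitionK pm (mdom_self m).
by rewrite /pull_mvdens det1 scale1r invmx1 trmx1 act1.
Qed.

(** At each [m] the expression is formed with [l m]. Naturality under the transition map replaces it
    by the expression for [l p] at the chart state, so that all points near [p] are covered by one
    function of the state. *)
Lemma stress_in_chart : \forall x \near x0,
  in_chart (@pull_dens11 R n) (tensor_lagrangian l X) p x =
  stress (l p) (chart_state x).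
Proof.
apply: near_chart near_differentiable_l => m pm dl.
rewrite in_chartE//; have -> : tensor_lagrangian l X m = stress (l m) (lagr_state X m) by [].
rewrite lagr_state_pull// (stress_pull (f2 := l p))//; last 3 first.
- exact: det_jacobian_transition.
- exact: admissible_chart_state.
- by move=> S' aS; exact: lagrangian_chart.
rewrite -functorial_dens11; last 2 first.
- exact: jacobian_transition_unit pm (mdom_self m).
- exact: jacobian_transition_unit (mdom_self m) pm.
have -> := jacobian_transitionK pm (mdom_self m).
by rewrite /pull_dens11 det1 scale1r invmx1 trmx1 mul1mx mulmx1.
Qed.

Lemma differentiable_chart_D v :
  differentiable (fun x => 'D_v (l p) (chart_state x)) x0.
Proof.
have [_ C] := hls p 2.
have D : differentiable ('D_v (l p)) (lagr_state X p).
  exact: (@C_at1_differentiable _ _ _ 0 _ _ (C v)).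
apply: (@differentiable_comp _ _ _ _ chart_state ('D_v (l p))).
  exact: differentiable_chart_state.
by rewrite chart_state0.
Qed.

Lemma differentiable_chart_l : differentiable (fun x => l p (chart_state x)) x0.
Proof.
apply: (@differentiable_comp _ _ _ _ chart_state (l p)).
  exact: differentiable_chart_state.
by rewrite chart_state0; exact: differentiable_l.
Qed.

Lemma differentiable_coef (d : nat) (f : 'rV[R]_n.+1 -> tensor R n d) x I :
  differentiable f x -> differentiable (fun y => coef (f y) I) x.
Proof. exact: differentiable_entry. Qed.

Lemma differentiable_coef2_slotF i j :
  differentiable (fun x => coef2 (slotF (l p) (chart_state x)) i j) x0.
Proof.
have -> : (fun x => coef2 (slotF (l p) (chart_state x)) i j) =
    (fun x => 'D_(0, wedge_basis R [tuple i; j], 0, 0, 0, 0) (l p) (chart_state x)).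
  by apply/funext => x; exact: coef_slotF.
exact: differentiable_chart_D.
Qed.

Lemma differentiable_stress : differentiable (fun x => stress (l p) (chart_state x)) x0.
Proof.
apply: differentiable_mx => i j.
have -> : (fun x => stress (l p) (chart_state x) i j) = (fun x =>
  (l p (chart_state x) - hr x * 'D_(0, 0, 0, 1, 0, 0) (l p) (chart_state x)
   - hs x * 'D_(0, 0, 0, 0, 1, 0) (l p) (chart_state x)) * (1%:M : 'M[R]_n.+1) i j
  + coef (hw x) [tuple i] * 'D_(0, 0, wedge_basis R [tuple j], 0, 0, 0) (l p) (chart_state x)
  - 'D_(wedge_basis R [tuple i], 0, 0, 0, 0, 0) (l p) (chart_state x) * coef (hA x) [tuple j]
  - \sum_k 'D_(0, wedge_basis R [tuple i; k], 0, 0, 0, 0) (l p) (chart_state x) *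
      coef (hF x) [tuple j; k]).
  apply/funext => x; rewrite -slotrE -slotsE -coef_slotw -coef_slotA.
  transitivity ((l p (chart_state x) - hr x * slotr (l p) (chart_state x)
   - hs x * slots (l p) (chart_state x)) * (1%:M : 'M[R]_n.+1) i j
  + coef (hw x) [tuple i] * coef (slotw (l p) (chart_state x)) [tuple j]
  - coef (slotA (l p) (chart_state x)) [tuple i] * coef (hA x) [tuple j]
  - \sum_k coef (slotF (l p) (chart_state x)) [tuple i; k] * coef (hF x) [tuple j; k]).
    rewrite /stress /= /stress_mx mxB mxB mxD mxZ trtens2E !trtens1E; exact: erefl.
  by congr (_ - _); apply: eq_bigr => k _; rewrite coef_slotF.
have dw := differentiable_coef [tuple i] differentiable_hw.
have dA := differentiable_coef [tuple j] differentiable_hA.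
apply: differentiableB; last first.
  apply: differentiable_sumf => k; apply: differentiableM.
    exact: differentiable_chart_D.
  exact: (differentiable_coef _ differentiable_hF).
apply: differentiableB; last by apply: differentiableM => //; exact: differentiable_chart_D.
apply: differentiableD; last by apply: differentiableM => //; exact: differentiable_chart_D.
apply: differentiableM => //.
apply: differentiableB; last first.
  by apply: differentiableM; [exact: differentiable_hs|exact: differentiable_chart_D].
apply: differentiableB; last first.
  by apply: differentiableM; [exact: differentiable_hr|exact: differentiable_chart_D].
exact: differentiable_chart_l.
Qed.

End LagrangianInChart.

(** * Sums and derivatives of six-tuples *)

Section ProductSums.
Context {R : realType} {V1 V2 V3 V4 V5 V6 : normedModType R}.

Lemma tuple6_sum m (f1 : 'I_m -> V1) (f2 : 'I_m -> V2) (f3 : 'I_m -> V3)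
    (f4 : 'I_m -> V4) (f5 : 'I_m -> V5) (f6 : 'I_m -> V6) (z : 'I_m -> R) :
  \sum_k z k *: (f1 k, f2 k, f3 k, f4 k, f5 k, f6 k) =
  (\sum_k z k *: f1 k, \sum_k z k *: f2 k, \sum_k z k *: f3 k,
   \sum_k z k *: f4 k, \sum_k z k *: f5 k, \sum_k z k *: f6 k).
Proof.
elim: m f1 f2 f3 f4 f5 f6 z => [|m IH] f1 f2 f3 f4 f5 f6 z.
  by rewrite !big_ord0.
by rewrite !big_ord_recl IH.
Qed.

Lemma tuple6D (a1 b1 : V1) (a2 b2 : V2) (a3 b3 : V3) (a4 b4 : V4) (a5 b5 : V5)
    (a6 b6 : V6) : (a1, a2, a3, a4, a5, a6) + (b1, b2, b3, b4, b5, b6) =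
  (a1 + b1, a2 + b2, a3 + b3, a4 + b4, a5 + b5, a6 + b6).
Proof. by []. Qed.

Lemma tuple6_scale y (a1 : V1) (a2 : V2) (a3 : V3) (a4 : V4) (a5 : V5) (a6 : V6) :
  y *: (a1, a2, a3, a4, a5, a6) =
  (y *: a1, y *: a2, y *: a3, y *: a4, y *: a5, y *: a6).
Proof. by []. Qed.

Lemma tuple6_split (a1 : V1) (a2 : V2) (a3 : V3) (y4 : R) (b4 : V4) (y5 : R) (b5 : V5) :
  (a1, a2, a3, y4 *: b4, y5 *: b5, 0 : V6) =
  (a1, 0, 0, 0, 0, 0) + (0, a2, 0, 0, 0, 0) + (0, 0, a3, 0, 0, 0)
  + y4 *: (0, 0, 0, b4, 0, 0) + y5 *: (0, 0, 0, 0, b5, 0).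
Proof.
have Z4 : y4 *: (0, 0, 0, b4, 0, 0) = (0, 0, 0, y4 *: b4, 0, 0) :> V1 * V2 * V3 * V4 * V5 * V6.
  by rewrite -[LHS]addr0 [LHS]tuple6_line !scaler0 !addr0.
have Z5 : y5 *: (0, 0, 0, 0, b5, 0) = (0, 0, 0, 0, y5 *: b5, 0) :> V1 * V2 * V3 * V4 * V5 * V6.
  by rewrite -[LHS]addr0 [LHS]tuple6_line !scaler0 !addr0.
by rewrite Z4 Z5 !tuple6D !addr0 !add0r.
Qed.

Lemma is_derive_tuple6 (U : normedModType R) (x v : U) (f1 : U -> V1) (f2 : U -> V2)
    (f3 : U -> V3) (f4 : U -> V4) (f5 : U -> V5) (f6 : U -> V6) d1 d2 d3 d4 d5 d6 :
  is_derive x v f1 d1 -> is_derive x v f2 d2 -> is_derive x v f3 d3 ->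
  is_derive x v f4 d4 -> is_derive x v f5 d5 -> is_derive x v f6 d6 ->
  is_derive x v (fun y => (f1 y, f2 y, f3 y, f4 y, f5 y, f6 y))
    (d1, d2, d3, d4, d5, d6).
Proof. by move=> *; do 5 (apply: is_derive_pair => //). Qed.

Lemma derive_comp_dir (U W : normedModType R) (f : U -> V1) (h : V1 -> W) x v :
  differentiable f x -> differentiable h (f x) ->
  'D_v (fun y => h (f y)) x = 'd h (f x) ('D_v f x).
Proof.
move=> df dh; rewrite (deriveE v df) deriveE; last exact: differentiable_comp.
by rewrite (diff_comp df dh).
Qed.

Lemma is_derive_affine2 (a b c : V1) :
  is_derive (0 : R) (1 : R) (fun t : R => a + t *: b + (t * t) *: c) b.
Proof.
have d1 := is_derive_affine1 a b 0.
have d2 : is_derive (0 : R) (1 : R) (fun t : R => t * t) 0.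
  by apply: (is_derive_at0 (a := 0) (e := 1)); apply/funext => t; ring.
have := is_deriveD d1 (is_derive_Zl c d2).
by rewrite scale0r addr0.
Qed.

End ProductSums.

(** * Differentiating covariance under the linear group *)

Section InfinitesimalAction.
Context {R : realType} {n : nat}.
Implicit Types (i j k : 'I_n.+1) (K G g : 'M[R]_n.+1).
Local Notation T1 := (tensor R n 1).
Local Notation T2 := (tensor R n 2).

(** The first-order term in [t] of [act (1%:M + t *: K)] on rank two tensors. *)
Definition ad K (F : T2) : T2 := mktensor2 (fun i j =>
  \sum_k K i k * coef2 F k j + \sum_k K j k * coef2 F i k).

Lemma mat_ad K F : mat (ad K F) = K *m mat F + mat F *m K^T.
Proof.
apply/matrixP => i j; rewrite mxE coef2_mktensor2 !mxE; congr (_ + _).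
  by apply: eq_bigr => k _; rewrite mxE.
by apply: eq_bigr => k _; rewrite !mxE mulrC.
Qed.

Lemma matD (s t : T2) : mat (s + t) = mat s + mat t.
Proof. by apply/matrixP => i j; rewrite !mxE coef2D. Qed.

Lemma matZ a (t : T2) : mat (a *: t) = a *: mat t.
Proof. by apply/matrixP => i j; rewrite !mxE coef2Z. Qed.

Lemma conj_affine (Y K : 'M[R]_n.+1) t :
  (1%:M + t *: K) *m Y *m (1%:M + t *: K)^T =
  Y + t *: (K *m Y + Y *m K^T) + (t * t) *: (K *m Y *m K^T).
Proof.
rewrite linearD linearZ /= trmx1 !mulmxDl !mulmxDr !mul1mx !mulmx1.
rewrite -!scalemxAl -!scalemxAr scalerA scalerDr -!addrA.
by congr (_ + _); rewrite addrCA.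
Qed.

Lemma act_affine1 K (A : T1) t : act (1%:M + t *: K) A = A + t *: act K A.
Proof.
apply: tensor1P => i; rewrite coef1_act coef1D coef1Z coef1_act big_distrr /=.
under eq_bigr do rewrite mxD mxZ mulrDl.
rewrite big_split /=; congr (_ + _); last by apply: eq_bigr => j _; rewrite mulrA.
under eq_bigr do rewrite mxE eq_sym.
exact: sum_delta.
Qed.

Lemma act_affine2 K (F : T2) t :
  act (1%:M + t *: K) F = F + t *: ad K F + (t * t) *: act K F.
Proof.
by apply: mat_inj; rewrite mat_act conj_affine !matD !matZ mat_ad mat_act.
Qed.

(** The matrix is lower or upper triangular, and transposition reduces the second case to the
    first. *)
Lemma det_elementary (a b : 'I_n.+1) (t : R) :
  \det (1%:M + t *: delta_mx a b : 'M[R]_n.+1) = 1 + t * (a == b)%:R.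
Proof.
wlog ab : a b / (b <= a)%N => [W|].
  case: (leqP b a) => [/W//|/ltnW ab].
  by rewrite -det_tr linearD linearZ /= trmx1 trmx_delta W// eq_sym.
rewrite det_trig.
  rewrite (bigD1 a)//= big1 => [|i ia]; rewrite !mxE.
    by rewrite !eqxx mulr1 /= eq_sym.
  by rewrite eqxx (negbTE ia) mulr0 addr0.
apply/is_trig_mxP => i j ij; rewrite !mxE.
have -> : (i == j) = false by rewrite -val_eqE /= ltn_eqF.
rewrite add0r; case: eqP => [ia|_]; last by rewrite mulr0.
case: eqP => [jb|_]; last by rewrite mulr0.
by move: ij; rewrite ia jb ltnNge ab.
Qed.

Variables (f : lagr_arg R n -> R) (A : T1) (F : T2) (w : T1) (r s : R)
  (g : 'M[R]_n.+1).
Local Notation S := (A, F, w, r, s, g).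
Hypothesis aS : admissible S.
Hypothesis df : differentiable f S.
Hypothesis cov : forall G S', 0 < \det G -> admissible S' ->
  f (pull_state G S') = \det G * f S'.

(** The derivative at [t = 0] of the pull-back of the state by [1%:M + t *: K]. The vector [w]
    transforms by the transposed inverse, hence the sign of its component. *)
Definition generator K : lagr_arg R n :=
  (act K A, ad K F, - act K^T w, \tr K * r, \tr K * s, K *m g + g *m K^T).

Lemma generator_linear y K K' :
  generator (y *: K + K') = y *: generator K + generator K'.
Proof.
rewrite [RHS]tuple6_line; congr (_, _, _, _, _, _).
- apply: tensor1P => i; rewrite coef1D coef1Z !coef1_act big_distrr -big_split.
  by apply: eq_bigr => j _ /=; rewrite mxD mxZ mulrDl mulrA.
- by apply: mat_inj; rewrite matD matZ !mat_ad linearD linearZ /= mulmxDl mulmxDr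
    -scalemxAl -scalemxAr scalerDr addrACA.
- apply: tensor1P => i; rewrite coef1D coef1Z !coef1N !coef1_act -!sumrN.
  rewrite big_distrr -big_split.
  by apply: eq_bigr => j _; rewrite /= !mxE; ring.
- by rewrite mxtraceD mxtraceZ mulrDl -[y *: _]/(y * _) mulrA.
- by rewrite mxtraceD mxtraceZ mulrDl -[y *: _]/(y * _) mulrA.
- by rewrite linearD linearZ /= mulmxDl mulmxDr -scalemxAl -scalemxAr scalerDr addrACA.
Qed.

(** For elementary matrices the determinant is the explicit function [1 + t * e], which spares the
    derivative of a general determinant; linearity in [K] does the rest. *)
Lemma generator_elementary (a b : 'I_n.+1) :
  'd f S (generator (delta_mx a b)) = \tr (delta_mx a b : 'M[R]_n.+1) * f S.
Proof.
have [aF lg tw] := aS.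
pose K : 'M[R]_n.+1 := delta_mx a b; pose e : R := (a == b)%:R.
have trK : \tr K = e.
  rewrite /mxtrace (bigD1 a)//= big1 => [|i ia]; rewrite mxE ?eqxx ?addr0//=.
  by rewrite (negbTE ia).
rewrite -/K trK.
(* The pull-back of [g2 t] by [1%:M + t *: K] is [g1 t], for small [t]. Moving [w] in [g2]
   beforehand makes its pull-back constant, so that no matrix inverse has to be differentiated and
   both curves are polynomial. *)
pose g1 (t : R) : lagr_arg R n := (A + t *: act K A,
  F + t *: ad K F + (t * t) *: act K F, w, r + t *: (e * r), s + t *: (e * s),
  g + t *: (K *m g + g *m K^T) + (t * t) *: (K *m g *m K^T)).
pose g2 (t : R) : lagr_arg R n := (A, F, w + t *: act K^T w, r, s, g).
have g10 : g1 0 = S by rewrite /g1 mulr0 !scale0r !addr0.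
have g20 : g2 0 = S by rewrite /g2 scale0r addr0.
have D1 : is_derive (0 : R) (1 : R) g1
    (act K A, ad K F, 0, e * r, e * s, K *m g + g *m K^T).
  apply: is_derive_tuple6.
  - exact: is_derive_affine1.
  - exact: is_derive_affine2.
  - exact: is_derive_affine1.
  - exact: is_derive_affine1.
  - exact: is_derive_affine2.
have D2 : is_derive (0 : R) (1 : R) g2 (0, 0, act K^T w, 0, 0, 0).
  by apply: is_derive_tuple6; try exact: is_derive_cst; exact: is_derive_affine1.
have df1 : differentiable f (g1 0) by rewrite g10.
have df2 : differentiable f (g2 0) by rewrite g20.
have [d1 E1] := is_derive_curve df1 D1.
have [d2 E2] := is_derive_curve df2 D2.
have E3 : 'D_1 (fun t => f (g1 t)) 0 = 'D_1 (fun t : R => (1 + t * e) * f (g2 t)) 0.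
  apply: near_eq_derive.
  have te : \forall t \near (0 : R), 0 < 1 + t * e.
    have c : {for (0 : R), continuous (fun t : R => 1 + t * e)}.
      by apply: cvgD; [exact: cvg_cst|apply: cvgM; [exact: cvg_id|exact: cvg_cst]].
    by apply: (cvgr_gt _ c); rewrite mul0r addr0.
  move: te (near_timelike lg tw (act K^T w)); apply: filterS2 => t te tt.
  pose G : 'M[R]_n.+1 := 1%:M + t *: K.
  have dG : \det G = 1 + t * e by exact: det_elementary.
  have Gu : G \in unitmx by rewrite unitmxE unitfE dG gt_eqF.
  have d0 : 0 < \det G by rewrite dG.
  have aS2 : admissible (g2 t) by split.
  rewrite -dG -(cov d0 aS2); congr (f _); rewrite /g1 /g2 /pull_state.
  congr (_, _, _, _, _, _).
  - by rewrite /pull_form act_affine1.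
  - by rewrite /pull_form act_affine2.
  - have -> : w + t *: act K^T w = act G^T w.
      by rewrite /G linearD linearZ /= trmx1 act_affine1.
    by rewrite /pull_vec -actM -trmx_mul mulmxV// trmx1 act1.
  - by rewrite /pull_top dG -[t *: _]/(t * _); ring.
  - by rewrite /pull_top dG -[t *: _]/(t * _); ring.
  - by rewrite /pull_metric conj_affine.
have E4 : 'D_1 (fun t : R => (1 + t * e) * f (g2 t)) 0 =
    e * f S + 'd f S (0, 0, act K^T w, 0, 0, 0).
  have d3 : is_derive (0 : R) (1 : R) (fun t : R => 1 + t * e) e.
    by have := is_derive_affine1 (1 : R) e 0.
  have [_ E5] := is_deriveM d3 (DeriveDef d2 E2).
  transitivity ((1 + 0 * e) *: 'd f (g2 0) (0, 0, act K^T w, 0, 0, 0) + f (g2 0) *: e).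
    exact: E5.
  by rewrite mul0r addr0 scale1r g20 addrC -[f S *: e]/(f S * e) mulrC.
rewrite E1 E4 g10 in E3.
have -> : generator K = (act K A, ad K F, 0, e * r, e * s, K *m g + g *m K^T)
    + (-1) *: (0, 0, act K^T w, 0, 0, 0).
  rewrite addrC [RHS]tuple6_line !scaler0 !add0r addr0 scaleN1r /generator trK.
  exact: erefl.
have DD u v : 'd f S (u + v) = 'd f S u + 'd f S v by rewrite linearD.
have DZ y v : 'd f S (y *: v) = y * 'd f S v by rewrite linearZ.
by rewrite DD DZ E3 mulN1r addrK.
Qed.

(** When K is the connection matrix of Z, the last component of [generator K] is the
    derivative of g along Z, so that this identity eliminates df/dg. *)
Lemma generatorE K : 'd f S (generator K) = \tr K * f S.
Proof.
have DD u v : 'd f S (u + v) = 'd f S u + 'd f S v by rewrite linearD.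
have DZ y v : 'd f S (y *: v) = y * 'd f S v by rewrite linearZ.
have G0 : generator 0 = 0.
  by have := generator_linear (-1) 0 0; rewrite scaler0 addr0 scaleN1r addNr.
have H y K1 K2 : 'd f S (generator K1) = \tr K1 * f S ->
    'd f S (generator K2) = \tr K2 * f S ->
    'd f S (generator (y *: K1 + K2)) = \tr (y *: K1 + K2) * f S.
  by move=> H1 H2; rewrite generator_linear DD DZ H1 H2 linearD linearZ /=; ring.
have H0 : 'd f S (generator 0) = \tr (0 : 'M[R]_n.+1) * f S.
  by rewrite G0 linear0 mxtrace0 mul0r.
rewrite (matrix_sum_delta K).
elim/big_ind: _ => [|K1 K2 H1 H2|i _]; first exact: H0.
  by rewrite -[K1]scale1r; exact: H.
elim/big_ind: _ => [|K1 K2 H1 H2|j _]; first exact: H0.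
  by rewrite -[K1]scale1r; exact: H.
rewrite -[_ *: _]addr0; apply: H; [exact: generator_elementary|exact: H0].
Qed.

End InfinitesimalAction.

(** * Commutation of [d] with the Lie derivative, and metric compatibility *)

Section CurlOfLie.
Context {R : realType} {N : nat}.
Implicit Types (i j k : 'I_N).

Lemma partialC i j (f : 'rV[R]_N -> R) x : C_at 2 f x ->
  partial i (partial j f) x = partial j (partial i f) x.
Proof.
move=> Cf; have [df _] := Cf.
apply: derive_comm; first exact: df.
  exact: (@C_at2_differentiable _ _ _ 0 f).
exact: (@C_at2_differentiable _ _ _ 0 f).
Qed.

(** By symmetry of second derivatives, those of [Z] cancel and those of [A] combine into derivatives
    of the curl [F]; the remaining products of first derivatives form the Lie derivative of [F]. *)
Lemma curl_lie (A Z : 'I_N -> 'rV[R]_N -> R) x i j :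
  (forall k, C_at 2 (A k) x) -> (forall k, C_at 2 (Z k) x) ->
  let F i j y := partial i (A j) y - partial j (A i) y in
  partial i (fun y => \sum_k (Z k y * partial k (A j) y + A k y * partial j (Z k) y)) x
  - partial j (fun y => \sum_k (Z k y * partial k (A i) y + A k y * partial i (Z k) y)) x
  = \sum_k Z k x * partial k (F i j) x
    + (\sum_k partial i (Z k) x * F k j x + \sum_k partial j (Z k) x * F i k x).
Proof.
move=> CA CZ F.
have dA k : differentiable (A k) x by exact: (@C_at1_differentiable _ _ _ 1 (A k)).
have dZ k : differentiable (Z k) x by exact: (@C_at1_differentiable _ _ _ 1 (Z k)).
have ddA k l : differentiable (partial l (A k)) x.
  exact: (@C_at2_differentiable _ _ _ 0 (A k)).
have ddZ k l : differentiable (partial l (Z k)) x.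
  exact: (@C_at2_differentiable _ _ _ 0 (Z k)).
have E a b : partial a (fun y => \sum_k (Z k y * partial k (A b) y + A k y * partial b (Z k) y)) x
  = \sum_k (partial a (Z k) x * partial k (A b) x + Z k x * partial a (partial k (A b)) x
     + (partial a (A k) x * partial b (Z k) x + A k x * partial a (partial b (Z k)) x)).
  rewrite partial_sum => [|k]; last by apply: differentiableD; exact: differentiableM.
  by apply: eq_bigr => k _; rewrite partialD ?partialM//; exact: differentiableM.
rewrite !E -sumrB -!big_split; apply: eq_bigr => k _ /=.
have -> : partial k (F i j) x = partial k (partial i (A j)) x - partial k (partial j (A i)) x.
  exact: partialB.
have alg (a1 b1 z c1 d1 e1 y h1 b2 c2 d2 h2 c1' c2' : R) :
    c1 = c1' -> c2 = c2' -> h1 = h2 ->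
    a1 * b1 + z * c1 + (d1 * e1 + y * h1) - (e1 * b2 + z * c2 + (d2 * a1 + y * h2)) =
    z * (c1' - c2') + (a1 * (b1 - d2) + e1 * (d1 - b2)).
  by move=> -> -> ->; ring.
exact: alg (partialC i k (CA j)) (partialC j k (CA i)) (partialC i j (CZ k)).
Qed.

End CurlOfLie.

(** Multiplication by [g] lowers the upper index of the Christoffel symbol. Adding the transpose
    symmetrizes in [i] and [b], and only the derivative of the metric in direction [j] survives. *)
Lemma metric_compatible (R : realType) n (g : 'M[R]_n.+1) (dg : 'I_n.+1 -> 'M[R]_n.+1)
    (z : 'I_n.+1 -> R) : g^T = g -> g \in unitmx -> (forall a, (dg a)^T = dg a) ->
  let K := \matrix_(i, k) \sum_j (2^-1 * \sum_d invmx g k d *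
      (dg i d j + dg j d i - dg d i j)) * z j in
  K *m g + g *m K^T = \sum_a z a *: dg a.
Proof.
move=> gs gu ds K.
have dsE a i j : dg a i j = dg a j i by rewrite -{1}(ds a) mxE.
have Kg i b : (K *m g) i b =
    \sum_j (2^-1 * (dg i b j + dg j b i - dg b i j)) * z j.
  rewrite mxE; under eq_bigr do rewrite mxE big_distrl /=.
  rewrite exchange_big; apply: eq_bigr => j _ /=.
  transitivity (\sum_d (2^-1 * (dg i d j + dg j d i - dg d i j) * z j) *
     \sum_k invmx g d k * g k b).
    under [LHS]eq_bigr do rewrite big_distrr big_distrl big_distrl /=.
    rewrite exchange_big; apply: eq_bigr => d _ /=; rewrite big_distrr.
    apply: eq_bigr => k _ /=.
    have -> : invmx g k d = invmx g d k by rewrite -{1}(trmx_invmx_sym gs) mxE.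
    ring.
  transitivity (\sum_d (d == b)%:R * (2^-1 * (dg i d j + dg j d i - dg d i j) * z j)).
    apply: eq_bigr => d _; rewrite mulrC; congr (_ * _).
    have := mulVmx gu => /matrixP/(_ d b); rewrite !mxE => <-.
    by [].
  exact: sum_delta.
apply/matrixP => i b; rewrite mxD.
have -> : g *m K^T = (K *m g)^T by rewrite trmx_mul gs.
rewrite [X in _ + X]mxE !Kg -big_split summxE; apply: eq_bigr => j _ /=.
rewrite mxZ (dsE i b j) (dsE b i j) (dsE j i b).
by field.
Qed.

(** * The differential of the Lagrangian and its contraction with expression (i) *)

Section Expansion.
Context {R : realType} {n : nat}.
Implicit Types (i j k : 'I_n.+1) (Q g : 'M[R]_n.+1).
Local Notation T1 := (tensor R n 1).
Local Notation T2 := (tensor R n 2).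
Variables (f : lagr_arg R n -> R) (A : T1) (F : T2) (w : T1) (r s : R)
  (g : 'M[R]_n.+1).
Local Notation S := (A, F, w, r, s, g).
Hypothesis altF : alternating F.
Hypothesis df : differentiable f S.

Lemma contr_slotA v : contr (slotA f S) v = 'd f S (v, 0, 0, 0, 0, 0).
Proof.
have d := differentiable_tuple6_1 df.
rewrite contr_pderiv//; last exact: alternating1.
rewrite -deriveE// -deriveE//; apply: (derive_embed f (emb := fun A => (A, F, w, r, s, g))) => t.
exact: tuple6_line1.
Qed.

Lemma contr_slotF v : alternating v -> contr (slotF f S) v = 'd f S (0, v, 0, 0, 0, 0).
Proof.
have d := differentiable_tuple6_2 df.
move=> av; rewrite contr_pderiv//.
rewrite -deriveE// -deriveE//; apply: (derive_embed f (emb := fun F => (A, F, w, r, s, g))) => t.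
exact: tuple6_line2.
Qed.

Lemma contr_slotw v : contr (slotw f S) v = 'd f S (0, 0, v, 0, 0, 0).
Proof.
have d := differentiable_tuple6_3 df.
rewrite contr_pderiv//; last exact: alternating1.
rewrite -deriveE// -deriveE//; apply: (derive_embed f (emb := fun w => (A, F, w, r, s, g))) => t.
exact: tuple6_line3.
Qed.

Lemma alternating_slotF : alternating (slotF f S).
Proof. by apply: alternating_pderiv; exact: (differentiable_tuple6_2 df). Qed.

Lemma differential_slots a1 a2 a3 a4 a5 : alternating a2 ->
  'd f S (a1, a2, a3, a4, a5, 0) =
  contr (slotA f S) a1 + contr (slotF f S) a2 + contr (slotw f S) a3
  + a4 * slotr f S + a5 * slots f S.
Proof.
move=> aa; rewrite contr_slotA contr_slotF// contr_slotw slotrE slotsE.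
have DD u v : 'd f S (u + v) = 'd f S u + 'd f S v by rewrite linearD.
have DZ y v : 'd f S (y *: v) = y * 'd f S v by rewrite linearZ.
rewrite (deriveE _ df) (deriveE _ df) -!DZ -!DD; congr ('d f S _).
have := tuple6_split a1 a2 a3 a4 (1 : R) a5 (1 : R) (V6 := 'M[R]_n.+1).
by rewrite -[a4 *: 1]/(a4 * 1) -[a5 *: 1]/(a5 * 1) !mulr1.
Qed.

(** The infinitesimal action of [Q] on all arguments except the metric. *)
Definition generator0 Q : lagr_arg R n :=
  (act Q A, ad Q F, - act Q^T w, \tr Q * r, \tr Q * s, 0).

Lemma alternating_ad Q : alternating (ad Q F).
Proof.
apply: alternating2P => i j; rewrite !coef2_mktensor2 opprD addrC.
by congr (_ + _); rewrite -sumrN; apply: eq_bigr => k _;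
  rewrite (alternating2 _ _ altF) mulrN.
Qed.

(** Expression (i) originates here: it is the array of coefficients of [Q] when every field but the
    metric is moved by [Q], with the trace term of the density [f] split off. *)
Lemma generator0E Q :
  'd f S (generator0 Q) = \tr Q * f S - \sum_i \sum_k stress f S i k * Q i k.
Proof.
rewrite differential_slots; last exact: alternating_ad.
have trE : \sum_i \sum_k (1%:M : 'M[R]_n.+1) i k * Q i k = \tr Q.
  rewrite /mxtrace; apply: eq_bigr => i _.
  under eq_bigr do rewrite mxE eq_sym.
  exact: sum_delta.
have -> : \sum_i \sum_k stress f S i k * Q i k =
    (f S - r * slotr f S - s * slots f S) * \tr Q
    + \sum_i \sum_k coef1 w i * coef1 (slotw f S) k * Q i k
    - \sum_i \sum_k coef1 (slotA f S) i * coef1 A k * Q i k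
    - \sum_i \sum_k (\sum_j coef2 (slotF f S) i j * coef2 F k j) * Q i k.
  rewrite -trE big_distrr -big_split -!sumrB; apply: eq_bigr => i _ /=.
  rewrite big_distrr -big_split -!sumrB; apply: eq_bigr => k _ /=.
  rewrite -trtens1E -trtens1E -trtens2E /stress /stress_mx !mxB mxD mxZ.
  have alg (a b d e y z : R) :
    (a * b + d - e - y) * z = a * (b * z) + d * z - e * z - y * z by ring.
  exact: alg.
have -> : contr (slotA f S) (act Q A) =
    \sum_i \sum_k coef1 (slotA f S) i * coef1 A k * Q i k.
  rewrite contr1E; apply: eq_bigr => i _; rewrite coef1_act big_distrr /=.
  by apply: eq_bigr => k _; ring.
have -> : contr (slotw f S) (- act Q^T w) =
    - \sum_i \sum_k coef1 w i * coef1 (slotw f S) k * Q i k.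
  rewrite contr1E exchange_big -sumrN; apply: eq_bigr => k _ /=.
  rewrite coef1N coef1_act mulrN big_distrr; congr (- _).
  by apply: eq_bigr => i _ /=; rewrite mxE; ring.
have -> : contr (slotF f S) (ad Q F) =
    \sum_i \sum_k (\sum_j coef2 (slotF f S) i j * coef2 F k j) * Q i k.
  have aF := alternating_slotF.
  set Y := RHS.
  have E1 : \sum_i \sum_j coef2 (slotF f S) i j * \sum_k Q i k * coef2 F k j = Y.
    apply: eq_bigr => i _; under eq_bigr do rewrite big_distrr /=.
    rewrite exchange_big; apply: eq_bigr => k _ /=; rewrite big_distrl.
    by apply: eq_bigr => j _ /=; ring.
  have E2 : \sum_i \sum_j coef2 (slotF f S) i j * \sum_k Q j k * coef2 F i k = Y.
    rewrite -E1 exchange_big; apply: eq_bigr => i _; apply: eq_bigr => j _ /=.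
    rewrite (alternating2 _ _ aF) mulNr -mulrN -sumrN; congr (_ * _).
    by apply: eq_bigr => k _; rewrite (alternating2 _ _ altF) mulrN opprK.
  rewrite /contr sum_tuple2.
  (* Since [F] and the derivative in [F] are antisymmetric, both terms of [ad] contribute [Y], which
     cancels the factor 1/2 of [contr]. *)
  transitivity (2^-1 * (Y + Y)); last by field.
  congr (_ * _); rewrite -{1}E1 -E2 -big_split; apply: eq_bigr => i _.
  rewrite -big_split; apply: eq_bigr => j _ /=; rewrite -mulrDr.
  by rewrite -[coef (ad Q F) _]/(coef2 (ad Q F) i j) coef2_mktensor2.
ring.
Qed.

End Expansion.

(** * The first variation *)

Section Variation.
Context {R : realType} {n : nat} (M : oriented_manifold R n.+1).
Implicit Types (m : M) (i j k : 'I_n.+1) (x : 'rV[R]_n.+1).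
Variables (l : lagrangian M) (X : fluid_fields M).
Hypothesis hl : covariant_lagrangian l.
Hypothesis hX : regular_fields X.
Hypothesis hls : forall p, smooth_at (l p) (lagr_state X p).
Variable p : M.
Local Notation x0 := (mchart p p).
Local Notation pf1 := (@pull_form R n 1).
Local Notation pf2 := (@pull_form R n 2).
Local Notation pv := (@pull_vec R n).
Local Notation hA := (in_chart pf1 (fA X) p).
Local Notation hF := (in_chart pf2 (fF X) p).
Local Notation hw := (in_chart pv (fw X) p).
Local Notation hr := (in_chart (@pull_top R n : _ -> R -> R) (fr X) p).
Local Notation hs := (in_chart (@pull_top R n : _ -> R -> R) (fs X) p).
Local Notation hg := (in_chart (@pull_metric R n) (fg X) p).
Local Notation S0 := (lagr_state X p).
Local Notation e k := (delta_mx ord0 k : 'rV[R]_n.+1).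
Local Notation f := (l p).

Section Fields.
Variables Z a : M -> tensor R n 1.
Hypothesis sZ : smooth_field_at pv Z p.
Hypothesis sa : smooth_field_at pf1 a p.
Local Notation z k := (coef1 (Z p) k).

Definition grad : 'M[R]_n.+1 := \matrix_(i, k) partial i (loc1 pv Z p k) x0.

(** The connection terms of the covariant derivative of [Z]: [grad] and [connection] add up to the
    matrix of that derivative at [p]. *)
Definition connection : 'M[R]_n.+1 := \matrix_(i, k)
  \sum_j christoffel (fg X) p k i j * z j.

Definition chart_velocity k : lagr_arg R n :=
  ('D_(e k) hA x0, 'D_(e k) hF x0, 'D_(e k) hw x0, 'D_(e k) hr x0, 'D_(e k) hs x0,
   'D_(e k) hg x0).

Lemma chart_velocityE k : partial k (fun x => f (chart_state X p x)) x0 =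
  'd f S0 (chart_velocity k).
Proof.
have dS := differentiable_chart_state hX p.
have dl : differentiable f (chart_state X p x0).
  by rewrite chart_state0; exact: differentiable_l.
rewrite /partial (derive_comp_dir _ dS dl) chart_state0; congr ('d f _ _).
have D : is_derive x0 (e k) (chart_state X p) (chart_velocity k).
  apply: is_derive_tuple6; apply: DeriveDef => //; apply: diff_derivable.
  - exact: differentiable_hA.
  - exact: differentiable_hF.
  - exact: differentiable_hw.
  - exact: differentiable_hr.
  - exact: differentiable_hs.
  - exact: differentiable_hg.
by have [_ ->] := D.
Qed.

Lemma pull_vec1 (v : tensor R n 1) : pv 1%:M v = v.
Proof. by rewrite /pull_vec invmx1 trmx1 act1. Qed.

Lemma pull_form1 (d : nat) (v : tensor R n d) : pull_form 1%:M v = v.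
Proof. exact: act1. Qed.

Lemma loc1_form_base (A : M -> tensor R n 1) i : loc1 pf1 A p i x0 = coef1 (A p) i.
Proof. by rewrite /loc1 in_chart_base//; exact: pull_form1. Qed.

Lemma loc1_vec_base (Y : M -> tensor R n 1) i : loc1 pv Y p i x0 = coef1 (Y p) i.
Proof. by rewrite /loc1 in_chart_base//; exact: pull_vec1. Qed.

Lemma coef1_derive (h : 'rV[R]_n.+1 -> tensor R n 1) x v i :
  differentiable h x -> coef1 ('D_v h x) i = 'D_v (fun y => coef1 (h y) i) x.
Proof. by move=> dh; rewrite /coef1 /coef derive_entry. Qed.

Lemma coef2_derive (h : 'rV[R]_n.+1 -> tensor R n 2) x v i j :
  differentiable h x -> coef2 ('D_v h x) i j = 'D_v (fun y => coef2 (h y) i j) x.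
Proof. by move=> dh; rewrite /coef2 /coef derive_entry. Qed.

Lemma coef1_sum (I : finType) (h : I -> tensor R n 1) i :
  coef1 (\sum_b h b) i = \sum_b coef1 (h b) i.
Proof. exact: coef_sum. Qed.

Lemma coef2_sum (I : finType) (h : I -> tensor R n 2) i j :
  coef2 (\sum_b h b) i j = \sum_b coef2 (h b) i j.
Proof. exact: coef_sum. Qed.

Let dZ : differentiable (in_chart pv Z p) x0.
Proof. exact: (@C_at1_differentiable _ _ _ 0 _ _ (sZ 1)). Qed.
Let da : differentiable (in_chart pf1 a p) x0.
Proof. exact: (@C_at1_differentiable _ _ _ 0 _ _ (sa 1)). Qed.

Local Notation dA := (fun m => a m - lie_form Z (fA X) m).

(** The transport term that arises from varying the domain cancels the derivatives of the field in
    the Lie derivative, and only the terms algebraic in the gradient of [Z] remain. The same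
    mechanism serves for the other fields. *)
Lemma variation_A :
  dA p + \sum_k z k *: 'D_(e k) hA x0 = a p - act grad (fA X p).
Proof.
apply: tensor1P => i; rewrite !coef1D !coef1N coef1_sum coef1_mktensor1 coef1_act.
rewrite -addrA; congr (_ + _).
rewrite big_split /= opprD -addrA addrC -addrA.
have -> : \sum_k coef1 (z k *: 'D_(e k) hA x0) i =
    \sum_k z k * pd k (loc1 pf1 (fA X) p i) p.
  apply: eq_bigr => k _; rewrite coef1Z coef1_derive//.
  exact: differentiable_hA.
rewrite subrr addr0; congr (- _); apply: eq_bigr => k _.
by rewrite mxE mulrC.
Qed.

Lemma near_loc1_variation j : \forall x \near x0,
  loc1 pf1 dA p j x = loc1 pf1 a p j x -
    \sum_k (loc1 pv Z p k x * partial k (loc1 pf1 (fA X) p j) x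
    + loc1 pf1 (fA X) p k x * partial j (loc1 pv Z p k) x).
Proof.
have [nA _] : C_at 1 hA x0 := reg_A hX p 1.
have [nZ _] := sZ 1.
have nAZ : \forall x \near x0, differentiable hA x /\ differentiable (in_chart pv Z p) x.
  by apply: filterS2 nA nZ => x.
apply: near_chart nAZ => m pm [dAm dZm].
rewrite -lie_form_in_chart// /loc1 !in_chartE//.
by rewrite /pull_form -[lie_form Z (fA X) m]scale1r -scaleNr actZD coef1D coef1Z
  mulN1r scale1r.
Qed.

Lemma coef1_C_at (h : 'rV[R]_n.+1 -> tensor R n 1) (r : nat) x i :
  C_at r h x -> C_at r (fun y => coef1 (h y) i) x.
Proof. exact: C_at_entry. Qed.

Lemma near_hF : \forall x \near x0, forall i j, coef2 (hF x) i j =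
  partial i (loc1 pf1 (fA X) p j) x - partial j (loc1 pf1 (fA X) p i) x.
Proof.
have [nA _] : C_at 1 hA x0 := reg_A hX p 1.
apply: near_chart nA => m pm dAm i j.
by rewrite ext_d_in_chart// coef2_mktensor2.
Qed.

(** The variation of [F] is the exterior derivative of the variation of [A], so
    [near_loc1_variation] provides the latter on a neighbourhood, and [curl_lie] brings the result
    to the form of a Lie derivative of [F]. *)
Lemma variation_F :
  ext_d dA p + \sum_k z k *: 'D_(e k) hF x0 = ext_d a p - ad grad (fF X p).
Proof.
apply: tensor2P => i j; rewrite !coef2D coef2N coef2_sum !coef2_mktensor2.
have CA k : C_at 2 (loc1 pf1 (fA X) p k) x0.
  by apply: coef1_C_at; exact: (reg_A hX p 2).
have CZ k : C_at 2 (loc1 pv Z p k) x0 by apply: coef1_C_at; exact: (sZ 2).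
have dl (b c : 'I_n.+1) : differentiable (fun y => \sum_k (loc1 pv Z p k y *
      partial k (loc1 pf1 (fA X) p c) y
    + loc1 pf1 (fA X) p k y * partial c (loc1 pv Z p k) y)) x0.
  apply: differentiable_sumf => k; apply: differentiableD; apply: differentiableM.
  - exact: (@C_at1_differentiable _ _ _ 1 _ _ (CZ k)).
  - exact: (@C_at2_differentiable _ _ _ 0 _ _ _ (CA c)).
  - exact: (@C_at1_differentiable _ _ _ 1 _ _ (CA k)).
  - exact: (@C_at2_differentiable _ _ _ 0 _ _ _ (CZ k)).
have dac c : differentiable (loc1 pf1 a p c) x0 by exact: differentiable_coef1.
have E b c : pd b (loc1 pf1 dA p c) p = partial b (loc1 pf1 a p c) x0 -
    partial b (fun y => \sum_k (loc1 pv Z p k y *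
      partial k (loc1 pf1 (fA X) p c) y
    + loc1 pf1 (fA X) p k y * partial c (loc1 pv Z p k) y)) x0.
  transitivity (partial b (fun x => loc1 pf1 a p c x -
    \sum_k (loc1 pv Z p k x * partial k (loc1 pf1 (fA X) p c) x
    + loc1 pf1 (fA X) p k x * partial c (loc1 pv Z p k) x)) x0).
    exact: near_partial (near_loc1_variation c).
  exact: partialB (dac c) (dl b c).
have EF b c : partial b (loc1 pf1 (fA X) p c) x0 - partial c (loc1 pf1 (fA X) p b) x0
    = coef2 (fF X p) b c by rewrite coef2_mktensor2.
have CL := curl_lie i j CA CZ; rewrite /= in CL.
have -> : \sum_k coef2 (z k *: 'D_(e k) hF x0) i j =
   \sum_k loc1 pv Z p k x0 * partial k (fun y => partial i (loc1 pf1 (fA X) p j) y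
     - partial j (loc1 pf1 (fA X) p i) y) x0.
  apply: eq_bigr => k _; rewrite coef2Z loc1_vec_base coef2_derive; last first.
    exact: differentiable_hF.
  congr (_ * _); apply: near_partial; apply: filterS near_hF => x; exact.
have -> : \sum_k grad i k * coef2 (fF X p) k j + \sum_k grad j k * coef2 (fF X p) i k
  = \sum_k partial i (loc1 pv Z p k) x0 *
       (partial k (loc1 pf1 (fA X) p j) x0 - partial j (loc1 pf1 (fA X) p k) x0)
  + \sum_k partial j (loc1 pv Z p k) x0 *
       (partial i (loc1 pf1 (fA X) p k) x0 - partial k (loc1 pf1 (fA X) p i) x0).
  by congr (_ + _); apply: eq_bigr => k _; rewrite EF mxE.
have alg (a1 a2 b1 b2 y c d d' : R) : d = a1 - b1 -> d' = a2 - b2 ->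
   b1 - b2 = y + c -> d - d' + y = a1 - a2 - c.
  move=> -> -> h; have -> : c = (b1 - b2) - y by rewrite h; ring.
  ring.
exact: alg (E i j) (E j i) CL.
Qed.

Lemma variation_w :
  - lie_vec Z (fw X) p + \sum_k z k *: 'D_(e k) hw x0 = act grad^T (fw X p).
Proof.
apply: tensor1P => i; rewrite coef1D coef1N coef1_sum coef1_mktensor1 coef1_act.
rewrite sumrB opprB addrC addrA.
have -> : \sum_k coef1 (z k *: 'D_(e k) hw x0) i =
    \sum_k z k * pd k (loc1 pv (fw X) p i) p.
  apply: eq_bigr => k _; rewrite coef1Z coef1_derive//.
  exact: differentiable_hw.
rewrite addrAC subrr add0r; apply: eq_bigr => k _.
by rewrite mxE mxE mulrC.
Qed.

Lemma variation_top (rho : M -> R) :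
  - lie_top Z rho p + \sum_k z k *: 'D_(e k) (in_chart (@pull_top R n : _ -> R -> R) rho p) x0
  = - (\tr grad * rho p).
Proof.
rewrite /lie_top big_split /= opprD addrAC.
rewrite [X in X + _](_ : _ = 0) ?add0r; last by rewrite addNr.
congr (- _); rewrite mulrC /mxtrace big_distrr; apply: eq_bigr => k _ /=.
by rewrite mxE.
Qed.

Lemma trmx_derive (h : 'rV[R]_n.+1 -> 'M[R]_n.+1) x v : differentiable h x ->
  (forall y, (h y)^T = h y) -> ('D_v h x)^T = 'D_v h x.
Proof.
move=> dh hs; apply/matrixP => i j; rewrite mxE -!derive_entry//.
congr ('D_v _ x); apply/funext => y.
by rewrite -{1}hs mxE.
Qed.

(** The metric is not varied, so the transport term is its whole contribution; metric compatibility
    writes it as the infinitesimal action of [connection]. *)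
Lemma variation_g :
  \sum_k z k *: 'D_(e k) hg x0 =
  connection *m fg X p + fg X p *m connection^T.
Proof.
have lg := reg_lorentz hX p.
have [gs _] := lg.
have dg := differentiable_hg hX p.
have hgs y : (hg y)^T = hg y.
  have [gys _] := reg_lorentz hX (mchartV p y).
  by rewrite /in_chart /pull_metric !trmx_mul trmxK gys mulmxA.
have := @metric_compatible _ _ (fg X p) (fun k => 'D_(e k) hg x0) (fun k => z k) gs
  (lorentzian_unit lg) (fun k => trmx_derive (e k) dg hgs).
move=> /= <-.
have E : connection = \matrix_(i, k) \sum_j (2^-1 * \sum_d invmx (fg X p) k d *
   ('D_(e i) hg x0 d j + 'D_(e j) hg x0 d i - 'D_(e d) hg x0 i j)) * z j.
  apply/matrixP => i k; rewrite !mxE; apply: eq_bigr => j _; congr (_ * _).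
  rewrite /christoffel; congr (_ * _); apply: eq_bigr => d _; congr (_ * _).
  by congr (_ + _ - _); exact: derive_entry.
by rewrite E.
Qed.

Lemma first_variationE : first_variation l X Z a p =
  contr (dl_dA l X p) (a p) + contr (dl_dF l X p) (ext_d a p)
  + \sum_i \sum_k tensor_lagrangian l X p i k * (grad + connection) i k.
Proof.
have dl := differentiable_l hls p.
have aS := admissible_state hX p.
have altF : alternating (fF X p) by exact: alternating_ext_d.
have cov G S' : 0 < \det G -> admissible S' -> f (pull_state G S') = \det G * f S'.
  move: S' => [[[[[A F] w] r] s] g] G0 [aF lg tw].
  have := @lagrangian_covariance _ _ _ l hl p p G (mdom_self p) G0 A F w r s g aF lg tw.
  have -> := jacobian_transition_id (mdom_self p).
  by rewrite mul1mx.
pose D v : R := 'd f S0 v.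
have DD u v : D (u + v) = D u + D v by rewrite /D linearD.
have DZ y v : D (y *: v) = y * D v by rewrite /D linearZ.
have D_sum (v : 'I_n.+1 -> lagr_arg R n) (y : 'I_n.+1 -> R) :
    D (\sum_k y k *: v k) = \sum_k y k * D (v k).
  by rewrite /D linear_sum; apply: eq_bigr => k _; exact: DZ.
have T_lie : lie_top Z (fun m => l m (lagr_state X m)) p =
    D (\sum_k z k *: chart_velocity k) + \tr grad * f S0.
  rewrite /lie_top big_split /= D_sum; congr (_ + _).
    apply: eq_bigr => k _; congr (_ * _); rewrite /D -chart_velocityE.
    by apply: near_partial; exact: lagrangian_in_chart.
  rewrite mulrC /mxtrace big_distrr; apply: eq_bigr => k _ /=.
  by rewrite mxE.
rewrite /first_variation T_lie deriveE//.
pose v0 : lagr_arg R n := (dA p, ext_d dA p, - lie_vec Z (fw X) p,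
  - lie_top Z (fr X) p, - lie_top Z (fs X) p, 0).
have V : v0 + \sum_k z k *: chart_velocity k =
   (a p - act grad (fA X p), ext_d a p - ad grad (fF X p), act grad^T (fw X p),
    - (\tr grad * fr X p), - (\tr grad * fs X p),
    connection *m fg X p + fg X p *m connection^T).
  rewrite tuple6_sum [LHS]tuple6D variation_A variation_F variation_w !variation_top.
  by rewrite add0r variation_g.
have g0E Q : D (generator0 (fA X p) (fF X p) (fw X p) (fr X p) (fs X p) Q) =
    \tr Q * f S0 - \sum_i \sum_k stress f S0 i k * Q i k.
  exact: generator0E altF dl Q.
have gE K : D (generator (fA X p) (fF X p) (fw X p) (fr X p) (fs X p) (fg X p) K) =
    \tr K * f S0.
  exact: generatorE aS dl cov K.
have D0 : D (a p, ext_d a p, 0, 0, 0, 0) =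
    contr (dl_dA l X p) (a p) + contr (dl_dF l X p) (ext_d a p).
  have := @differential_slots _ _ f (fA X p) (fF X p) (fw X p) (fr X p) (fs X p) (fg X p)
    dl (a p) (ext_d a p) 0 0 0 (@alternating_ext_d _ _ M a p).
  by rewrite contr0r !mul0r !addr0.
transitivity (D v0 + (D (\sum_k z k *: chart_velocity k) + \tr grad * f S0)).
  by [].
clearbody D v0.
(* The last two terms differ only in the metric component, so together they carry the transport of
   the metric. Each generator has a known differential, and all multiples of the Lagrangian cancel
   because of the trace term from the divergence of [Z]. *)
have V2 : v0 + \sum_k z k *: chart_velocity k =
  (a p, ext_d a p, 0, 0, 0, 0)
  + (-1) *: generator0 (fA X p) (fF X p) (fw X p) (fr X p) (fs X p) grad
  + (-1) *: generator0 (fA X p) (fF X p) (fw X p) (fr X p) (fs X p) connection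
  + generator (fA X p) (fF X p) (fw X p) (fr X p) (fs X p) (fg X p) connection.
  rewrite V; apply/esym; rewrite /generator0 /generator !tuple6_scale !tuple6D !scaleN1r.
  congr (_, _, _, _, _, _).
  - by rewrite addrNK.
  - by rewrite addrNK.
  - by rewrite !opprK add0r addrK.
  - by rewrite /= add0r addrNK.
  - by rewrite /= add0r addrNK.
  - by rewrite /= !oppr0 !add0r.
rewrite addrA -DD V2 !DD !DZ !g0E gE D0 !mulN1r.
have -> : \sum_i \sum_k tensor_lagrangian l X p i k * (grad + connection) i k =
    \sum_i \sum_k stress f S0 i k * grad i k +
    \sum_i \sum_k stress f S0 i k * connection i k.
  have splitE (Y N K : 'M[R]_n.+1) : \sum_i \sum_k Y i k * (N + K) i k =
      \sum_i \sum_k Y i k * N i k + \sum_i \sum_k Y i k * K i k.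
    rewrite -big_split; apply: eq_bigr => i _ /=; rewrite -big_split.
    by apply: eq_bigr => k _ /=; rewrite mxD mulrDr.
  exact: splitE.
set t1 := \sum_i _; set t2 := \sum_i _; ring.
Qed.

Definition flux (T : 'M[R]_n.+1) (Y : tensor R n 1) (L : tensor R n 2)
    (b : tensor R n 1) : tensor R n 1 :=
  mktensor1 (fun i => \sum_k (T i k * coef1 Y k + coef2 L i k * coef1 b k)).

Lemma vec_flux T Y L b : vec (flux T Y L b) = vec Y *m T^T + vec b *m (mat L)^T.
Proof.
apply/rowP => i; rewrite !mxE coef1_mktensor1 big_split; congr (_ + _).
  by apply: eq_bigr => k _; rewrite !mxE mulrC.
by apply: eq_bigr => k _; rewrite !mxE mulrC.
Qed.

Lemma vecZ y (t : tensor R n 1) : vec (y *: t) = y *: vec t.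
Proof. by apply/rowP => i; rewrite !mxE coef1Z. Qed.

(** In both products an upper index meets a lower one, so the Jacobian factors cancel and a vector
    density remains. *)
Lemma flux_pull K T Y L b : K \in unitmx ->
  pull_mvdens K (flux T Y L b) =
  flux (pull_dens11 K T) (pv K Y) (pull_mvdens K L) (pf1 K b).
Proof.
move=> Ku; apply: vec_inj.
rewrite vec_flux /pull_mvdens /pull_vec /pull_form /pull_dens11 vecZ matZ mat_act !vec_act.
have trZ y (W : 'M[R]_n.+1) : (y *: W)^T = y *: W^T by rewrite linearZ.
rewrite vec_flux !trZ !trmx_mul !trmxK -!scalemxAr -scalerDr mulmxDl !mulmxA.
congr (_ *: (_ + _)); first by rewrite mulmxKV.
have -> : vec b *m K^T *m (invmx K)^T = vec b.
  by rewrite -mulmxA -trmx_mul mulVmx// trmx1 mulmx1.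
by [].
Qed.

Lemma boundary_flux_in_chart (T : M -> 'M[R]_n.+1) :
  \forall x \near x0, in_chart (@pull_mvdens R n 1) (boundary_flux l X T Z a) p x =
  flux (in_chart (@pull_dens11 R n) T p x) (in_chart pv Z p x)
    (slotF f (chart_state X p x)) (in_chart pf1 a p x).
Proof.
apply: near_chart (slotF_in_chart hl hX hls p) => m pm <-.
rewrite !in_chartE//; apply: flux_pull.
exact: jacobian_transition_unit pm (mdom_self m).
Qed.

Lemma contr2_curl (L : tensor R n 2) (d : 'I_n.+1 -> 'I_n.+1 -> R) : alternating L ->
  contr L (mktensor2 (fun i j => d i j - d j i)) =
  \sum_i \sum_j coef2 L i j * d i j.
Proof.
move=> aL; set Y := RHS.
have E2 : \sum_i \sum_j coef2 L i j * d j i = - Y.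
  rewrite exchange_big -sumrN; apply: eq_bigr => i _ /=; rewrite -sumrN.
  by apply: eq_bigr => j _; rewrite (alternating2 _ _ aL) mulNr.
rewrite /contr sum_tuple2.
transitivity (2^-1 * (Y - - Y)); last by field.
congr (_ * _); rewrite -E2 /Y -sumrB; apply: eq_bigr => i _; rewrite -sumrB.
apply: eq_bigr => j _; rewrite -mulrBr.
by rewrite -[coef (mktensor2 _) _]/(coef2 (mktensor2 _) i j) coef2_mktensor2.
Qed.

(** Leibniz rule: the derivatives of [T] and of the derivative in [F], produced by the divergence of
    the flux, cancel against those in the divergence of [T] and in [maxwell]. The Christoffel term
    of the former completes the gradient of [Z] to a covariant derivative. *)
Lemma divergence_expansion (T : M -> 'M[R]_n.+1) :
  differentiable (in_chart (@pull_dens11 R n) T p) x0 ->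
  - contr (Z p) (div_dens11 (fg X) T p) + contr (maxwell l X p) (a p)
      + div_vdens (boundary_flux l X T Z a) p =
  contr (dl_dA l X p) (a p) + contr (dl_dF l X p) (ext_d a p)
  + \sum_i \sum_k T p i k * (grad + connection) i k.
Proof.
move=> dT; set hT := in_chart _ T p in dT *.
have altL : alternating (dl_dF l X p).
  by apply: (@alternating_slotF _ _ f _ _ _ _ _ _ (differentiable_l hls p)).
have hT0 : hT x0 = T p.
  apply: in_chart_base.
  by rewrite /pull_dens11 det1 scale1r invmx1 trmx1 mul1mx mulmx1.
pose L i k x := coef2 (slotF f (chart_state X p x)) i k.
have dL i k : differentiable (L i k) x0 by exact: differentiable_coef2_slotF.
have L0 i k : L i k x0 = coef2 (dl_dF l X p) i k.
  by rewrite /L chart_state0.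
have dTik i k : differentiable (fun x => hT x i k) x0 by exact: differentiable_entry.
have dZk k : differentiable (loc1 pv Z p k) x0 by exact: differentiable_coef1.
have dak k : differentiable (loc1 pf1 a p k) x0 by exact: differentiable_coef1.
have E1 : div_vdens (boundary_flux l X T Z a) p = \sum_i \sum_k
   (partial i (fun x => hT x i k) x0 * z k + T p i k * grad i k
    + (partial i (L i k) x0 * coef1 (a p) k
       + coef2 (dl_dF l X p) i k * partial i (loc1 pf1 a p k) x0)).
  apply: eq_bigr => i _.
  transitivity (partial i (fun x => \sum_k (hT x i k * loc1 pv Z p k x
      + L i k x * loc1 pf1 a p k x)) x0).
    apply: near_partial; apply: filterS (boundary_flux_in_chart T) => x E.
    by rewrite /loc1 E coef1_mktensor1.
  rewrite partial_sum => [|k]; last by apply: differentiableD; exact: differentiableM.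
  apply: eq_bigr => k _.
  rewrite partialD; [|exact: differentiableM|exact: differentiableM].
  rewrite (partialM i (dTik i k) (dZk k)) (partialM i (dL i k) (dak k)).
  by rewrite L0 hT0 loc1_vec_base loc1_form_base mxE.
have E2 : contr (Z p) (div_dens11 (fg X) T p) =
    \sum_i \sum_k (partial i (fun x => hT x i k) x0 * z k - T p i k * connection i k).
  rewrite contr1E.
  transitivity (\sum_j (\sum_i partial i (fun x => hT x i j) x0 * z j) -
     \sum_j (\sum_i \sum_k christoffel (fg X) p k i j * T p i k * z j)).
    rewrite -sumrB; apply: eq_bigr => j _; rewrite coef1_mktensor1 mulrBr; congr (_ - _).
      by rewrite big_distrr; apply: eq_bigr => i _; rewrite mulrC.
    rewrite big_distrr; apply: eq_bigr => i _ /=; rewrite big_distrr.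
    by apply: eq_bigr => k _ /=; rewrite mulrC.
  transitivity (\sum_i \sum_k partial i (fun x => hT x i k) x0 * z k -
     \sum_i \sum_k T p i k * connection i k).
    congr (_ - _); first by rewrite exchange_big.
    rewrite exchange_big; apply: eq_bigr => i _ /=; rewrite exchange_big.
    apply: eq_bigr => k _ /=; rewrite mxE big_distrr.
    by apply: eq_bigr => j _ /=; ring.
  by rewrite -sumrB; apply: eq_bigr => i _; rewrite -sumrB.
have E3 : contr (maxwell l X p) (a p) = contr (dl_dA l X p) (a p)
    - \sum_i \sum_k partial i (L i k) x0 * coef1 (a p) k.
  rewrite !contr1E exchange_big -sumrB; apply: eq_bigr => k _ /=.
  rewrite coef1D coef1N coef1_mktensor1 mulrDl mulNr big_distrl; congr (_ - _).
  apply: eq_bigr => i _ /=; congr (_ * _).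
  apply: near_partial; apply: filterS (slotF_in_chart hl hX hls p) => x E.
  by rewrite E.
have E4 : contr (dl_dF l X p) (ext_d a p) =
   \sum_i \sum_k coef2 (dl_dF l X p) i k * partial i (loc1 pf1 a p k) x0.
  exact: (contr2_curl (fun i j => pd i (loc1 pf1 a p j) p)).
rewrite E1 E2 E3 E4.
under [X in _ = _ + X]eq_bigr do under eq_bigr do rewrite mxD mulrDr.
have S2 (u v : 'I_n.+1 -> 'I_n.+1 -> R) : \sum_i \sum_k (u i k + v i k) =
   \sum_i \sum_k u i k + \sum_i \sum_k v i k.
  by rewrite -big_split; apply: eq_bigr => i _; rewrite big_split.
have S3 (u : 'I_n.+1 -> 'I_n.+1 -> R) : \sum_i \sum_k - u i k = - \sum_i \sum_k u i k.
  by rewrite -sumrN; apply: eq_bigr => i _; rewrite sumrN.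
rewrite !S2 S3.
have alg (u v y t c b : R) :
  - (u - v) + (b - y) + (u + t + (y + c)) = b + c + (t + v) by ring.
exact: alg.
Qed.

End Fields.

Lemma act0 (d : nat) (G : 'M[R]_n.+1) : act G (0 : tensor R n d) = 0.
Proof. by rewrite -[X in act G X](scale0r 0) actZ scale0r. Qed.

Lemma smooth_form0 : smooth_field_at pf1 (fun=> 0) p.
Proof.
move=> d; apply: C_at_near (C_at_cst d 0 x0); apply: filterE => x.
by rewrite /in_chart /pull_form act0.
Qed.

(** In the chart at [p] this is a coordinate difference times a basis vector. Outside the domain of
    that chart the formula has no geometric meaning, but only the germ at [p] is tested. *)
Definition linear_field (i0 k0 : 'I_n.+1) : M -> tensor R n 1 := fun m =>
  pv ('J (transition m p) (mchart m m))
    ((mchart p m ord0 i0 - x0 ord0 i0) *: wedge_basis R [tuple k0]).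

Lemma linear_field_in_chart i0 k0 : \forall x \near x0,
  in_chart pv (linear_field i0 k0) p x =
  (x ord0 i0 - x0 ord0 i0) *: wedge_basis R [tuple k0].
Proof.
apply: (@near_chart _ _ _ _ (fun=> True)) => [m pm _|]; last exact: filterT.
rewrite in_chartE// /linear_field -functorial_vec; last 2 first.
- exact: jacobian_transition_unit pm (mdom_self m).
- exact: jacobian_transition_unit (mdom_self m) pm.
have -> := jacobian_transitionK pm (mdom_self m).
exact: pull_vec1.
Qed.

Lemma smooth_linear_field i0 k0 : smooth_field_at pv (linear_field i0 k0) p.
Proof.
move=> d; apply: (@C_at_near _ _ _ _ (fun x =>
    (x ord0 i0 - x0 ord0 i0) *: (wedge_basis R [tuple k0] : tensor R n 1))).
  by apply: filterS (linear_field_in_chart i0 k0) => x ->.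
apply: C_atZl; apply: C_atD; last exact: C_at_cst.
by apply: (C_at_entry ord0 i0); exact: smooth_at_id.
Qed.

Lemma linear_field0 i0 k0 : linear_field i0 k0 p = 0.
Proof. by rewrite /linear_field subrr scale0r /pull_vec act0. Qed.

(** One entry of the gradient is isolated, so testing with this field compares one entry of the two
    tensors. *)
Lemma grad_linear_field i0 k0 : grad (linear_field i0 k0) = delta_mx i0 k0.
Proof.
apply/matrixP => i k; rewrite mxE.
transitivity (partial i (fun x => (x ord0 i0 - x0 ord0 i0) * (k0 == k)%:R) x0).
  apply: near_partial; apply: filterS (linear_field_in_chart i0 k0) => x.
  by rewrite /loc1 => ->; rewrite coef1Z coef1_wedge_basis.
apply: derive_line => h; rewrite !mxE eqxx /= -[h *: _]/(h * _).
by rewrite (eq_sym i i0) (eq_sym k k0) -mulnb natrM; ring.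
Qed.

Lemma stress_unique (T : M -> 'M[R]_n.+1) :
  differentiable (in_chart (@pull_dens11 R n) T p) x0 ->
  (forall Z a, smooth_field_at pv Z p -> smooth_field_at pf1 a p ->
    first_variation l X Z a p
    = - contr (Z p) (div_dens11 (fg X) T p) + contr (maxwell l X p) (a p)
      + div_vdens (boundary_flux l X T Z a) p) ->
  T p = tensor_lagrangian l X p.
Proof.
move=> dT HT; apply/matrixP => i0 k0.
have sZ := smooth_linear_field i0 k0; have s0 := smooth_form0.
have := HT _ _ sZ s0.
rewrite first_variationE// divergence_expansion// => /addrI.
have -> : grad (linear_field i0 k0) + connection (linear_field i0 k0) = delta_mx i0 k0.
  rewrite grad_linear_field -[RHS]addr0; congr (_ + _); apply/matrixP => i k.
  by rewrite !mxE big1// => j _; rewrite linear_field0 coef10 mulr0.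
have E (Y : 'M[R]_n.+1) : \sum_i \sum_k Y i k * (delta_mx i0 k0 : 'M[R]_n.+1) i k = Y i0 k0.
  rewrite (bigD1 i0)//= [X in _ + X]big1 => [|i ii].
    rewrite addr0 (bigD1 k0)//= [X in _ + X]big1 => [|k kk].
      by rewrite mxE !eqxx mulr1 addr0.
    by rewrite mxE (negbTE kk) andbF mulr0.
  by rewrite big1// => k _; rewrite mxE (negbTE ii) mulr0.
by rewrite !E => ->.
Qed.

End Variation.

Lemma stress_energy_momentumP (R : realType) n (M : oriented_manifold R n.+1)
    (l : lagrangian M) (X : fluid_fields M) (T : M -> 'M[R]_n.+1) :
  covariant_lagrangian l -> regular_fields X ->
  (forall p, smooth_at (l p) (lagr_state X p)) ->
  stress_energy_momentum l X T <-> (forall p, T p = tensor_lagrangian l X p).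
Proof.
move=> hl hX hls; split=> [H p|HT p].
  by have [dT HT] := H p; exact: stress_unique.
have -> : T = tensor_lagrangian l X by exact/funext.
(* The characterization of [T] includes differentiability in the chart; for expression (i) it comes
   from the expression at the chart state. *)
have dT : differentiable (in_chart (@pull_dens11 R n) (tensor_lagrangian l X) p) (mchart p p).
  apply: near_eq_differentiable (differentiable_stress hX hls p).
  by apply: filterS (stress_in_chart hl hX hls p) => x ->.
split=> // Z a sZ sa.
by rewrite first_variationE// divergence_expansion.
Qed.

(** * Proper quantities and differentiability of the electric and magnetic forms *)

Section ProperQuantities.
Context {R : realType} {n : nat} (c : R).
Hypothesis c0 : 0 < c.
Variables (g : 'M[R]_n.+1) (w : tensor R n 1).
Hypothesis gL : lorentzian g.
Hypothesis tw : timelike g w.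

Lemma contrZl y (v t : tensor R n 1) : contr (y *: v) t = y * contr v t.
Proof. by rewrite contr1C contrZr contr1C. Qed.

(** The normalizations of velocity and density cancel against the volume factor, so the charge term
    is polynomial in the generalized quantities and its derivatives are immediate. *)
Lemma proper_charge q r A :
  q * proper_density c g w r * contr (proper_velocity c g w) A * vol g =
  q * r * contr w A.
Proof.
rewrite /proper_density /proper_velocity contrZl.
have N0 : Num.sqrt (- sqnorm g w) != 0 by rewrite gt_eqF// N_gt0.
have V0 : vol g != 0 by rewrite gt_eqF// vol_gt0.
have c1 : c != 0 by rewrite gt_eqF.
by field; rewrite c1 V0 N0.
Qed.

Lemma sqnorm_proper_velocity : sqnorm g (proper_velocity c g w) = - c ^+ 2.
Proof.
have N0 : Num.sqrt (- sqnorm g w) != 0 by rewrite gt_eqF// N_gt0.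
have NN : Num.sqrt (- sqnorm g w) ^+ 2 = - sqnorm g w.
  by rewrite sqr_sqrtr// ltW// oppr_gt0.
rewrite /proper_velocity /sqnorm /flat actZ contrZr contrZl.
rewrite -/(flat g w) -/(sqnorm g w); move: (Num.sqrt _) N0 NN => N N0 NN.
have -> : sqnorm g w = - N ^+ 2 by rewrite NN opprK.
by field.
Qed.

End ProperQuantities.

Lemma differentiable_fst (R : realType) (V W : normedModType R) (x : V * W) :
  differentiable (fst : V * W -> V) x.
Proof. by apply: linear_differentiable => y; exact: cvg_fst. Qed.

Lemma differentiable_snd (R : realType) (V W : normedModType R) (x : V * W) :
  differentiable (snd : V * W -> W) x.
Proof. by apply: linear_differentiable => y; exact: cvg_snd. Qed.

Lemma differentiable_electric (R : realType) n (V : normedModType R) (c : R)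
    (u : V -> tensor R n 1) (F : V -> tensor R n 2) x :
  differentiable u x -> differentiable F x ->
  differentiable (fun y => electric c (u y) (F y)) x.
Proof.
move=> du dF; apply: differentiable_mx => a b.
apply: (@near_eq_differentiable _ _ _ (fun y => - c^-1 *
    \sum_i coef (u y) [tuple i] * coef (F y) [tuple of i :: enum_val b])).
  by apply: filterE => y; rewrite [RHS]mxE [X in _ = _ * X]mxE.
apply: differentiableM => //; apply: differentiable_sumf => i.
by apply: differentiableM; exact: differentiable_entry.
Qed.

Lemma differentiable_mag (R : realType) k (V : normedModType R) (c : R)
    (g : 'M[R]_k.+3) (u : V -> tensor R k.+2 1) (F : V -> tensor R k.+2 2) x :
  differentiable u x -> differentiable F x ->
  differentiable (fun y => mag c g (u y) (F y) : tensor R k.+2 k) x.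
Proof.
move=> du dF; apply: differentiable_mx => a b.
have -> : (fun y => (mag c g (u y) (F y) : tensor R k.+2 k) a b) =
    (fun y => \sum_i \sum_j \sum_l
   (- c^-1 * vol g * 2^-1 * coef2 (sharp g (F y)) i j * coef1 (u y) l)
     * (lc_tensor i j l : tensor R k.+2 k) a b).
  apply/funext => y; rewrite magE.
  rewrite summxE; apply: eq_bigr => i _; rewrite summxE; apply: eq_bigr => j _.
  by rewrite summxE; apply: eq_bigr => l _; rewrite [LHS]mxE.
do 3 (apply: differentiable_sumf => ?); apply: differentiableM => //.
apply: differentiableM; last exact: differentiable_entry.
apply: differentiableM => //.
apply: (@near_eq_differentiable _ _ _ (fun y => \sum_d \sum_e
   invmx g _ d * invmx g _ e * coef (F y) [tuple d; e])).
  by apply: filterE => y; rewrite coef2_act.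
do 2 (apply: differentiable_sumf => ?); apply: differentiableM => //.
exact: differentiable_entry.
Qed.

Lemma differentiable_eps_en (R : realType) k (c : R) (g : 'M[R]_k.+3)
    (eps : R * R * tensor R k.+2 1 * tensor R k.+2 k * 'M[R]_k.+3 -> R) rho sig u F :
  differentiable eps (rho, sig, electric c u F, mag c g u F : tensor R k.+2 k, g) ->
  differentiable (eps_en c g eps) (rho, sig, u, F).
Proof.
set x := (rho, sig, u, F); pose T := (R * R * tensor R k.+2 1 * tensor R k.+2 2)%type.
move=> deps.
have d1 : differentiable (fun z : T => z.1.1) x.
  exact: (differentiable_comp (differentiable_fst _) (differentiable_fst _)).
have d2 : differentiable (fun z : T => z.1.2) x.
  exact: (differentiable_comp (differentiable_fst _) (differentiable_snd _)).
have d3 : differentiable (fun z : T => z.2) x by exact: differentiable_snd.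
have d4 : differentiable (fun z : T => z.1.1.1) x.
  exact: (differentiable_comp d1 (differentiable_fst _)).
have d5 : differentiable (fun z : T => z.1.1.2) x.
  exact: (differentiable_comp d1 (differentiable_snd _)).
have d6 := differentiable_electric c d2 d3.
have d7 := differentiable_mag c g d2 d3.
have d8 := differentiable_pair (differentiable_pair (differentiable_pair
  (differentiable_pair d4 d5) d6) d7) (differentiable_cst g x).
exact: (@differentiable_comp _ _ _ _ _ eps x d8 deps).
Qed.

(** The equation n = k.+2 is kept because (n - 2).+2 does not reduce to n. *)
Section EpsLagrangian.
Context {R : realType} (n k : nat) (nk : n = k.+2) (c q : R).
Local Notation T1 := (tensor R n 1).
Local Notation T2 := (tensor R n 2).
Hypothesis c0 : 0 < c.
Variable g : 'M[R]_n.+1.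
Hypothesis gL : lorentzian g.
Variable eps : R * R * T1 * tensor R n k * 'M[R]_n.+1 -> R.
Local Notation magn := (fun u F => - c^-1 *: iprod u (hodge k.+1 g F) : tensor R n k).
Hypothesis cov : forall G rho s E B, G \in unitmx -> alternating B ->
  eps (rho, s, act G E, act G B, G *m g *m G^T) = eps (rho, s, E, B, g).
Variable L : T1 -> T2 -> T1 -> R -> R -> R.
Hypothesis HL : forall A F w r s, alternating F -> timelike g w ->
  let u := proper_velocity c g w in
  L A F w r s = - eps (proper_density c g w r, proper_density c g w s,
    electric c u F, magn u F, g) * vol g - q * proper_density c g w r * contr u A * vol g.
Variables (A : T1) (F : T2) (w : T1) (r s : R).
Hypothesis altF : alternating F.
Hypothesis tw : timelike g w.
Local Notation u := (proper_velocity c g w).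
Local Notation rho := (proper_density c g w r).
Local Notation sig := (proper_density c g w s).
Local Notation E := (electric c u F).
Local Notation B := (magn u F).
Hypothesis deps : differentiable eps (rho, sig, E, B, g).

Lemma lagrangian_tensor_eps :
  let e := eps (rho, sig, E, B, g) in
  let e_rho := derive1 (fun y : R => eps (y, sig, E, B, g)) rho in
  let e_s := derive1 (fun y : R => eps (rho, y, E, B, g)) sig in
  let e_E := pderiv (fun E' => eps (rho, sig, E', B, g)) E in
  let e_B := pderiv (fun B' => eps (rho, sig, E, B', g)) B in
  let S : tensor R n 1 := ((-1) ^+ n * c^-1) *:
    iprod (sharp g E) (iprod u (hodge 3 g (flat g e_B))) in
  (L A F w r s - r * derive1 (fun r => L A F w r s) r
    - s * derive1 (fun s => L A F w r s) s) *: 1%:M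
  + trtens w (pderiv (fun w => L A F w r s) w)
  - trtens (pderiv (fun A => L A F w r s) A) A
  - trtens (pderiv (fun F => L A F w r s) F) F =
  vol g *:
    ((e - contr e_E E) *: (c ^- 2 *: uu g u)
     + c^-1 *: (trtens u S + trtens (sharp g S) (flat g u))
     + trtens e_E E - trtens (sharp g B) (flat g e_B)
     + (e_rho * rho + e_s * sig + contr e_B B - e) *: proj_orth c g u).
Proof.
subst n; move=> e e_rho e_s e_E e_B S.
have [gs _] := gL.
have c1 : c != 0 by rewrite gt_eqF.
have un := sqnorm_proper_velocity c tw.
pose h := eps_en c g eps.
have dh : differentiable h (rho, sig, u, F) by exact: differentiable_eps_en.
(* With [h] as energy density in (u, F), the Lagrangian takes the form already treated, and what is
   left is the change of variables in the tensor. *)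
have HL' A' F' w' r' s' : alternating F' -> timelike g w' ->
    L A' F' w' r' s' = - h (proper_density c g w' r', proper_density c g w' s',
      proper_velocity c g w', F') * vol g - q * r' * contr w' A'.
  by move=> aF' tw'; rewrite HL// proper_charge.
rewrite (lagrangian_tensor_en c0 gL HL' A altF tw dh); congr (_ *: _).
apply: (tensor_en_eps c0 gL altF un deps) => B' aB'.
by apply: cov => //; exact: reflection_unit.
Qed.

End EpsLagrangian.

(** * Agreement of the three expressions and conclusion *)

Section EquivalentTensors.
Context {R : realType} {n : nat} (M : oriented_manifold R n.+1) (c q : R).
Hypothesis c0 : 0 < c.
Variables (l : lagrangian M) (X : fluid_fields M).
Hypothesis hX : regular_fields X.

Lemma tensor_lagrangian_en (e : en_density M) p :
  differentiable (e p) (en_state c X p) -> lagrangian_of_en c q l e ->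
  tensor_lagrangian l X p = tensor_en c e X p.
Proof.
move=> de hle; have gL := reg_lorentz hX p; have tw := reg_timelike hX p.
pose g := fg X p.
pose h (z : R * R * tensor R n 1 * tensor R n 2) := e p (z.1.1.1, z.1.1.2, z.1.2, z.2, g).
have aF : alternating (fF X p) by exact: alternating_ext_d.
have dh : differentiable h (frho c X p, fsig c X p, fu c X p, fF X p).
  apply: (@differentiable_comp _ _ _ _ (fun z : R * R * tensor R n 1 * tensor R n 2 =>
    (z, g)) (fun y => e p (y.1.1.1.1, y.1.1.1.2, y.1.1.2, y.1.2, y.2))).
    exact: differentiable_pair.
  have -> : (fun y => e p (y.1.1.1.1, y.1.1.1.2, y.1.1.2, y.1.2, y.2)) = e p.
    by apply/funext => -[[[[y1 y2] y3] y4] y5].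
  exact: de.
have HL A F w r s : alternating F -> timelike g w ->
    l p (A, F, w, r, s, g) = - h (proper_density c g w r, proper_density c g w s,
      proper_velocity c g w, F) * vol g - q * r * contr w A.
  by move=> aF' tw'; rewrite hle// proper_charge.
exact: (lagrangian_tensor_en (L := fun A F w r s => l p (A, F, w, r, s, g))
  c0 gL HL (fA X p) aF tw dh).
Qed.

Lemma tensor_lagrangian_eps (eps : eps_density M) p : (2 <= n)%N ->
  covariant_eps eps -> differentiable (eps p) (eps_state c X p) ->
  lagrangian_of_eps c q l eps ->
  tensor_lagrangian l X p = tensor_eps c eps X p.
Proof.
move=> n2 he de hle; have gL := reg_lorentz hX p; have tw := reg_timelike hX p.
have aF : alternating (fF X p) by exact: alternating_ext_d.
have nk : n = (n - 2).+2 by rewrite -addn2 subnK.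
have cov G rho s E B : G \in unitmx -> alternating B ->
    eps p (rho, s, act G E, act G B, G *m fg X p *m G^T) = eps p (rho, s, E, B, fg X p).
  by move=> Gu aB; exact: eps_covariance.
exact: (lagrangian_tensor_eps (L := fun A F w r s => l p (A, F, w, r, s, fg X p))
  nk c0 gL cov (fun A F w r s aF' tw' => hle p A F w r s (fg X p) aF' gL tw')
  (fA X p) aF tw de).
Qed.

End EquivalentTensors.

Theorem proposition4p4 (R : realType) (n : nat) (hn : (2 <= n)%N)
    (M : oriented_manifold R n.+1) (c q : R) (hc : 0 < c)
    (X : fluid_fields M) (hX : regular_fields X)
    (l : lagrangian M) (hl : covariant_lagrangian l)
    (hls : forall p, smooth_at (l p) (lagr_state X p))
    (T : M -> 'M[R]_n.+1) :
  [/\ stress_energy_momentum l X T <-> (forall p, T p = tensor_lagrangian l X p),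
      forall eps : eps_density M,
        covariant_eps eps ->
        (forall p, differentiable (eps p) (eps_state c X p)) ->
        lagrangian_of_eps c q l eps ->
        stress_energy_momentum l X T <-> (forall p, T p = tensor_eps c eps X p)
    & forall e : en_density M,
        covariant_en e ->
        (forall p, differentiable (e p) (en_state c X p)) ->
        lagrangian_of_en c q l e ->
        stress_energy_momentum l X T <-> (forall p, T p = tensor_en c e X p)].
Proof.
split=> [|eps he deps hle|e he de hle].
- exact: stress_energy_momentumP.
- rewrite stress_energy_momentumP//; split=> H p; rewrite H;
    by rewrite (tensor_lagrangian_eps hc hX hn he (deps p) hle).
- rewrite stress_energy_momentumP//; split=> H p; rewrite H;
    by rewrite (tensor_lagrangian_en hc hX (de p) hle).
Qed.
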